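(* Let $X$ be a smooth, projective, absolutely irreducible variety over the field $\mathbf{R}$ of real numbers such that the set $X(\mathbf{R})$ of real points is not empty, and let $K=\mathbf{R}(X)$ be its function field. Let $D(X)\subset K^*$ be the multiplicative subgroup of all $f\in K^*$ such that for every point $M$ of the scheme $X$ one can write $f=u\cdot g$ with $u\in O_{X,M}^*$ a unit of the local ring $O_{X,M}$ and $g\in K^*$ a sum of squares of elements of $K$. Then the squaring map $x\mapsto x^2$ induces an exact sequence of abelian groups $$1\to\{\pm1\}\to D(X)/(K^*\cap\textstyle\sum K^2)\to (K^{*2}\cap\sum K^4)/(K^*\cap\sum K^2)^2\to 1,$$ where the map from $\{\pm 1\}$ is induced by the inclusion $\{\pm1\}\subset D(X)$.
   Context: For a field $K$ and a positive integer $n$, $\sum K^n$ denotes the set of all finite sums of $n$-th powers of elements of $K$, and $K^{*2}$ denotes the group of nonzero squares in $K$. Thus $K^*\cap\sum K^2$ is the multiplicative group of nonzero sums of squares in $K$, and $(K^*\cap\sum K^2)^2$ is the group of squares $g^2$ of elements $g\in K^*\cap\sum K^2$; it is a subgroup of $K^{*2}\cap\sum K^4$ (this follows from Becker's theorem that, for $n$ even, $f\in K^*$ is a sum of $n$-th powers in $K$ if and only if $f$ is a sum of squares in $K$ and $n$ divides $v(f)$ for every Krull valuation $v$ of $K$ with formally real residue field). ''Point of $X$'' is meant in the scheme-theoretic sense (points are not necessarily closed). For $M\in X$, the local ring $O_{X,M}$ is viewed as a subring of the function field $K=\mathbf{R}(X)$. *)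

(* Defs.v *)
From HB Require Import structures.
From mathcomp Require Import all_boot all_order all_algebra.
From mathcomp Require Import mpoly complex boolp reals.

Set Implicit Arguments.
Unset Strict Implicit.
Unset Printing Implicit Defensive.

Import GRing.Theory.
Local Open Scope ring_scope.
Local Open Scope quotient_scope.

Definition Kstar (K : fieldType) := {x : K | x != 0}.
HB.instance Definition _ (K : fieldType) := SubChoice.on (Kstar K).

Section KstarGroup.
Variable K : fieldType.
Implicit Types x y z : Kstar K.

Definition Kstar_one : Kstar K := Sub 1 (oner_neq0 K).
Definition Kstar_mul x y : Kstar K :=
  Sub (val x * val y) (mulf_neq0 (valP x) (valP y)).
Fact Kstar_inv_subproof x : (val x)^-1 != 0.
Proof. by rewrite invr_eq0 (valP x). Qed.
Definition Kstar_inv x : Kstar K := Sub (val x)^-1 (Kstar_inv_subproof x).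

Fact Kstar_mulA : associative Kstar_mul.
Proof. by move=> x y z; apply: val_inj; rewrite /= mulrA. Qed.
Fact Kstar_mul1 : left_id Kstar_one Kstar_mul.
Proof. by move=> x; apply: val_inj; rewrite /= mul1r. Qed.
Fact Kstar_mulr1 : right_id Kstar_one Kstar_mul.
Proof. by move=> x; apply: val_inj; rewrite /= mulr1. Qed.
Fact Kstar_mulV : left_inverse Kstar_one Kstar_inv Kstar_mul.
Proof. by move=> x; apply: val_inj; rewrite /= mulVf // (valP x). Qed.
Fact Kstar_mulrV : right_inverse Kstar_one Kstar_inv Kstar_mul.
Proof. by move=> x; apply: val_inj; rewrite /= mulfV // (valP x). Qed.

HB.instance Definition _ := isGroup.Build (Kstar K)
  Kstar_mulA Kstar_mul1 Kstar_mulr1 Kstar_mulV Kstar_mulrV.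

Lemma Kstar_mulC x y : (x * y = y * x)%g.
Proof. by apply: val_inj; apply: mulrC. Qed.

Lemma val_Kstar1 : val (1%g : Kstar K) = 1. Proof. by []. Qed.
Lemma val_KstarM x y : val (x * y)%g = val x * val y. Proof. by []. Qed.
Lemma val_KstarV x : val (x^-1)%g = (val x)^-1. Proof. by []. Qed.

End KstarGroup.

Section SubQuotient.
Variable K : fieldType.

Definition subgroup (A : groupClosed (Kstar K)) := {x : Kstar K | x \in A}.

Section Subgroup.
Variable A : groupClosed (Kstar K).
HB.instance Definition _ := SubChoice.on (subgroup A).
Fact subgroup_closed : group_closed (A : {pred Kstar K}).
Proof. by split=> [|x y]; [exact: gpred1 | exact: gpredF]. Qed.
HB.instance Definition _ :=
  SubChoice_isSubGroup.Build (Kstar K) (fun x => x \in A) (subgroup A)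
    subgroup_closed.
End Subgroup.

Variables A B : groupClosed (Kstar K).

Definition subquot_equiv (x y : subgroup A) := (val x / val y)%g \in B.

Fact subquot_equivP : equiv_class_of subquot_equiv.
Proof.
split=> [x|x y|y x z]; rewrite /subquot_equiv.
- by rewrite divgg gpred1.
- by rewrite gpredFC.
- move=> xy yz; have -> : (val x / val z = val x / val y * (val y / val z))%g.
    by rewrite mulgA divgK.
  exact: gpredM.
Qed.
Canonical subquot_equiv_equiv := EquivRelPack subquot_equivP.
Canonical subquot_encModRel := defaultEncModRel subquot_equiv.

(* The quotient group A/(A :&: B), which is A/B for B contained in A.  The
   inclusion of sosK2 K in sq_so4K K below, for K of characteristic 0, is
   Hilbert's identity. *)
Definition subquot := {eq_quot subquot_equiv}.
HB.instance Definition _ : EqQuotient _ subquot_equiv subquot :=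
  EqQuotient.on subquot.
HB.instance Definition _ := Choice.on subquot.

Lemma subquot_eqP (x y : subgroup A) :
  reflect (\pi_subquot x = \pi_subquot y) ((val x / val y)%g \in B).
Proof. by apply: (iffP idP) => [xy|/eqmodP//]; apply/eqmodP. Qed.

Definition subquot_one : subquot := \pi_subquot 1%g.
Definition subquot_mul (x y : subquot) : subquot := \pi_subquot (repr x * repr y)%g.
Definition subquot_inv (x : subquot) : subquot := \pi_subquot ((repr x)^-1)%g.

Lemma repr_subquot (x : subgroup A) :
  (val (repr (\pi_subquot x)) / val x)%g \in B.
Proof. by apply/subquot_eqP; rewrite reprK. Qed.

Lemma subquot_piM (x y : subgroup A) :
  subquot_mul (\pi_subquot x) (\pi_subquot y) = \pi_subquot (x * y)%g.
Proof.
apply/subquot_eqP; rewrite !valM.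
set a := val (repr _); set b := val (repr _).
have -> : (a * b / (val x * val y) = (a / val x) * (b / val y))%g.
  by apply: val_inj; rewrite !(val_KstarM, val_KstarV) invfM mulrACA.
by apply: gpredM; apply: repr_subquot.
Qed.

Lemma subquot_piV (x : subgroup A) :
  subquot_inv (\pi_subquot x) = \pi_subquot (x^-1)%g.
Proof.
apply/subquot_eqP; have valV (y : subgroup A) : val (y^-1)%g = (val y)^-1%g.
  by apply/(mulgI (val y)); rewrite -valM !mulgV val1.
rewrite !valV invgK Kstar_mulC gpredFC; exact: repr_subquot.
Qed.

Fact subquot_mulA : associative subquot_mul.
Proof.
elim/quotW=> x; elim/quotW=> y; elim/quotW=> z.
by rewrite (subquot_piM y z) (subquot_piM x y) !subquot_piM mulgA.
Qed.
Fact subquot_mul1 : left_id subquot_one subquot_mul.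
Proof. by elim/quotW=> x; rewrite subquot_piM mul1g. Qed.
Fact subquot_mulr1 : right_id subquot_one subquot_mul.
Proof. by elim/quotW=> x; rewrite subquot_piM mulg1. Qed.
Fact subquot_mulV : left_inverse subquot_one subquot_inv subquot_mul.
Proof. by elim/quotW=> x; rewrite subquot_piV subquot_piM mulVg. Qed.
Fact subquot_mulrV : right_inverse subquot_one subquot_inv subquot_mul.
Proof. by elim/quotW=> x; rewrite subquot_piV subquot_piM mulgV. Qed.

HB.instance Definition _ := isGroup.Build subquot
  subquot_mulA subquot_mul1 subquot_mulr1 subquot_mulV subquot_mulrV.

Variables (C : groupClosed (Kstar K)) (sCA : {subset C <= A}).

Definition quot_incl (x : subgroup C) : subquot :=
  \pi_subquot (Sub (val x) (sCA (valP x)) : subgroup A).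

Fact quot_incl_is_multiplicative : {morph quot_incl : x y / (x * y)%g}.
Proof.
move=> x y; rewrite /quot_incl [RHS]subquot_piM; congr (\pi_subquot _).
by apply: val_inj; rewrite !(valM, SubK).
Qed.
HB.instance Definition _ :=
  isMultiplicative.Build (subgroup C) subquot quot_incl
    quot_incl_is_multiplicative.

End SubQuotient.

(* Exactness of 1 -> G1 -> G2 -> G3 -> 1. *)
Definition short_exact (G1 G2 G3 : groupType)
    (f : {multiplicative G1 -> G2}) (g : {multiplicative G2 -> G3}) :=
  [/\ injective f,
      forall y : G2, g y = 1%g <-> exists x : G1, f x = y
    & forall z : G3, exists y : G2, g y = z].

Definition sum_of_powers (K : fieldType) (m : nat) (x : K) :=
  exists s : seq K, x = \sum_(y <- s) y ^+ m.

Section SumsOfPowers.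
Variable K : fieldType.

Lemma sum_of_powersM m (x y : K) :
  sum_of_powers m x -> sum_of_powers m y -> sum_of_powers m (x * y).
Proof.
move=> [s ->] [t ->]; exists [seq a * b | a <- s, b <- t].
rewrite big_allpairs_dep mulr_suml; apply: eq_bigr => a _.
by rewrite mulr_sumr; apply: eq_bigr => b _; rewrite exprMn.
Qed.

Lemma sum_of_powers1 m : sum_of_powers m (1 : K).
Proof. by exists [:: 1]; rewrite big_seq1 expr1n. Qed.

Lemma sum_of_powersX m (x : K) : sum_of_powers m (x ^+ m).
Proof. by exists [:: x]; rewrite big_seq1. Qed.

Lemma sum_of_powersV m (x : K) :
  x != 0 -> sum_of_powers m.+1 x -> sum_of_powers m.+1 x^-1.
Proof.
move=> x0 sx; have -> : x^-1 = x ^+ m * x^-1 ^+ m.+1.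
  by rewrite exprS mulrCA -exprMn divff // expr1n mulr1.
apply: sum_of_powersM; last exact: sum_of_powersX.
elim: {2}m => [|j IHj]; first exact: sum_of_powers1.
by rewrite exprS; apply: sum_of_powersM.
Qed.

(* K^* :&: \sum K^2 *)
Definition sosK : {pred Kstar K} := fun x => `[< sum_of_powers 2 (val x) >].

Fact sosK_mul : mulg_closed sosK.
Proof.
by move=> x y /asboolP sx /asboolP sy; apply/asboolP/sum_of_powersM.
Qed.
Fact sosK_1 : 1%g \in sosK.
Proof. by apply/asboolP/sum_of_powers1. Qed.
Fact sosK_inv : invg_closed sosK.
Proof.
by move=> x /asboolP sx; apply/asboolP/sum_of_powersV => //; exact: (valP x).
Qed.
HB.instance Definition _ := isMulClosed.Build _ sosK sosK_mul.
HB.instance Definition _ := isMul1Closed.Build _ sosK sosK_1.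
HB.instance Definition _ := isInvClosed.Build _ sosK sosK_inv.

(* K^{*2} :&: \sum K^4 *)
Definition sq_so4K : {pred Kstar K} := fun x =>
  `[< (exists y : Kstar K, x = y ^+ 2)%g /\ sum_of_powers 4 (val x) >].

Fact sq_so4K_mul : mulg_closed sq_so4K.
Proof.
move=> _ _ /asboolP[[a ->] sx] /asboolP[[b ->] sy]; apply/asboolP.
split; last exact: sum_of_powersM.
exists (a * b)%g; apply: val_inj; rewrite !expg2 !val_KstarM.
by rewrite mulrACA.
Qed.
Fact sq_so4K_1 : 1%g \in sq_so4K.
Proof.
by apply/asboolP; split; [exists 1%g; rewrite expg1n | exact: sum_of_powers1].
Qed.
Fact sq_so4K_inv : invg_closed sq_so4K.
Proof.
move=> _ /asboolP[[a ->] sx]; apply/asboolP; split.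
  by exists (a^-1)%g; rewrite expVgn.
by apply/sum_of_powersV => //; exact: (valP (a ^+ 2)%g).
Qed.
HB.instance Definition _ := isMulClosed.Build _ sq_so4K sq_so4K_mul.
HB.instance Definition _ := isMul1Closed.Build _ sq_so4K sq_so4K_1.
HB.instance Definition _ := isInvClosed.Build _ sq_so4K sq_so4K_inv.

(* (K^* :&: \sum K^2)^2 *)
Definition sosK2 : {pred Kstar K} := fun x =>
  `[< exists2 g, g \in sosK & x = (g ^+ 2)%g >].

Fact sosK2_mul : mulg_closed sosK2.
Proof.
move=> _ _ /asboolP[a sa ->] /asboolP[b sb ->]; apply/asboolP.
exists (a * b)%g; first exact: gpredM.
by apply: val_inj; rewrite !expg2 !val_KstarM mulrACA.
Qed.
Fact sosK2_1 : 1%g \in sosK2.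
Proof. by apply/asboolP; exists 1%g; rewrite ?expg1n ?gpred1. Qed.
Fact sosK2_inv : invg_closed sosK2.
Proof.
move=> _ /asboolP[a sa ->]; apply/asboolP; exists (a^-1)%g; rewrite ?gpredV //.
by rewrite expVgn.
Qed.
HB.instance Definition _ := isMulClosed.Build _ sosK2 sosK2_mul.
HB.instance Definition _ := isMul1Closed.Build _ sosK2 sosK2_1.
HB.instance Definition _ := isInvClosed.Build _ sosK2 sosK2_inv.

Definition pm1K : {pred Kstar K} := fun x => (val x == 1) || (val x == -1).

Fact pm1K_mul : mulg_closed pm1K.
Proof.
move=> x y; rewrite !unfold_in !val_KstarM.
by move=> /orP[] /eqP-> /orP[] /eqP->;
  rewrite ?mulr1 ?mul1r ?mulrNN ?mulr1 eqxx ?orbT.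
Qed.
Fact pm1K_1 : 1%g \in pm1K.
Proof. by rewrite unfold_in eqxx. Qed.
Fact pm1K_inv : invg_closed pm1K.
Proof.
move=> x; rewrite !unfold_in !val_KstarV.
by move=> /orP[] /eqP->; rewrite ?invrN invr1 eqxx ?orbT.
Qed.
HB.instance Definition _ := isMulClosed.Build _ pm1K pm1K_mul.
HB.instance Definition _ := isMul1Closed.Build _ pm1K pm1K_1.
HB.instance Definition _ := isInvClosed.Build _ pm1K pm1K_inv.

End SumsOfPowers.

Arguments sosK K x : clear implicits.
Arguments sq_so4K K x : clear implicits.
Arguments sosK2 K x : clear implicits.
Arguments pm1K K x : clear implicits.

Definition subfield (F : fieldType) (S : divringClosed F) := {x : F | x \in S}.

Section Subfield.
Variables (F : fieldType) (S : divringClosed F).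

HB.instance Definition _ := SubChoice.on (subfield S).
HB.instance Definition _ :=
  [SubChoice_isSubIntegralDomain of subfield S by <:].
HB.instance Definition _ := [SubIntegralDomain_isSubField of subfield S by <:].

End Subfield.

(* A point of the scheme P^n over k: a homogeneous prime ideal of
   k[x_0, ..., x_n] that does not contain the irrelevant ideal.  Its closure
   is an integral closed subscheme of P^n, and every integral closed
   subscheme arises in this way from a unique point, so the same type also
   serves for the integral projective schemes X with a given embedding. *)
Record projPoint (k : fieldType) (n : nat) := ProjPoint {
  point_ideal :> prime_idealr {mpoly k[n.+1]};
  _ : forall (p : {mpoly k[n.+1]}) (d : nat),
        p \in point_ideal -> pihomog mdeg d p \in point_ideal;
  _ : exists i : 'I_n.+1, 'X_i \notin point_ideal }.

(* M is a point of the scheme X. *)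
Definition point_of (k : fieldType) n (X M : projPoint k n) :=
  {subset (X : {pred _}) <= (M : {pred _})}.

Section HomogCoordRing.
Variables (k : fieldType) (n : nat) (X : projPoint k n).

Definition coordRing := {ideal_quot X}.
HB.instance Definition _ := GRing.ComNzRing.on coordRing.

Definition coord_unit : {pred coordRing} := fun x => `[< exists y, y * x = 1 >].
Definition coord_inv (x : coordRing) : coordRing :=
  if pselect (exists y, y * x = 1) is left ex then sval (cid ex) else x.

Fact coord_mulVx : {in coord_unit, left_inverse 1 coord_inv *%R}.
Proof.
move=> x /asboolP ex; rewrite /coord_inv; case: pselect => // e.
exact: (svalP (cid e)).
Qed.
Fact coord_unitPl (x y : coordRing) : y * x = 1 -> coord_unit x.
Proof. by move=> yx; apply/asboolP; exists y. Qed.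
Fact coord_inv_out : {in [predC coord_unit], coord_inv =1 id}.
Proof.
move=> x; rewrite inE /= => /asboolPn ex.
by rewrite /coord_inv; case: pselect.
Qed.
HB.instance Definition _ := GRing.ComNzRing_hasMulInverse.Build coordRing
  coord_mulVx coord_unitPl coord_inv_out.
HB.instance Definition _ := GRing.ComUnitRing_isIntegral.Build coordRing
  (@Quotient.rquot_IdomainAxiom _ X).

Definition coord (p : {mpoly k[n.+1]}) : coordRing := \pi_{ideal_quot X} p.

Fact coord_is_zmod_morphism : zmod_morphism coord.
Proof. exact: (@pi_is_zmod_morphism _ _ _ {ideal_quot X}). Qed.
Fact coord_is_monoid_morphism : monoid_morphism coord.
Proof. exact: (@pi_is_monoid_morphism _ _ _ {ideal_quot X}). Qed.
HB.instance Definition _ :=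
  GRing.isZmodMorphism.Build _ _ coord coord_is_zmod_morphism.
HB.instance Definition _ :=
  GRing.isMonoidMorphism.Build _ _ coord coord_is_monoid_morphism.

Lemma coord_eq0 p : (coord p == 0) = (p \in X).
Proof. by rewrite -(rmorph0 coord) -[in RHS](subr0 p) Quotient.idealrBE. Qed.

(* The element F/G of the fraction field of k[x_0, ..., x_n]/X *)
Definition ratio_of (F G : {mpoly k[n.+1]}) : {fraction coordRing} :=
  tofrac (coord F) / tofrac (coord G).

(* f is a fraction F/G with F and G homogeneous of the same degree and G not
   in M; for M a point of X this is the homogeneous localisation at M. *)
Definition hom_localization (M : projPoint k n) (f : {fraction coordRing}) :=
  exists d (F G : {mpoly k[n.+1]}),
    [/\ F \is d.-homog, G \is d.-homog, G \notin M & f = ratio_of F G].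

Definition degree0 : {pred {fraction coordRing}} :=
  fun f => `[< hom_localization X f >].

Lemma tofrac_coord_neq0 p : p \notin X -> tofrac (coord p) != 0.
Proof. by rewrite tofrac_eq0 coord_eq0. Qed.

Fact degree0_divring_closed : divring_closed degree0.
Proof.
split=> [|f g|f g].
- apply/asboolP; exists 0%N, 1, 1; split; rewrite ?dhomog1 ?idealr1 //.
  by rewrite /ratio_of !rmorph1 divr1.
- move=> /asboolP[d [F [G [hF hG nG ->]]]] /asboolP[e [F' [G' [hF' hG' nG' ->]]]].
  apply/asboolP; exists (d + e)%N, (F * G' - F' * G), (G * G'); split.
  + apply: rpredB; first exact: dhomogM.
    by rewrite addnC; apply: dhomogM.
  + exact: dhomogM.
  + by rewrite prime_idealrM negb_or nG.
  + rewrite /ratio_of rmorphB !rmorphM tofracB !tofracM.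
    by rewrite -mulNr addf_div ?tofrac_coord_neq0 // mulNr.
- move=> /asboolP[d [F [G [hF hG nG ->]]]] /asboolP[e [F' [G' [hF' hG' nG' ->]]]].
  apply/asboolP; have [F'0|F'0] := boolP (F' \in X).
    exists 0%N, 0, 1; split; rewrite ?dhomog1 ?rpred0 ?idealr1 //.
    move: F'0; rewrite -coord_eq0 /ratio_of => /eqP->.
    by rewrite !rmorph0 !mul0r invr0 mulr0.
  exists (d + e)%N, (F * G'), (G * F'); split.
  + exact: dhomogM.
  + exact: dhomogM.
  + by rewrite prime_idealrM negb_or nG.
  + by rewrite /ratio_of !rmorphM invf_div mulf_div.
Qed.
HB.instance Definition _ :=
  GRing.isDivringClosed.Build _ degree0 degree0_divring_closed.

Definition function_field : fieldType := subfield degree0.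

Definition local_ring (M : projPoint k n) (f : function_field) :=
  hom_localization M (val f).

Definition local_unit (M : projPoint k n) (f : function_field) :=
  local_ring M f /\ exists2 g, local_ring M g & f * g = 1.

Definition DX : {pred Kstar function_field} := fun f => `[< forall M,
  point_of X M -> exists u g : function_field,
    [/\ local_unit M u, sum_of_powers 2 g & val f = u * g] >].

Lemma hom_localizationM M f g : point_of X M ->
  hom_localization M f -> hom_localization M g -> hom_localization M (f * g).
Proof.
move=> XM [d [F [G [hF hG nG ->]]]] [e [F' [G' [hF' hG' nG' ->]]]].
exists (d + e)%N, (F * F'), (G * G'); split; try exact: dhomogM.
  by rewrite prime_idealrM negb_or nG.
by rewrite /ratio_of !rmorphM mulf_div.
Qed.

Lemma local_ring1 M : local_ring M 1.
Proof.
exists 0%N, 1, 1; split; rewrite ?dhomog1 ?idealr1 //.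
by rewrite /ratio_of !rmorph1 divr1.
Qed.

Lemma local_unitM M u v : point_of X M ->
  local_unit M u -> local_unit M v -> local_unit M (u * v).
Proof.
move=> XM [ru [u' ru' uu']] [rv [v' rv' vv']]; split.
  by rewrite /local_ring rmorphM; apply: hom_localizationM.
exists (u' * v'); first by rewrite /local_ring rmorphM; apply: hom_localizationM.
by rewrite mulrACA uu' vv' mulr1.
Qed.

Lemma local_unitV M u : local_unit M u -> local_unit M u^-1.
Proof.
move=> [ru [v rv uv]]; have u0 : u != 0.
  by apply: contra_eqN uv => /eqP->; rewrite mul0r eq_sym oner_eq0.
have -> : u^-1 = v by apply: (mulfI u0); rewrite uv mulfV.
by split=> //; exists u; rewrite // mulrC.
Qed.

Lemma local_unit1 M : local_unit M 1.
Proof. by split; [|exists 1]; rewrite ?mulr1 //; apply: local_ring1. Qed.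

Lemma local_unitN1 M : local_unit M (- 1).
Proof.
have rN1 : local_ring M (- 1).
  exists 0%N, (- 1), 1; split; rewrite ?rpredN ?dhomog1 ?idealr1 //.
  by rewrite /ratio_of !rmorphN !rmorph1 divr1.
by split=> //; exists (- 1); rewrite // mulrNN mulr1.
Qed.

Fact DX_mul : mulg_closed DX.
Proof.
move=> f f' /asboolP Df /asboolP Df'; apply/asboolP => M XM.
have [u [g [uu sg fE]]] := Df M XM; have [u' [g' [uu' sg' fE']]] := Df' M XM.
exists (u * u'), (g * g'); split.
- exact: local_unitM.
- exact: sum_of_powersM.
- by rewrite val_KstarM fE fE' mulrACA.
Qed.
Fact DX_inv : invg_closed DX.
Proof.
move=> f /asboolP Df; apply/asboolP => M XM.
have [u [g [uu sg fE]]] := Df M XM; exists u^-1, g^-1; split.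
- exact: local_unitV.
- apply: sum_of_powersV => //; apply: contraTneq (valP f) => g0.
  by rewrite fE g0 mulr0 eqxx.
- by rewrite val_KstarV fE invfM.
Qed.

Lemma sosK_sub_DX : {subset sosK function_field <= DX}.
Proof.
move=> f /asboolP sf; apply/asboolP => M XM; exists 1, (val f).
by rewrite mul1r; split=> //; apply: local_unit1.
Qed.

Fact DX_1 : 1%g \in DX. Proof. by apply: sosK_sub_DX; apply: gpred1. Qed.
HB.instance Definition _ := isMulClosed.Build _ DX DX_mul.
HB.instance Definition _ := isMul1Closed.Build _ DX DX_1.
HB.instance Definition _ := isInvClosed.Build _ DX DX_inv.

Lemma pm1K_sub_DX : {subset pm1K function_field <= DX}.
Proof.
move=> f /orP[] /eqP fE; first by apply: sosK_sub_DX; apply/asboolP;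
  rewrite fE; apply: sum_of_powers1.
apply/asboolP => M XM; exists (- 1), 1; rewrite fE mulr1.
split=> //; last exact: sum_of_powers1.
exact: local_unitN1.
Qed.

End HomogCoordRing.

Arguments DX {k n} X f.
Arguments pm1K_sub_DX {k n} X [f] : rename.

(* X is smooth over k at M: on some standard chart x_j <> 0 containing M, the
   ideal of X is generated near M by c elements whose differentials in the
   affine coordinates x_i/x_j (i <> j) are linearly independent at M.  For g
   homogeneous of degree e, the partial derivative in x_i/x_j of g/x_j^e is
   g^`M(i)/x_j^(e-1), so a Jacobian minor is nonzero in the residue field
   exactly when the same minor of the homogeneous g's is not in M. *)
Definition smooth_at (k : fieldType) n (X M : projPoint k n) :=
  exists (j : 'I_n.+1) (c : nat) (g : 'I_c -> {mpoly k[n.+1]})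
         (J : 'I_c -> 'I_n.+1),
  [/\ 'X_j \notin M,
      forall a, g a \in X /\ exists d, g a \is d.-homog,
      forall f, f \in X -> exists2 s, s \notin M &
        exists h : 'I_c -> {mpoly k[n.+1]}, s * f = \sum_a h a * g a
    & (forall a, J a != j) /\
      \det (\matrix_(a, b) (g a)^`M(J b)) \notin M].

Definition smooth (k : fieldType) n (X : projPoint k n) :=
  forall M, point_of X M -> smooth_at X M.

(* The points of the base change of X along a field extension: the points of
   P^n over the extension whose ideal contains the image of the ideal of X. *)
Definition point_of_baseChange (k l : fieldType) (f : {rmorphism k -> l}) n
    (X : projPoint k n) (M : projPoint l n) :=
  forall p, p \in X -> map_mpoly f p \in M.

(* A set of points of P^n is irreducible (for the Zariski topology, whose
   basic open sets are the sets F <> 0 for F homogeneous): it is nonempty and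
   any two nonempty open subsets meet. *)
Definition irreducible_set (k : fieldType) n (Z : projPoint k n -> Prop) :=
  (exists M, Z M) /\
  forall (d e : nat) (F G : {mpoly k[n.+1]}),
    F \is d.-homog -> G \is e.-homog ->
    (exists2 M, Z M & F \notin M) -> (exists2 M, Z M & G \notin M) ->
    exists2 M, Z M & (F \notin M) && (G \notin M).

Definition absolutely_irreducible (R : realType) n (X : projPoint R n) :=
  irreducible_set (point_of_baseChange (real_complex R) X).

Definition has_real_point (R : realType) n (X : projPoint R n) :=
  exists2 x : 'I_n.+1 -> R, exists i, x i != 0 &
    forall p, p \in X -> p.@[x] = 0.

(* Main.v *)
(** Every point of X is treated through a generic point y of an affine chart and its specialisation P.

    If f lies in D(X), write f = u_M g_M with u_M = F/G and set N = sum of the y_i^2.  The multipliers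
    c = F G^3 / N^(2d) make every f c a sum of squares; they generate the unit ideal of the ring of
    elements bounded by constants, since a prime ideal containing them would define a point of X at which
    every chosen F or G vanishes.  A sum c of such multipliers then has delta <= c^2 <= C in the
    order defined by sums of squares, so that c^2 is a sum of fourth powers (Becker; Kadison-Dubois), and so is
    f^2 = (f c)^2 / c^2 by Hilbert's identity.

    Conversely let f^2 be a sum of fourth powers.  Generic linear projections reduce the local ring at a
    smooth point to that of an affine space or of a hypersurface h = 0 with a transversal line, and
    elimination along the line turns f into a polynomial f0 in the remaining variables, up to units and squares.
    A real prime factor of f0 through P occurs to an even power because f^2 is a sum of fourth
    powers; a nonreal prime factor is a sum of squares up to a constant, by descent on its degree.

    The same reduction at a real point gives a hypersurface with a simple real zero, hence
    real zeros at which any given denominator is nonzero: -1 is not a sum of squares in K, which is injectivity at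
    {1, -1}.  The rest of the kernel is clear, as f^2 = g^2 means f = g or f = -g. *)

From HB Require Import structures.
Require Import Defs.
From mathcomp Require Import all_boot all_order all_algebra.
From mathcomp Require Import mpoly complex boolp reals ring lra zify.

Set Implicit Arguments.
Unset Strict Implicit.
Unset Printing Implicit Defensive.

Import Order.TTheory GRing.Theory Num.Theory.
Local Open Scope ring_scope.

(** * Sums of squares and of fourth powers *)

Section SumsOfPowersTheory.
Variable K : fieldType.

(** Factorization is carried out in polynomial rings, where Gauss's lemma provides it; the
    projection to a hypersurface and the elimination serve to bring an element of the local ring
    down there. Points need not be closed, so their coordinates lie in an extension [k] of the
    constants, while a projection has to make sense over [R], [K] and [k] at once: its direction is
    therefore chosen with ratios of integers as coordinates.

    Orderings are encoded by the relation that a difference is a sum of squares, and the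
    multiplicity of a prime by divisibility in a subring of [K]. Positivity statements become
    polynomial identities around the fourth moment of a Gaussian variable, which is where constants
    such as 12, 48 and 9 come from.

    Passing from local to global rests on signs: any [c] with [f c] a sum of squares has the sign of
    [f] in every ordering, so the product of two such [c] is a sum of squares and their sum cannot
    become small by cancellation. *)

Lemma sum_of_powers0 m : sum_of_powers m (0 : K).
Proof. by exists [::]; rewrite big_nil. Qed.

Lemma sum_of_powersD m (x y : K) :
  sum_of_powers m x -> sum_of_powers m y -> sum_of_powers m (x + y).
Proof. by move=> [s ->] [t ->]; exists (s ++ t); rewrite big_cat. Qed.

Lemma sum_of_powers_sum m (I : Type) (r : seq I) (P : pred I) (F : I -> K) :
  (forall i, P i -> sum_of_powers m (F i)) ->
  sum_of_powers m (\sum_(i <- r | P i) F i).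
Proof.
move=> hF; apply: (big_ind (sum_of_powers m)) => //.
- exact: sum_of_powers0.
- exact: sum_of_powersD.
Qed.

Lemma sum_of_powersXn m (x : K) j : sum_of_powers m x -> sum_of_powers m (x ^+ j).
Proof.
move=> sx; elim: j => [|j IH]; first exact: sum_of_powers1.
by rewrite exprS; apply: sum_of_powersM.
Qed.

Lemma sum_of_powers_nat m k : sum_of_powers m (k%:R : K).
Proof.
elim: k => [|k IH]; first exact: sum_of_powers0.
by rewrite -natr1; apply: sum_of_powersD => //; exact: sum_of_powers1.
Qed.

Lemma sum_of_powers_div m (x y : K) :
  sum_of_powers m.+1 x -> sum_of_powers m.+1 y -> sum_of_powers m.+1 (x / y).
Proof.
move=> sx sy; have [->|y0] := eqVneq y 0; first by rewrite invr0 mulr0; apply: sum_of_powers0.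
by apply: sum_of_powersM => //; apply: sum_of_powersV.
Qed.

(* [E (a + xi c)^4] for independent standard Gaussians, [z] being the sum of the [c^2];
   the induction step replaces a Gaussian by a five-point quadrature of degree 5. *)
Definition quartic_form (a z : K) := a ^+ 4 + 6 * a ^+ 2 * z + 3 * z ^+ 2.

Lemma so4_quartic_form (a z : K) : (12 : K) != 0 ->
  sum_of_powers 2 z -> sum_of_powers 4 (quartic_form a z).
Proof.
move=> n12 [s ->]; elim: s a => [|c s IH] a.
  rewrite big_nil /quartic_form mulr0 expr0n mulr0 !addr0; exact: sum_of_powersX.
rewrite big_cons; set t := \sum_(_ <- _) _.
(* The nodes 0, 1, -1, 2, -2 with weights 6/12, 2/12, 2/12, 1/12, 1/12 have second moment 1 and
   fourth moment 3, like a standard Gaussian. *)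
have -> : quartic_form a (c ^+ 2 + t) =
    (6%:R * quartic_form a t + 2%:R * (quartic_form (a + c) t + quartic_form (a - c) t)
     + (quartic_form (a + 2 * c) t + quartic_form (a - 2 * c) t)) / 12%:R.
  by rewrite /quartic_form; field; rewrite n12.
apply: sum_of_powers_div; last exact: sum_of_powers_nat.
by do ![apply: sum_of_powers_nat | apply: IH | apply: sum_of_powersD | apply: sum_of_powersM].
Qed.

(** At [a = 0] the quartic form is [3 z^2]; this is Hilbert's identity. *)
Lemma so4_sqr (z : K) : (12 : K) != 0 -> sum_of_powers 2 z -> sum_of_powers 4 (z ^+ 2).
Proof.
move=> n12 sz; have n3 : (3 : K) != 0.
  by apply: contraNneq n12 => h; rewrite (natrM K 3 4) h mul0r.
have -> : z ^+ 2 = quartic_form 0 z / 3%:R by rewrite /quartic_form; field; rewrite n3.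
apply: sum_of_powers_div; last exact: sum_of_powers_nat.
exact: so4_quartic_form.
Qed.

End SumsOfPowersTheory.

Section RealConstants.
Variables (R : rcfType) (K : fieldType) (iota : {rmorphism R -> K}).

Lemma natr_neq0 k : (k.+1%:R : K) != 0.
Proof. by rewrite -(rmorph_nat iota) fmorph_eq0 pnatr_eq0. Qed.

Lemma sos_pos (c : R) : 0 <= c -> sum_of_powers 2 (iota c).
Proof. by move=> c0; rewrite -(sqr_sqrtr c0) rmorphXn; apply: sum_of_powersX. Qed.

Lemma so4_pos (c : R) : 0 <= c -> sum_of_powers 4 (iota c).
Proof.
move=> c0; rewrite -(sqr_sqrtr c0) -(sqr_sqrtr (sqrtr_ge0 c)) -exprM rmorphXn.
exact: sum_of_powersX.
Qed.

(** A preorder on any field, antisymmetric exactly when [-1] is not a sum of squares. *)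
Definition ple (x y : K) := sum_of_powers 2 (y - x).

Lemma ple_refl x : ple x x.
Proof. by rewrite /ple subrr; apply: sum_of_powers0. Qed.

Lemma ple_trans y x z : ple x y -> ple y z -> ple x z.
Proof.
move=> xy yz; rewrite /ple (_ : z - x = (z - y) + (y - x)); last by ring.
exact: sum_of_powersD.
Qed.

Lemma pleD x y z t : ple x y -> ple z t -> ple (x + z) (y + t).
Proof.
move=> xy zt; rewrite /ple (_ : y + t - (x + z) = (y - x) + (t - z)); last by ring.
exact: sum_of_powersD.
Qed.

Lemma ple_pM x y z : sum_of_powers 2 z -> ple x y -> ple (z * x) (z * y).
Proof. by move=> sz xy; rewrite /ple -mulrBr; apply: sum_of_powersM. Qed.

Lemma pleM x y z t : sum_of_powers 2 x -> sum_of_powers 2 z ->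
  ple x y -> ple z t -> ple (x * z) (y * t).
Proof.
move=> sx sz xy zt; apply: (@ple_trans (x * t)); first exact: ple_pM.
rewrite ![_ * t]mulrC; apply: ple_pM => //.
by rewrite -(subrK z t) addrC; apply: sum_of_powersD.
Qed.

Lemma pleX x y j : sum_of_powers 2 x -> ple x y -> ple (x ^+ j) (y ^+ j).
Proof.
move=> sx xy; elim: j => [|j IH]; first exact: ple_refl.
by rewrite !exprS; apply: pleM => //; apply: sum_of_powersXn.
Qed.

Lemma ple_sqrD x y : ple ((x + y) ^+ 2) (2 * (x ^+ 2 + y ^+ 2)).
Proof.
rewrite /ple (_ : _ - _ = (x - y) ^+ 2); last by ring.
exact: sum_of_powersX.
Qed.

Lemma ple_const (c d : R) : c <= d -> ple (iota c) (iota d).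
Proof. by move=> cd; rewrite /ple -rmorphB; apply: sos_pos; rewrite subr_ge0. Qed.

End RealConstants.
Arguments ple {K}.

(** * Bounded elements and sums of fourth powers *)

Section BeckerUnits.
Variables (R : realType) (K : fieldType) (iota : {rmorphism R -> K}).
Local Notation so4 := (@sum_of_powers K 4).
Local Notation sos := (@sum_of_powers K 2).

(* The decisive step in the proof of the Kadison-Dubois theorem for the preprime of sums of
   fourth powers. *)
Lemma so4_archimedean_descent (f p : K) (C : nat) (k : nat) :
  so4 p -> so4 (k.+1%:R - p) -> so4 (p * f - 1) -> so4 (f + C%:R) -> so4 f.
Proof.
move=> sp skp spf sfC.
have k0 := natr_neq0 iota k.
(* The constant added to [f] drops by [1/(k+1)] at each step, from [C] down to 0. *)
suff H m : so4 (f + m%:R / k.+1%:R) -> so4 f.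
  by apply: (H (C * k.+1)%N); rewrite natrM mulfK.
elim: m => [|m IH]; first by rewrite mul0r addr0.
move=> sm; apply: IH; set r := m%:R / _ in sm *.
have sr n : so4 (n%:R / k.+1%:R).
  by apply: sum_of_powers_div; apply: sum_of_powers_nat.
have -> : f + m%:R / k.+1%:R =
  ((k.+1%:R - p) * (f + m.+1%:R / k.+1%:R) + (p * f - 1) + (m.+1%:R / k.+1%:R) * p) / k.+1%:R.
  by rewrite -(natr1 m); move: k.+1%:R k0 => kk k0; field.
apply: sum_of_powers_div; last exact: sum_of_powers_nat.
apply: sum_of_powersD; last by apply: sum_of_powersM => //; apply: sr.
by apply: sum_of_powersD => //; apply: sum_of_powersM.
Qed.

(** These elements form the real holomorphy ring of [K]. A bound on the square bounds the element
    from both sides at once. *)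
Definition sbounded (x : K) := exists C : R, ple (x ^+ 2) (iota C).

Lemma sboundedD x y : sbounded x -> sbounded y -> sbounded (x + y).
Proof.
move=> [C hC] [D hD]; exists (2 * (C + D)); apply: (ple_trans (ple_sqrD _ _)).
rewrite rmorphM rmorph_nat rmorphD; apply: ple_pM; first exact: sum_of_powers_nat.
exact: pleD.
Qed.

Lemma sbounded_const c : sbounded (iota c).
Proof. by exists (c ^+ 2); rewrite rmorphXn; apply: ple_refl. Qed.

Lemma sboundedN x : sbounded x -> sbounded (- x).
Proof. by move=> [C hC]; exists C; rewrite sqrrN. Qed.

Lemma sboundedM x y : sbounded x -> sbounded y -> sbounded (x * y).
Proof.
move=> [C hC] [D hD]; exists (C * D).
by rewrite exprMn rmorphM; apply: pleM => //; apply: sum_of_powersX.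
Qed.

(** For [z = C - x^2] the terms in [C x^2] cancel in [quartic_form x z], which becomes
    [3 C^2 - 2 x^4]. *)
Lemma sbounded_so4 x : sbounded x ->
  exists C : R, so4 (iota C - x ^+ 4).
Proof.
move=> [C hC]; exists (3 / 2 * C ^+ 2).
have n2 : (2 : K) != 0 by exact: (natr_neq0 iota 1).
have -> : iota (3 / 2 * C ^+ 2) - x ^+ 4 = quartic_form x (iota C - x ^+ 2) / 2%:R.
  by rewrite /quartic_form rmorphM fmorph_div rmorphXn !rmorph_nat; field; rewrite n2.
apply: sum_of_powers_div; last exact: sum_of_powers_nat.
by apply: so4_quartic_form => //; exact: (natr_neq0 iota 11).
Qed.

Lemma so4_bounded_const x : sbounded x -> exists C : nat, so4 (C%:R + x).
Proof.
move=> bx.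
have [C hC] := sbounded_so4 (sboundedD bx (sbounded_const 1)).
have [D hD] := sbounded_so4 (sboundedD bx (sbounded_const (- 2))).
have [N hN] : exists N : nat, (2 * C + D) / 48 <= N%:R.
  by exists (Num.bound `|(2 * C + D) / 48|); apply/(le_trans (ler_norm _))/ltW/archi_boundP.
exists N.
have n48 : (48 : K) != 0 by exact: (natr_neq0 iota 47).
(* [48 x = (x+2)^4 + 2 (x-1)^4 - 2 (x+1)^4 - (x-2)^4]; the fourth powers with negative sign are
   bounded, so a constant absorbs them. *)
have -> : N%:R + x = ((x + 2) ^+ 4 + 2%:R * (x - 1) ^+ 4
    + 2%:R * (iota C - (x + iota 1) ^+ 4) + (iota D - (x + iota (- 2)) ^+ 4)) / 48%:R
    + iota (N%:R - (2 * C + D) / 48).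
  rewrite rmorphB fmorph_div !rmorph_nat rmorphD rmorphM rmorphN rmorph1 !rmorph_nat.
  by field; rewrite n48.
apply: sum_of_powersD; last by apply: so4_pos; rewrite subr_ge0.
apply: sum_of_powers_div; last exact: sum_of_powers_nat.
by do ![apply: sum_of_powers_nat | apply: sum_of_powersX | assumption
  | apply: sum_of_powersD | apply: sum_of_powersM].
Qed.

(* [(z + a) (z + 9 a) = 2 a^2 / 3 + (25 a^2 / 3) Q(1, z / (5 a))] with [Q] the quartic form,
   so the constant [a] in [z + a] can be divided by 9. *)
Lemma so4_shift_descent (z : K) (a : R) : 0 < a -> sos z -> sbounded z ->
  so4 (z + iota (9 * a)) -> so4 (z + iota a).
Proof.
move=> a0 sz bz s9.
have ia : iota a != 0 by rewrite fmorph_eq0 gt_eqF.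
set p := iota (3 / (2 * a ^+ 2)) * (z + iota (9 * a)).
have bp : sbounded p.
  by apply: sboundedM; [|apply: sboundedD => //]; apply: sbounded_const.
have [k hk] := so4_bounded_const (sboundedN bp).
have [C hC] := so4_bounded_const (sboundedD bz (sbounded_const a)).
have sp : so4 p by apply: sum_of_powersM => //; apply: so4_pos; rewrite divr_ge0 //; nra.
apply: (@so4_archimedean_descent _ p C k) => //.
- by rewrite -natr1 addrAC; apply: sum_of_powersD => //; apply: sum_of_powers1.
- have n2 : (2 : K) != 0 by exact: (natr_neq0 iota 1).
  have n5 : (5 : K) != 0 by exact: (natr_neq0 iota 4).
  have -> : p * (z + iota a) - 1 = 25%:R / 2%:R * quartic_form 1 (z / (5%:R * iota a)).
    rewrite /p /quartic_form fmorph_div !rmorphM !rmorph_nat expr2; field.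
    by rewrite n2 n5 ia.
  apply: sum_of_powersM; first by apply: sum_of_powers_div; apply: sum_of_powers_nat.
  apply: so4_quartic_form; first exact: (natr_neq0 iota 11).
  rewrite -(rmorph_nat iota) -rmorphM; apply: sum_of_powers_div => //.
  by apply: sos_pos; rewrite mulr_ge0 // ltW.
- by rewrite addrC.
Qed.

(** For large [a] this follows from [so4_bounded_const]; the shift descent then divides the constant
    by 9 as often as necessary. *)
Lemma so4_bounded_shift (z : K) (a : R) : 0 < a -> sos z -> sbounded z -> so4 (z + iota a).
Proof.
move=> a0 sz bz; have [C hC] := so4_bounded_const bz.
have [k hk] : exists k : nat, C%:R <= 9 ^+ k * a.
  have [k hk] : exists k : nat, C%:R / a <= k%:R.
    exists (Num.bound (C%:R / a)); apply/ltW/archi_boundP.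
    by rewrite divr_ge0 // ltW.
  exists k; rewrite -ler_pdivrMr //; apply: (le_trans hk).
  have : (k <= 9 ^ k)%N by apply/ltnW/ltn_expl.
  by rewrite -(ler_nat R) natrX.
elim: k a a0 hk => [|k IH] a a0 hk.
  rewrite -(subrK C%:R (iota a)) addrCA.
  rewrite -[C%:R in X in X + _](rmorph_nat iota) -rmorphB; apply: sum_of_powersD.
    by apply: so4_pos; rewrite subr_ge0; rewrite expr0 mul1r in hk.
  by rewrite addrC.
apply: so4_shift_descent => //; apply: IH; first by lra.
by apply: (le_trans hk); rewrite exprS -mulrA mulrCA.
Qed.

(** These [s] are the positive units of the ring of bounded elements, at which every valuation in
    Becker's criterion is zero. The difference [s - e] is a bounded sum of squares, to which the
    shift by [e] applies. *)
Lemma so4_bounded_pos (s : K) (e : R) : 0 < e -> sbounded s ->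
  ple (iota e) s -> so4 s.
Proof.
move=> e0 bs es; rewrite -(subrK (iota e) s).
apply: so4_bounded_shift => //.
by apply: sboundedD => //; apply/sboundedN/sbounded_const.
Qed.

End BeckerUnits.

(** * Unique factorization in polynomial rings *)

Section Snoc.
Variables (T : Type) (n : nat).
Definition snoc (v : 'I_n -> T) (a : T) (i : 'I_n.+1) : T :=
  if unlift ord_max i is Some j then v j else a.
Lemma snoc_lift v a j : snoc v a (lift ord_max j) = v j.
Proof. by rewrite /snoc liftK. Qed.
Lemma snoc_max v a : snoc v a ord_max = a.
Proof. by rewrite /snoc unlift_none. Qed.
End Snoc.

Lemma ord_snocP n (P : 'I_n.+1 -> Prop) :
  (forall j, P (lift ord_max j)) -> P ord_max -> forall i, P i.
Proof. by move=> hl hm i; case: (unliftP ord_max i) => [j ->|->]. Qed.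

Section MpolyEval.
Variables (R : comNzRingType).

Lemma mpoly_rmorph_ext n (C : comNzRingType) (f g : {rmorphism {mpoly R[n]} -> C}) :
  (forall c, f c%:MP = g c%:MP) -> (forall i, f 'X_i = g 'X_i) -> f =1 g.
Proof.
move=> hC hX p; rewrite (mpolyE p) !rmorph_sum; apply: eq_bigr => m _.
rewrite -mul_mpolyC !rmorphM hC mpolyXE_id !rmorph_prod; congr (_ * _).
by apply: eq_bigr => i _; rewrite !rmorphXn hX.
Qed.

Lemma mmapXi n (C : comNzRingType) (f : {rmorphism R -> C}) (v : 'I_n -> C) i :
  mmap f v 'X_i = v i.
Proof. by rewrite mmapX mmap1U. Qed.

Lemma eq_mmap n (C : comNzRingType) (f : {rmorphism R -> C}) (v w : 'I_n -> C) :
  v =1 w -> mmap f v =1 mmap f w.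
Proof. by move=> vw; apply: mpoly_rmorph_ext => [c|i] /=; rewrite ?mmapC // !mmapXi. Qed.

Lemma rmorph_mmap n (C D : comNzRingType) (f : {rmorphism R -> C}) (g : {rmorphism C -> D})
    (v : 'I_n -> C) (p : {mpoly R[n]}) :
  g (mmap f v p) = mmap (g \o f) (g \o v) p.
Proof.
move: p; apply: (mpoly_rmorph_ext (f := g \o mmap f v)) => [c|i] /=.
  by rewrite !mmapC.
by rewrite !mmapXi.
Qed.

Section Pev.
Variables (n : nat) (C : comNzRingType) (f : {rmorphism R -> C}) (v : 'I_n -> C) (a : C).
Definition pev : {poly {mpoly R[n]}} -> C := horner_eval a \o map_poly (mmap f v).
HB.instance Definition _ := GRing.RMorphism.on pev.

Lemma pevC p : pev p%:P = mmap f v p.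
Proof. by rewrite /pev /= map_polyC /horner_eval hornerC. Qed.
Lemma pevX : pev 'X = a.
Proof. by rewrite /pev /= map_polyX /horner_eval hornerX. Qed.
End Pev.

Lemma ppoly_rmorph_ext n (C : comNzRingType) (f g : {rmorphism {poly {mpoly R[n]}} -> C}) :
  (forall c, f c%:MP%:P = g c%:MP%:P) -> (forall i, f ('X_i)%:P = g ('X_i)%:P) -> f 'X = g 'X ->
  f =1 g.
Proof.
move=> hC hX hx p; rewrite -(coefK p) poly_def !rmorph_sum; apply: eq_bigr => i _.
rewrite -mul_polyC !rmorphM !rmorphXn hx; congr (_ * _).
exact: (mpoly_rmorph_ext (f := f \o polyC) (g := g \o polyC)).
Qed.

Section Shear.
Variables (n : nat) (o : 'I_n -> R).

(* The substitution of [Y_j + o_j Y_n] for [Y_j], with [Y_n] as the main variable. *)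
Definition shear : {mpoly R[n.+1]} -> {poly {mpoly R[n]}} :=
  mmap (polyC \o @mpolyC n R) (snoc (fun j => ('X_j)%:P + (o j)%:MP%:P * 'X) 'X).
HB.instance Definition _ := GRing.RMorphism.on shear.

Definition unshear : {poly {mpoly R[n]}} -> {mpoly R[n.+1]} :=
  pev (@mpolyC n.+1 R) (fun j => 'X_(lift ord_max j) - (o j)%:MP * 'X_ord_max) 'X_ord_max.
HB.instance Definition _ := GRing.RMorphism.on unshear.

Lemma pev_shear (C : comNzRingType) (f : {rmorphism R -> C}) v a p :
  pev f v a (shear p) = mmap f (snoc (fun j => v j + f (o j) * a) a) p.
Proof.
rewrite /shear rmorph_mmap; move: p; apply: mpoly_rmorph_ext => [c|i] /=.
  by rewrite !mmapC /= pevC mmapC.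
rewrite !mmapXi /=; move: i; apply: ord_snocP => [j|].
  by rewrite !snoc_lift rmorphD rmorphM /= !pevC pevX mmapC mmapXi.
by rewrite !snoc_max pevX.
Qed.

Lemma mmap_unshear (C : comNzRingType) (f : {rmorphism R -> C}) w q :
  mmap f w (unshear q) =
  pev f (fun j => w (lift ord_max j) - f (o j) * w ord_max) (w ord_max) q.
Proof.
move: q; apply: (ppoly_rmorph_ext (f := mmap f w \o unshear)) => [c|j|] /=; rewrite /unshear.
- by rewrite !pevC !mmapC.
- by rewrite !pevC !mmapXi rmorphB rmorphM /= !mmapXi mmapC.
- by rewrite !pevX mmapXi.
Qed.

Lemma shearK : cancel shear unshear.
Proof.
move=> p; rewrite /unshear pev_shear.
rewrite -[RHS]/((@idfun {mpoly R[n.+1]}) p); move: p; apply: mpoly_rmorph_ext => [c|i] /=.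
  by rewrite mmapC.
by rewrite mmapXi; move: i; apply: ord_snocP => [j|]; rewrite ?snoc_lift ?snoc_max //= subrK.
Qed.

Lemma unshearK : cancel unshear shear.
Proof.
move=> q; rewrite /shear mmap_unshear.
rewrite -[RHS]/((@idfun {poly {mpoly R[n]}}) q); move: q; apply: ppoly_rmorph_ext => [c|j|] /=.
- by rewrite pevC mmapC.
- by rewrite pevC mmapXi snoc_lift snoc_max addrK.
- by rewrite pevX snoc_max.
Qed.

End Shear.
End MpolyEval.

Definition divides (D : comNzRingType) (x y : D) := exists c, y = c * x.

Section Factoriality.
Variable D : idomainType.
Implicit Types x y z p : D.

Definition prime_elt p :=
  [/\ p != 0, p \isn't a GRing.unit & forall x y, divides p (x * y) -> divides p x \/ divides p y].

(** The factors are prime and not merely irreducible, which makes the factorization unique up to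
    units and order. *)
Definition ufd :=
  forall x, x != 0 -> exists2 u, u \is a GRing.unit &
    exists2 s : seq D, (forall p, p \in s -> prime_elt p) & x = u * \prod_(p <- s) p.

Lemma dvd_refl x : divides x x. Proof. by exists 1; rewrite mul1r. Qed.
Lemma dvd0 x : divides x 0. Proof. by exists 0; rewrite mul0r. Qed.
Lemma dvd_trans y x z : divides x y -> divides y z -> divides x z.
Proof. by move=> [a ->] [b ->]; exists (b * a); rewrite mulrA. Qed.
Lemma dvd_mull x y z : divides x z -> divides x (y * z).
Proof. by move=> [a ->]; exists (y * a); rewrite mulrA. Qed.
Lemma dvd_mulr x y z : divides x y -> divides x (y * z).
Proof. by rewrite mulrC; exact: dvd_mull. Qed.
Lemma dvdD x y z : divides x y -> divides x z -> divides x (y + z).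
Proof. by move=> [a ->] [b ->]; exists (a + b); rewrite mulrDl. Qed.
Lemma dvdN x y : divides x y -> divides x (- y).
Proof. by move=> [a ->]; exists (- a); rewrite mulNr. Qed.
Lemma dvdB x y z : divides x y -> divides x z -> divides x (y - z).
Proof. by move=> xy xz; apply: dvdD => //; apply: dvdN. Qed.
Lemma dvd_sum x (I : Type) (r : seq I) (P : pred I) (F : I -> D) :
  (forall i, P i -> divides x (F i)) -> divides x (\sum_(i <- r | P i) F i).
Proof.
by move=> h; apply: (big_ind (divides x)) => //; [exact: dvd0 | move=> ? ?; exact: dvdD].
Qed.

Lemma prime_dvd_prod p (I : eqType) (s : seq I) (F : I -> D) : prime_elt p ->
  divides p (\prod_(i <- s) F i) -> exists2 i, i \in s & divides p (F i).
Proof.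
move=> [p0 pu pp]; elim: s => [|i s IH].
  by rewrite big_nil => -[c /esym cp]; case/negP: pu; apply/unitrPr; exists c; rewrite mulrC.
rewrite big_cons => /pp[h|/IH[j js h]]; first by exists i; rewrite ?mem_head.
by exists j; rewrite // inE js orbT.
Qed.

Lemma prime_dvdM p x y : prime_elt p -> divides p (x * y) -> divides p x \/ divides p y.
Proof. by case=> _ _; apply. Qed.

Lemma prime_dvd_exp p x k : prime_elt p -> divides p (x ^+ k) -> divides p x.
Proof.
move=> pp; elim: k => [|k IH]; last by rewrite exprS; case: pp => _ _ h /h[].
case: (pp) => p0 pu _ [c /esym cp]; case/negP: pu.
by apply/unitrPr; exists c; rewrite mulrC.
Qed.

Lemma prime_dvd_unit p u : prime_elt p -> u \is a GRing.unit -> ~ divides p u.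
Proof.
move=> [p0 pu pp] uu [c uE]; case/negP: pu.
by move: uu; rewrite uE unitrM => /andP[].
Qed.
End Factoriality.

Section FactorialPoly.
Variable B : idomainType.
Implicit Types (b c : B) (p q u v w : {poly B}).

Lemma dvd_polyC b p : divides b%:P p <-> forall i, divides b p`_i.
Proof.
split=> [[q ->] i|h]; first by exists q`_i; rewrite coefMC.
have [f hf] := choice h.
exists (\poly_(i < size p) f i); apply/polyP => i.
rewrite coefMC coef_poly; case: ltnP => [_|/leq_sizeP->]; rewrite ?mul0r //.
Qed.

(** If [b] divides neither [x] nor [y], take the lowest coefficients [x_i] and [y_j] that it does
    not divide: in degree [i + j] of the product all other terms are divisible by [b]. *)
Lemma prime_polyC b : prime_elt b -> prime_elt b%:P.
Proof.
move=> [b0 bu bp]; split; rewrite ?polyC_eq0 //.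
  by rewrite poly_unitE coefC eqxx negb_and (negPf bu) orbT.
move=> x y bxy; apply: contrapT => /not_orP[nx ny].
have ex z : ~ divides b%:P z -> exists i, ~~ `[< divides b z`_i >].
  by move=> nz; apply: contrapT => /forallNP h; apply: nz; apply/dvd_polyC => i;
     apply/asboolP; move: (h i) => /negP; rewrite negbK.
set i := ex_minn (ex _ nx); set j := ex_minn (ex _ ny).
have [hi mi] : ~ divides b x`_i /\ forall k, (k < i)%N -> divides b x`_k.
  rewrite /i; case: ex_minnP => k /asboolPn hk mk; split=> // l lk.
  by apply: contrapT => /asboolPn/mk; rewrite leqNgt lk.
have [hj mj] : ~ divides b y`_j /\ forall k, (k < j)%N -> divides b y`_k.
  rewrite /j; case: ex_minnP => k /asboolPn hk mk; split=> // l lk.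
  by apply: contrapT => /asboolPn/mk; rewrite leqNgt lk.
have /dvd_polyC/(_ (i + j)%N) := bxy; rewrite coefM.
have il : (i < (i + j).+1)%N by rewrite ltnS leq_addr.
rewrite (bigD1 (Ordinal il)) //= addKn => h.
have : divides b (x`_i * y`_j).
  rewrite -(addrK (\sum_(k < (i + j).+1 | k != Ordinal il) x`_k * y`_(i + j - k)) (x`_i * _)).
  apply: dvdB => //; apply: dvd_sum => k ki.
  have [lki|lik] := ltnP k i; first by apply: dvd_mulr; apply: mi.
  apply: dvd_mull; apply: mj.
  have {}lik : (i < k)%N.
    by rewrite ltn_neqAle lik andbT; apply: contra ki => /eqP e; apply/eqP/val_inj.
  by have := ltn_ord k; rewrite ltnS => kij; rewrite ltn_subLR // ltn_add2r.
by move=> /bp[].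
Qed.

Hypothesis fB : ufd B.

(* Gauss's lemma, one prime factor of the constant at a time. *)
Lemma gauss_split c p u v : c != 0 -> c%:P * p = u * v ->
  exists u' v', [/\ p = u' * v', size u' = size u & size v' = size v].
Proof.
move=> c0; have [e eu [s sp cE]] := fB c0; rewrite {c}cE in c0 *.
elim: s sp c0 p u v => [|q s IH] sp c0 p u v.
  rewrite big_nil mulr1 => H; exists (e^-1 *: u), v; split=> //; last first.
    by rewrite size_scale // invr_eq0; apply: contraTneq eu => ->; rewrite unitr0.
  by rewrite -scalerAl -H mul_polyC scalerA mulVr // scale1r.
have qP : prime_elt q by apply: sp; rewrite mem_head.
have sp' x : x \in s -> prime_elt x by move=> h; apply: sp; rewrite inE h orbT.
rewrite big_cons mulrCA in c0 *; move: c0; rewrite mulf_eq0 negb_or => /andP[q0 c0].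
rewrite polyCM -mulrA => H.
have := @prime_dvdM _ _ u v (prime_polyC qP); case.
- by exists ((e * \prod_(j <- s) j)%:P * p); rewrite -H mulrC.
- move=> [w uE]; move: H; rewrite uE mulrAC mulrC => /(mulIf _); rewrite polyC_eq0 q0 => /(_ isT) H.
  have [u' [v' [pE su sv]]] := IH sp' c0 _ _ _ H; exists u', v'; split=> //.
  by rewrite su mulrC mul_polyC size_scale.
- move=> [w vE]; move: H; rewrite vE (mulrA u) mulrC => /(mulIf _); rewrite polyC_eq0 q0 => /(_ isT) H.
  have [u' [v' [pE su sv]]] := IH sp' c0 _ _ _ H; exists u', v'; split=> //.
  by rewrite sv mulrC mul_polyC size_scale.
Qed.

(** The prime factors of [c] are cancelled one by one: each divides [p * w], hence [w], because [p]
    is primitive. Divisibility over the fraction field thus becomes divisibility over [B]. *)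
Lemma primitive_cancel c p u w : c != 0 -> (forall b, prime_elt b -> ~ divides b%:P p) ->
  c%:P * u = p * w -> divides p u.
Proof.
move=> c0 pp; have [e eu [s sp cE]] := fB c0; rewrite {c}cE in c0 *.
elim: s sp c0 u w => [|q s IH] sp c0 u w.
  rewrite big_nil mulr1 => H; exists (e^-1 *: w).
  by rewrite -scalerAl mulrC -H mul_polyC scalerA mulVr // scale1r.
have qP : prime_elt q by apply: sp; rewrite mem_head.
have sp' x : x \in s -> prime_elt x by move=> h; apply: sp; rewrite inE h orbT.
rewrite big_cons mulrCA in c0 *; move: c0; rewrite mulf_eq0 negb_or => /andP[q0 c0].
rewrite polyCM -mulrA => H.
have := @prime_dvdM _ _ p w (prime_polyC qP); case.
- by rewrite -H; exists ((e * \prod_(j <- s) j)%:P * u); rewrite mulrC.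
- by move/(pp _ qP).
move=> [w' wE]; move: H; rewrite wE (mulrA p) mulrC => /(mulIf _); rewrite polyC_eq0 q0 => /(_ isT) H.
exact: (IH sp' c0 _ _ H).
Qed.

(** Over the fraction field [p] is either coprime to [x], and then divides [y], or shares a factor
    with [x]. In the second case [gauss_split] turns the common factor into a factor of [p] over
    [B], which by irreducibility has full degree. *)
Lemma irreducible_prime p : (1 < size p)%N -> (forall b, prime_elt b -> ~ divides b%:P p) ->
  (forall u v, p = u * v -> (size u <= 1)%N \/ (size v <= 1)%N) -> prime_elt p.
Proof.
move=> sp pp irr; have p0 : p != 0 by rewrite -size_poly_gt0 ltnW.
split=> //; first by rewrite poly_unitE negb_and (gtn_eqF sp).
(* [%|] is divisibility up to a nonzero constant, that is, over the fraction field. *)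
have key x : p %| x -> divides p x.
  by move=> /Pdiv.Idomain.dvdpP[[c r] /= c0 H]; apply: (primitive_cancel (w := r) c0 pp);
     rewrite mul_polyC H mulrC.
move=> x y [c xyE]; have [copx|ncop] := boolP (coprimep p x).
  right; apply: key; rewrite -(Gauss_dvdpr _ copx) xyE.
  exact: dvdp_mull.
left; apply: key; have := dvdp_gcdl p x; have gx := dvdp_gcdr p x.
move=> /Pdiv.Idomain.dvdpP[[d r] /= d0]; rewrite -mul_polyC => H.
have [u [v [pE su sv]]] := gauss_split d0 H.
have [|] := irr _ _ pE.
  rewrite su => /size1_polyC rE; apply: dvdp_trans gx.
  apply/Pdiv.Idomain.dvdpP; exists (r`_0, d%:P) => /=; last by rewrite -mul_polyC -rE -H.
  apply: contraTneq d0 => r0; rewrite negbK; move: H; rewrite rE r0 mul0r => /eqP.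
  by rewrite mulf_eq0 (negPf p0) orbF polyC_eq0.
rewrite sv => s1; move: ncop; rewrite coprimep_def => /negP[].
rewrite eqn_leq s1 lt0n size_poly_eq0 gcdp_eq0 (negPf p0) //.
Qed.

(** Induction on the degree and, inside it, on the number of prime factors of the leading
    coefficient: a constant prime dividing [p] is split off, and a primitive [p] either factors in
    lower degree or is prime. *)
Theorem ufd_poly : ufd {poly B}.
Proof.
have mulF (x y : {poly B}) :
  (exists2 u, u \is a GRing.unit & exists2 s : seq _, (forall p, p \in s -> prime_elt p) &
     x = u * \prod_(p <- s) p) ->
  (exists2 u, u \is a GRing.unit & exists2 s : seq _, (forall p, p \in s -> prime_elt p) &
     y = u * \prod_(p <- s) p) ->
  (exists2 u, u \is a GRing.unit & exists2 s : seq _, (forall p, p \in s -> prime_elt p) &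
     x * y = u * \prod_(p <- s) p).
  move=> [u uu [s sp ->]] [v vu [t tp ->]]; exists (u * v); first by rewrite unitrM uu.
  exists (s ++ t); last by rewrite big_cat mulrACA.
  by move=> p; rewrite mem_cat => /orP[/sp|/tp].
have primeF p : prime_elt p -> exists2 u : {poly B}, u \is a GRing.unit &
    exists2 s : seq _, (forall p, p \in s -> prime_elt p) & p = u * \prod_(p <- s) p.
  move=> pp; exists 1; first exact: unitr1.
  by exists [:: p]; [move=> q; rewrite inE => /eqP-> | rewrite big_seq1 mul1r].
move=> p; have [n sn] := ubnP (size p); elim: n => // n IHn in p sn *.
move=> p0; have l0 : lead_coef p != 0 by rewrite lead_coef_eq0.
have [e eu [s sp lE]] := fB l0.
have [m sm] := ubnP (size s); elim: m => // m IHm in p sn p0 l0 s sp lE sm *.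
have [s1|s1] := leqP (size p) 1.
  exists e%:P; first by apply: (rmorph_unit polyC).
  exists [seq b%:P | b <- s]; first by move=> q /mapP[b /sp bp ->]; apply: prime_polyC.
  rewrite big_map [LHS](size1_polyC s1) -rmorph_prod -polyCM -lE; congr (_%:P).
  by rewrite lead_coefE; move: s1; case: (size p) => [|[]].
have [[b bs [q pE]]|nos] := pselect (exists2 b, b \in s & divides b%:P p).
  have bP := sp _ bs; have [b0 _ _] := bP.
  have sq : size p = size q by rewrite pE mulrC mul_polyC size_scale.
  rewrite pE; apply: mulF; last by apply/primeF/prime_polyC.
  have q0 : q != 0 by apply: contraNneq p0 => q0; rewrite pE q0 mul0r.
  apply: (IHm q _ q0 _ (rem b s)); rewrite ?lead_coef_eq0 -?sq //.
  - by move=> x /mem_rem/sp.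
  - have qb : lead_coef q * b = lead_coef p by rewrite pE lead_coefM lead_coefC.
    by apply: (mulIf b0); rewrite qb lE (big_rem _ bs) /= mulrCA mulrC.
  - by rewrite size_rem // -subn1 ltn_subLR ?(leq_trans _ sm) //; case: (s) bs.
(* A prime constant dividing [p] divides the leading coefficient, so it is associate to a member of
   [s]; but no member of [s] divides [p]. *)
have prim b : prime_elt b -> ~ divides b%:P p.
  move=> bP bp; have /dvd_polyC/(_ (size p).-1) := bp; rewrite -lead_coefE lE.
  have [b0 bu bp'] := bP.
  case/bp' => [/(prime_dvd_unit bP eu)//|/(prime_dvd_prod bP)[q qs [c qE]]].
  have [q0 qu qp] := sp _ qs; have := qp c b; rewrite -qE => /(_ (dvd_refl q))[[d dE]|[d dE]].
    case/negP: bu; apply/unitrPr; exists d; apply: (mulfI q0).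
    by rewrite mulr1 [RHS]qE dE; ring.
  apply: nos; exists q => //; apply: dvd_trans bp; exists d%:P.
  by rewrite dE polyCM.
have [[u [v [pE su sv]]]|irr] := pselect (exists u v, [/\ p = u * v, (1 < size u)%N & (1 < size v)%N]).
  have u0 : u != 0 by rewrite -size_poly_gt0 ltnW.
  have v0 : v != 0 by rewrite -size_poly_gt0 ltnW.
  have spE : size p = (size u + size v).-1 by rewrite pE size_mul.
  rewrite pE; apply: mulF; apply: IHn => //.
    apply: leq_trans (sn : (size p <= n)%N); rewrite spE; move: sv; case: (size v) => [|[|k]] // _.
    by rewrite !addnS /= ltnS leq_addr.
  apply: leq_trans (sn : (size p <= n)%N); rewrite spE; move: su; case: (size u) => [|[|k]] // _.
  by rewrite !addSn /= ltnS leq_addl.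
apply: primeF; apply: irreducible_prime => // u v pE.
apply: contrapT => /not_orP[/negP su /negP sv]; apply: irr; exists u, v.
by rewrite !ltnNge.
Qed.
End FactorialPoly.

Section FactorialTransfer.
Variables (A B : idomainType) (f : {rmorphism A -> B}) (g : {rmorphism B -> A}).
Hypotheses (fK : cancel f g) (gK : cancel g f).

Lemma dvd_iso x y : divides x y <-> divides (f x) (f y).
Proof.
split=> [[c ->]|[c cE]]; first by exists (f c); rewrite rmorphM.
by exists (g c); rewrite -[y]fK cE rmorphM fK.
Qed.

Lemma prime_iso x : prime_elt (f x) -> prime_elt x.
Proof.
move=> [x0 xu xp]; split.
- by apply: contraNneq x0 => ->; rewrite rmorph0.
- by apply: contra xu; exact: rmorph_unit.
- by move=> a b /dvd_iso; rewrite rmorphM => /xp; rewrite -!dvd_iso.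
Qed.

Lemma ufd_iso : ufd B -> ufd A.
Proof.
move=> fB x x0; have [|u uu [s sp E]] := fB (f x).
  by apply: contraNneq x0 => e; rewrite -[x]fK e rmorph0.
exists (g u); first exact: rmorph_unit.
exists [seq g p | p <- s].
  by move=> p /mapP[q /sp qp ->]; apply: prime_iso; rewrite gK.
by rewrite big_map -rmorph_prod -rmorphM -E fK.
Qed.
End FactorialTransfer.

Lemma ufd_field (F : fieldType) : ufd F.
Proof.
move=> x x0; exists x; first by rewrite unitfE.
by exists [::]; rewrite ?big_nil ?mulr1.
Qed.

Lemma ufd_mpoly (F : fieldType) n : ufd {mpoly F[n]}.
Proof.
elim: n => [|n IH].
  have e0 : 'I_0 -> F by case.
  pose i0 : {rmorphism F -> F} := idfun.
  apply: (@ufd_iso _ F (mmap i0 e0) (@mpolyC 0 F)); last exact: ufd_field.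
    move=> p; rewrite -[RHS]/((@idfun {mpoly F[0]}) p) -[LHS]/((@mpolyC 0 F \o mmap i0 e0) p).
    by apply: mpoly_rmorph_ext => [c|[]//]; apply: congr1 (mmapC e0 i0 c).
  exact: (mmapC e0 i0).
apply: (ufd_iso (@shearK F n (fun=> 0)) (@unshearK F n (fun=> 0))).
exact: ufd_poly.
Qed.

Lemma prime_assoc (D : idomainType) (p q : D) : prime_elt p -> prime_elt q ->
  divides p q -> exists2 c, c \is a GRing.unit & q = c * p.
Proof.
move=> [p0 pu pp] [q0 qu qp] [c qE]; exists c => //.
have := qp c p; rewrite -qE => /(_ (dvd_refl q))[[d dE]|[d dE]].
  case/negP: pu; apply/unitrPr; exists d; apply: (mulfI q0).
  by rewrite mulr1 [RHS]qE dE; ring.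
apply/unitrPr; exists d; apply: (mulfI q0); rewrite mulr1 [RHS]qE dE; ring.
Qed.

Lemma dvd_sqr_factor (D : idomainType) (p u : D) (s : seq D) : u \is a GRing.unit ->
  (forall q, q \in s -> prime_elt q) -> prime_elt p ->
  divides p (u * \prod_(q <- s) q) ->
  exists2 v, v \is a GRing.unit & exists2 t : seq D, (forall q, q \in t -> q \in s) &
    (size t < size s)%N /\ u * \prod_(q <- s) q = p * (v * \prod_(q <- t) q).
Proof.
move=> uu sp pp /(prime_dvdM pp)[/(prime_dvd_unit pp uu)//|/(prime_dvd_prod pp)[q qs pq]].
have [c cu qE] := prime_assoc pp (sp _ qs) pq.
exists (u * c); first by rewrite unitrM uu.
exists (rem q s); first by move=> x /mem_rem.
split; first by rewrite size_rem //; case: (s) qs.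
by rewrite (big_rem _ qs) /= qE; ring.
Qed.

(** * Nonreal primes *)

Section NonrealPrimes.
Variables (K : fieldType).
Hypothesis n2 : (2 : K) != 0.
Local Notation sos := (@sum_of_powers K 2).

(** Division by [x^2] shows [-1] to be a sum of squares, and [y = ((y+1)/2)^2 - ((y-1)/2)^2]. *)
Lemma sos_isotropic (l : seq K) x y : \sum_(z <- l) z ^+ 2 = 0 -> x \in l -> x != 0 -> sos y.
Proof.
move=> l0 xl x0; rewrite (big_rem _ xl) /= in l0.
have -> : y = ((y + 1) / 2%:R) ^+ 2 + \sum_(z <- rem x l) (z / x * ((y - 1) / 2%:R)) ^+ 2.
  have -> : \sum_(z <- rem x l) (z / x * ((y - 1) / 2)) ^+ 2 = - ((y - 1) / 2) ^+ 2.
    under eq_bigr do rewrite exprMn expr_div_n mulrAC -mulrA.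
    rewrite -mulr_suml; move/eqP: l0; rewrite addrC addr_eq0 => /eqP->.
    by field; rewrite n2 x0.
  by field; rewrite n2.
apply: sum_of_powersD; first exact: sum_of_powersX.
by apply: sum_of_powers_sum => z _; apply: sum_of_powersX.
Qed.

Variables (B : idomainType) (fB : ufd B) (phi : {rmorphism {poly B} -> K}).
Hypothesis phi_inj : injective phi.
Implicit Types (p q r e : {poly B}) (l : seq {poly B}).

Lemma phi_eq0 p : (phi p == 0) = (p == 0).
Proof. by rewrite -(rmorph0 phi) (inj_eq phi_inj). Qed.

(** Up to a square, this is [p] divided by its leading coefficient: a multiplicative substitute for
    the monic associate. *)
Definition mu p := phi p * phi (lead_coef p)%:P.

Lemma muM p q : mu (p * q) = mu p * mu q.
Proof. by rewrite /mu lead_coefM polyCM !rmorphM mulrACA. Qed.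

Lemma sos_phi_sum (l : seq {poly B}) : sos (phi (\sum_(r <- l) r ^+ 2)).
Proof. by rewrite rmorph_sum; apply: sum_of_powers_sum => r _; rewrite rmorphXn; apply: sum_of_powersX. Qed.

(** Over an anisotropic base the squares of the leading coefficients of highest degree cannot
    cancel. *)
Lemma lead_coef_sum_sqr l : (exists2 r, r \in l & r != 0) ->
  (forall s : seq B, \sum_(x <- s) x ^+ 2 = 0 -> forall x, x \in s -> x = 0) ->
  exists d, [/\ exists2 r, r \in l & size r = d.+1, size (\sum_(r <- l) r ^+ 2) = (d.*2).+1
    & lead_coef (\sum_(r <- l) r ^+ 2) = \sum_(r <- l) r`_d ^+ 2].
Proof.
move=> [r0 r0l r00] aniso.
have [d [[r1 r1l sr1] hd]] : exists d, (exists2 r, r \in l & size r = d.+1) /\ forall r, r \in l -> (size r <= d.+1)%N.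
  pose P d := has (fun r => size r == d.+1) l.
  have exP : exists d, P d.
    by exists (size r0).-1; apply/hasP; exists r0; rewrite // prednK // size_poly_gt0.
  have bP d : P d -> (d <= \max_(r <- l) size r)%N.
    by move=> /hasP[r rl /eqP sr]; apply: ltnW; rewrite -sr; apply: (leq_bigmax_seq (P := xpredT)).
  case: (ex_maxnP exP bP) => d /hasP[r rl /eqP sr] dm; exists d; split; first by exists r.
  move=> r' r'l; case: (posnP (size r')) => [->//|sr'].
  by rewrite -(prednK sr') ltnS; apply: dm; apply/hasP; exists r'; rewrite // prednK.
set S := \sum_(r <- l) r ^+ 2.
have cS : S`_(d.*2) = \sum_(r <- l) r`_d ^+ 2.
  rewrite /S coef_sum; apply: eq_big_seq => r rl.
  have {}hd := hd _ rl.
  rewrite expr2 coefM -addnn.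
  have dl : (d < (d + d).+1)%N by rewrite ltnS leq_addr.
  rewrite (bigD1 (Ordinal dl)) //= addnK big1 ?addr0 // => i id.
  have [ltdi|ltid|eqi] := ltngtP i d; last by case/eqP: id; apply: val_inj.
    have : (d < d + d - i)%N by rewrite ltn_subRL ltn_add2r.
    by move=> h; rewrite [r`_(d + d - i)](leq_sizeP _ _ (leq_trans hd h)) ?mulr0.
  by rewrite [r`_i](leq_sizeP _ _ (leq_trans hd ltid)) ?mul0r.
have cS0 : S`_(d.*2) != 0.
  apply: contra_eqN sr1 => /eqP; rewrite cS => S0.
  have : r1`_d = 0.
    apply: (aniso [seq r`_d | r <- l]); first by rewrite big_map.
    exact: (map_f (fun r : {poly B} => r`_d)).
  by move=> h; apply/negP => /eqP sr1; move/eqP: h; rewrite -[d]/(d.+1.-1) -sr1 -lead_coefE lead_coef_eq0 -size_poly_eq0 sr1.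
have sS : size S = (d.*2).+1.
  apply/eqP; rewrite eqn_leq; apply/andP; split; last first.
    by rewrite ltnNge; apply: contra cS0 => /leq_sizeP->.
  rewrite /S; apply: (leq_trans (size_sum _ _ _)); apply/bigmax_leqP_seq => r rl _.
  have := hd _ rl; have [->|r0'] := eqVneq r 0; first by rewrite expr0n size_poly0.
  by move=> h; rewrite expr2 size_mul // -addnn; move: h; move: (size r) => k; lia.
by exists d; split=> //; [exists r1 | rewrite lead_coefE sS].
Qed.

(** One multiplier [c] serves for the whole list, so that passing to remainders turns [\sum r^2]
    into [c^2 \sum r^2] modulo [p]. *)
Lemma common_pseudo_rem p l : p != 0 ->
  exists2 c : B, c != 0 & exists f : {poly B} -> {poly B}, forall r, r \in l ->
    (size (f r) < size p)%N /\ divides p (c%:P * r - f r).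
Proof.
move=> p0; elim: l => [|a l [c c0 [f hf]]].
  by exists 1; [exact: oner_neq0 | exists id].
set k := lead_coef p ^+ scalp a p.
have k0 : k != 0 by rewrite expf_neq0 // lead_coef_eq0.
exists (k * c); first by rewrite mulf_neq0.
exists (fun r => if r == a then c *: (a %% p) else k *: f r) => r.
rewrite inE; case: eqP => [-> _|_ /= rl].
  split; first by rewrite size_scale // ltn_modp.
  exists (c *: (a %/ p)); have := Pdiv.Idomain.divp_eq a p; rewrite -/k => H.
  by rewrite -!mul_polyC polyCM (mulrC k%:P) -mulrA (mul_polyC k) H; ring.
have [s [q qE]] := hf _ rl; split; first by rewrite size_scale.
exists (k%:P * q); rewrite -mul_polyC polyCM (_ : _ - _ = k%:P * (c%:P * r - f r)); last by ring.
by rewrite qE mulrA.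
Qed.

Definition nonreal p := exists2 l, divides p (\sum_(r <- l) r ^+ 2) & exists2 r, r \in l & ~ divides p r.

(* The cofactor of [p] in a relation [p e = \sum r_i^2] with [deg r_i < deg p] has smaller degree
   than [p], and its prime factors are again nonreal. *)
Theorem sos_nonreal_prime p : prime_elt p -> nonreal p -> sos (mu p).
Proof.
(* If squares in the base cancel nontrivially, every element of [K] is a sum of squares. *)
have [iso|aniso] := pselect (exists s : seq B, \sum_(x <- s) x ^+ 2 = 0 /\ exists2 x, x \in s & x != 0).
  move=> _ _; have [s [s0 [x xs x0]]] := iso.
  apply: (@sos_isotropic [seq phi y%:P | y <- s] (phi x%:P)).
  - rewrite big_map; under eq_bigr do rewrite -rmorphXn -polyC_exp.
    by rewrite -!rmorph_sum s0 !rmorph0.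
  - exact: (map_f (fun y => phi y%:P)).
  - by rewrite phi_eq0 polyC_eq0.
have {}aniso s : \sum_(x <- s) x ^+ 2 = 0 -> forall x : B, x \in s -> x = 0.
  by move=> s0 x xs; apply: contrapT => /eqP x0; apply: aniso; exists s; split=> //; exists x.
have [n] := ubnP (size p); elim: n p => // n IHn p; rewrite ltnS => sn pp [l pl [r rl npr]].
have [p0 _ _] := pp.
have [sp|sp] := leqP (size p) 1.
  rewrite /mu [p in phi p](size1_polyC sp) lead_coefE.
  suff -> : (size p).-1 = 0%N by rewrite -expr2; apply: sum_of_powersX.
  by move: sp; case: (size p) => [|[]].
have [l' [sl' [r' r'l' r'0] [e eE]]] : exists l', [/\ forall r, r \in l' -> (size r < size p)%N,
    exists2 r, r \in l' & r != 0 & divides p (\sum_(r <- l') r ^+ 2)].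
  have [c c0 [f hf]] := common_pseudo_rem l p0.
  exists [seq f r | r <- l]; split.
  - by move=> _ /mapP[x xl ->]; have [] := hf _ xl.
  - exists (f r); first exact: map_f.
    have [_ pf] := hf _ rl; apply/eqP => f0; apply: npr.
    move: pf; rewrite f0 subr0 => /(prime_dvdM pp)[[d /(congr1 (size : {poly B} -> nat))]|//].
    rewrite size_polyC c0; have [->|d0] := eqVneq d 0; first by rewrite mul0r size_poly0.
    rewrite size_mul // => h.
    have : (0 < size d)%N by rewrite size_poly_gt0.
    by move: h sp; move: (size d) (size p) => a b /=; clear; lia.
  - rewrite big_map (_ : \sum_(i <- l) f i ^+ 2 = c%:P ^+ 2 * (\sum_(i <- l) i ^+ 2)
       - \sum_(i <- l) ((c%:P * i) ^+ 2 - f i ^+ 2)).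
      apply: dvdB; first exact: dvd_mull.
      rewrite big_seq; apply: dvd_sum => i il; rewrite subr_sqr; apply: dvd_mulr.
      by have [] := hf _ il.
    rewrite big_split /= sumrN opprD opprK addrA mulr_sumr.
    by under [X in _ - X + _]eq_bigr do rewrite exprMn; rewrite subrr add0r.
have {r rl npr l pl r' r'l' r'0}ex0 : exists2 r, r \in l' & r != 0 by exists r'.
have e0 : e != 0.
  apply: contraTneq isT => e0; have [d [_ sd _]] := lead_coef_sum_sqr ex0 aniso.
  by move: sd; rewrite eE e0 mul0r size_poly0.
have [u uu [s sp' es]] := ufd_poly fB e0.
have [m] := ubnP (size s); elim: m => // m IHm in l' sl' ex0 e eE e0 u uu s sp' es *.
rewrite ltnS => sm.
(* A prime [q] dividing every [r] is not associate to [p], because the [r] have smaller degree than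
   [p]. Hence [q^2] divides [e], and the relation can be divided by [q^2]. *)
have [[q qs qall]|nq] := pselect (exists2 q, q \in s & forall r, r \in l' -> divides q r).
  have qp := sp' _ qs; have [q0 qu _] := qp.
  have nqp : ~ divides q p.
    move=> /(prime_assoc qp pp)[c cu pE]; have [r rl r0] := ex0.
    have [d rE] := qall _ rl; have := sl' _ rl.
    have : divides p r by exists (d * c^-1); rewrite pE mulrA divrK // -rE.
    move=> [d' r'E]; have d'0 : d' != 0 by apply: contraNneq r0 => h; rewrite r'E h mul0r.
    rewrite r'E size_mul //; have : (0 < size d')%N by rewrite size_poly_gt0.
    by move: (size d') (size p) => a b; clear; lia.
  have [f hf] : exists f : {poly B} -> {poly B}, forall r, r \in l' -> r = f r * q.
    exists (fun r => if pselect (divides q r) is left h then sval (cid h) else 0) => r rl.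
    by case: pselect => [h|/(_ (qall _ rl))//]; exact: (svalP (cid h)).
  set s1 := rem q s.
  have es1 : e = q * (u * \prod_(x <- s1) x) by rewrite es (big_rem _ qs) /= mulrCA.
  have sumE : \sum_(r <- l') r ^+ 2 = q ^+ 2 * \sum_(r <- [seq f r | r <- l']) r ^+ 2.
    rewrite big_map mulr_sumr; apply: eq_big_seq => r rl; rewrite {1}(hf _ rl); ring.
  have H1 : u * (\prod_(x <- s1) x) * p = q * \sum_(r <- [seq f r | r <- l']) r ^+ 2.
    by apply: (mulfI q0); rewrite mulrA mulrA -es1 -eE sumE; ring.
  have /(prime_dvdM qp)[qd|//] : divides q (u * \prod_(x <- s1) x * p).
    by rewrite H1; exists (\sum_(r <- [seq f r | r <- l']) r ^+ 2); rewrite mulrC.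
  have ss1 x : x \in s1 -> prime_elt x by move=> /mem_rem/sp'.
  have [v vu [t ts [st tE]]] := dvd_sqr_factor uu ss1 qp qd.
  apply: (IHm [seq f r | r <- l'] _ _ (v * \prod_(x <- t) x) _ _ v vu t) => //.
  - move=> _ /mapP[r rl ->]; apply: leq_ltn_trans (sl' _ rl).
    have [->|fr0] := eqVneq (f r) 0; first by rewrite size_poly0.
    rewrite {2}(hf _ rl) size_mul //; have : (0 < size q)%N by rewrite size_poly_gt0.
    by move: (size q) (size (f r)) => a b; clear; lia.
  - have [r rl r0] := ex0; exists (f r); first exact: map_f.
    by apply: contraNneq r0 => h; rewrite (hf _ rl) h mul0r.
  - by apply: (mulfI q0); rewrite -H1 tE -!mulrA.
  - by apply: contraNneq e0 => h; rewrite es1 tE h !mulr0.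
  - by move=> x /ts/ss1.
  - by apply: leq_trans st _; rewrite /s1 size_rem // -ltnS prednK //; [exact: leq_trans sm _|case: (s) qs].
have [d [[rd rdl srd] sS lS]] := lead_coef_sum_sqr ex0 aniso.
(* [deg e + deg p = 2 d] with [d < deg p]. *)
have se : (size e < size p)%N.
  have := sl' _ rdl; rewrite srd; move: sS; rewrite eE size_mul //.
  have : (0 < size e)%N by rewrite size_poly_gt0.
  by rewrite -addnn; move: (size e) (size p) => a b; clear; lia.
have mue : sos (mu e).
  (* A prime factor [x] of [e] divides [\sum r^2] but not every [r], common factors having been
     removed; so [x] is nonreal and the induction applies to it. *)
  have muprod t : (forall x, x \in t -> x \in s) -> sos (mu (\prod_(x <- t) x)).
    elim: t => [|x t IH] ts.
      by rewrite big_nil /mu lead_coef1 -expr2; apply: sum_of_powersX.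
    rewrite big_cons muM; apply: sum_of_powersM; last by apply: IH => y yt; apply: ts; rewrite inE yt orbT.
    have xs := ts _ (mem_head _ _).
    have xe : divides x e.
      by rewrite es (big_rem _ xs) /=; exists (u * \prod_(y <- rem x s) y); ring.
    apply: IHn; [|exact: sp'|].
    - have [c eE'] := xe; have c0 : c != 0 by apply: contraNneq e0 => h; rewrite eE' h mul0r.
      have x0 : x != 0 by have [] := sp' _ xs.
      apply: leq_trans sn; apply: leq_ltn_trans se; rewrite eE' size_mul //.
      have : (0 < size c)%N by rewrite size_poly_gt0.
      by move: (size c) (size x) => a b; clear; lia.
    - exists l'; first by rewrite eE; apply: dvd_mulr.
      apply: contrapT => h; apply: nq; exists x => // y yl.
      by apply: contrapT => nxy; apply: h; exists y.
  rewrite es muM; apply: sum_of_powersM; last exact: muprod.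
  move: uu; rewrite poly_unitE => /andP[/eqP su _].
  rewrite /mu lead_coefE su [u in phi u]size1_polyC ?su //= -expr2; exact: sum_of_powersX.
(* Up to the square in the denominator, [mu p] is the product of [p e], [mu e] and the leading
   coefficient of [p e], all three of which are sums of squares. *)
have -> : mu p = (phi p * phi e) * mu e * (phi (lead_coef p * lead_coef e)%:P) / (phi e * phi (lead_coef e)%:P) ^+ 2.
  rewrite polyCM rmorphM /mu; field.
  by rewrite !phi_eq0 polyC_eq0 lead_coef_eq0 e0.
apply: sum_of_powers_div; last exact: sum_of_powersX.
apply: sum_of_powersM; first apply: sum_of_powersM => //.
  by rewrite -rmorphM mulrC -eE; apply: sos_phi_sum.
rewrite mulrC -lead_coefM -eE lS !rmorph_sum; apply: sum_of_powers_sum => r _ /=.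
by rewrite polyC_exp rmorphXn; apply: sum_of_powersX.
Qed.
End NonrealPrimes.

(** * Elimination along a generic line *)

Section GenericCoprime.
Variable k : fieldType.
Implicit Types (rho b : {poly k}) (H : {poly {poly k}}).

(** Newton's divided differences: the differences of the nodes [z] are invertible constants, so
    every division step preserves divisibility by [rho]. *)
Lemma dvdp_lead_of_values rho H (s : seq k) : uniq s -> (size H <= size s)%N ->
  (forall z, z \in s -> rho %| H.[z%:P]) -> rho %| lead_coef H.
Proof.
elim: s H => [|z0 s IH] H /=.
  by move=> _; rewrite leqn0 size_poly_eq0 => /eqP-> _; rewrite lead_coef0 dvdp0.
move=> /andP[z0s us] sH hs.
have [sH1|sH1] := leqP (size H) 1.
  have := hs z0 (mem_head _ _); rewrite (size1_polyC sH1) hornerC lead_coefC.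
  by [].
have [Q HQ] : exists Q, H = Q * ('X - z0%:P%:P) + H.[z0%:P]%:P.
  have /factor_theorem[Q HQ] : root (H - H.[z0%:P]%:P) z0%:P.
    by rewrite rootE hornerD hornerN hornerC subrr.
  by exists Q; rewrite -HQ subrK.
have Q0 : Q != 0.
  by apply: contraTneq sH1 => Q0; rewrite HQ Q0 mul0r add0r -leqNgt size_polyC leq_b1.
have sQ : size H = (size Q).+1.
  rewrite HQ size_polyDl ?size_mul ?polyXsubC_eq0 ?size_XsubC ?addn2 //=.
  rewrite size_polyC; apply: (leq_ltn_trans (leq_b1 _)).
  by rewrite ltnS size_poly_gt0.
have -> : lead_coef H = lead_coef Q.
  rewrite [in LHS]HQ lead_coefDl ?lead_coefM ?lead_coefXsubC ?mulr1 //.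
  rewrite size_polyC size_mul ?polyXsubC_eq0 ?size_XsubC ?addn2 //=.
  by rewrite (leq_ltn_trans (leq_b1 _)) // ltnS size_poly_gt0.
apply: IH => //; first by rewrite -ltnS -sQ.
move=> z zs; have hz : rho %| H.[z%:P] by apply: hs; rewrite inE zs orbT.
have hz0 : rho %| H.[z0%:P] by apply: hs; rewrite mem_head.
have zz0 : z - z0 != 0 by rewrite subr_eq0; apply: contraNneq z0s => <-.
have := dvdp_sub hz hz0; rewrite {1}HQ !hornerE addrK -polyCB mulrC mul_polyC.
by rewrite dvdpZr.
Qed.

(** If some value of [H] has a proper common factor with [rho], then [rho] is split along it.
    Otherwise each value that is not coprime to [rho] is a multiple of [rho], and too many of these
    would make [rho] divide the leading coefficient. *)
Lemma generic_coprime rho H : rho != 0 -> coprimep rho (lead_coef H) ->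
  exists2 b, b != 0 & forall z, b.[z] != 0 -> coprimep rho H.[z%:P].
Proof.
have [n] := ubnP (size rho); elim: n rho => // n IHn rho; rewrite ltnS => sn rho0 cop.
have [s1|s1] := leqP (size rho) 1.
  exists 1; first exact: oner_neq0.
  move=> z _; apply: coprimep_dvdr (coprime1p _).
  by rewrite dvdp1 eqn_leq s1 size_poly_gt0.
have [[z0 /andP[g1 g2]]|hz] := pselect (exists z0, (1 < size (gcdp rho H.[z0%:P]) < size rho)%N).
  set d := gcdp rho _ in g1 g2.
  have d0 : d != 0 by rewrite -size_poly_gt0 ltnW.
  have rhoE := divpK (dvdp_gcdl rho H.[z0%:P]); rewrite -/d in rhoE; set q := rho %/ d in rhoE.
  have q0 : q != 0 by apply: contraNneq rho0 => q0; rewrite -rhoE q0 mul0r.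
  have sr : size rho = (size q + size d).-1 by rewrite -rhoE size_mul.
  have [b1 b10 h1] : exists2 b, b != 0 & forall z, b.[z] != 0 -> coprimep d H.[z%:P].
    apply: IHn => //; first by apply: leq_trans sn.
    by apply: coprimep_dvdr cop; rewrite -rhoE dvdp_mull.
  have [b2 b20 h2] : exists2 b, b != 0 & forall z, b.[z] != 0 -> coprimep q H.[z%:P].
    apply: IHn => //.
      by apply: leq_trans sn; move: sr g1 s1; move: (size q) (size d) (size rho) => a b c; clear; lia.
    by apply: coprimep_dvdr cop; rewrite -rhoE dvdp_mulr.
  exists (b1 * b2); first exact: mulf_neq0.
  move=> z; rewrite hornerM mulf_eq0 negb_or => /andP[/h1 c1 /h2 c2].
  by rewrite -rhoE coprimepMl c2.
have bad z : ~~ coprimep rho H.[z%:P] -> rho %| H.[z%:P].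
  rewrite coprimep_def => ng; have g0 : gcdp rho H.[z%:P] != 0 by rewrite gcdp_eq0 negb_and rho0.
  have sg : (size rho <= size (gcdp rho H.[z%:P]))%N.
    rewrite leqNgt; apply/negP => lt; apply: hz; exists z; rewrite lt andbT.
    by rewrite ltn_neqAle eq_sym ng size_poly_gt0.
  apply: dvdp_trans (dvdp_gcdr rho _).
  have /eqp_dvdl <- : gcdp rho H.[z%:P] %= rho; last exact: dvdpp.
  rewrite -dvdp_size_eqp ?dvdp_gcdl // eqn_leq sg andbT.
  by apply: dvdp_leq => //; apply: dvdp_gcdl.
pose Bd m := `[< exists s : seq k, [/\ uniq s, size s = m & forall z, z \in s -> ~~ coprimep rho H.[z%:P]] >].
have exB : exists m, Bd m by exists 0%N; apply/asboolP; exists [::].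
have bB m : Bd m -> (m <= size H)%N.
  move=> /asboolP[s [us sm hs]]; rewrite leqNgt; apply/negP => lt.
  have : rho %| lead_coef H.
    by apply: (@dvdp_lead_of_values _ _ s) => //; [rewrite sm ltnW | move=> z /hs/bad].
  move=> dv; move: cop; rewrite coprimep_def.
  have /eqp_size -> := dvdp_gcd_idl dv.
  by rewrite (gtn_eqF s1).
case: (ex_maxnP exB bB) => m /asboolP[s [us sm hs]] mmax.
exists (\prod_(z <- s) ('X - z%:P)); first by apply/monic_neq0/monic_prod_XsubC.
move=> z bz; apply: contrapT => /negP nc.
have zs : z \notin s by rewrite -root_prod_XsubC rootE.
suff /mmax : Bd m.+1 by rewrite ltnn.
apply/asboolP; exists (z :: s); split; rewrite /= ?zs ?sm //.
by move=> y; rewrite inE => /orP[/eqP->|/hs].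
Qed.
End GenericCoprime.

(** The resultant lies in the ideal of [h] and [g]. If it vanished, their common factor over the
    fraction field would be a multiple of the prime [h], and [h] would divide [g]. *)
Lemma bezout_prime (A : idomainType) (h g : {poly A}) : prime_elt h -> h \is monic ->
  ~ divides h g -> exists2 r : A, r != 0 & exists u v, r%:P = u * h + v * g.
Proof.
move=> hp hm nhg; have [h0 hu _] := hp.
have sh : (1 < size h)%N.
  rewrite ltnNge; apply/negP => sh; case/negP: hu.
  move: hm; rewrite monicE lead_coefE; have := size1_polyC sh.
  have -> : (size h).-1 = 0%N by move: sh; case: (size h) => [|[]].
  by move=> hE /eqP h1; rewrite hE h1 unitr1.
have [sg|sg] := leqP (size g) 1.
  exists g`_0; last by exists 0, 1; rewrite mul0r add0r mul1r -size1_polyC.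
  by apply/eqP => g0; apply: nhg; exists 0; rewrite mul0r (size1_polyC sg) g0.
have [[u v] _ E] := resultant_in_ideal sh sg.
exists (resultant h g); last by exists u, v.
rewrite resultant_eq0 -leqNgt; apply/negPn/negP; rewrite -ltnNge => sd; apply: nhg.
set d := gcdp h g in sd.
have d0 : d != 0 by rewrite -size_poly_gt0 ltnW.
have lt_ndvd (c : A) : c != 0 -> ~ divides h c%:P.
  move=> c0 [q /(congr1 (size : {poly A} -> nat))]; rewrite size_polyC c0.
  have [->|q0] := eqVneq q 0; first by rewrite mul0r size_poly0.
  rewrite size_mul //= => e; have : (0 < size q)%N by rewrite size_poly_gt0.
  by move: e sh; move: (size q) (size h) => a b; clear; lia.
have /Pdiv.Idomain.dvdpP[[c q] /= c0 cE] := dvdp_gcdl h g; rewrite -/d in cE.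
have /Pdiv.Idomain.dvdpP[[c' q'] /= c'0 c'E] := dvdp_gcdr h g; rewrite -/d in c'E.
have hd : divides h d.
  have /(prime_dvdM hp)[[e qE]|//] : divides h (q * d).
    by rewrite -cE; exists c%:P; rewrite mul_polyC.
  exfalso.
  have e0 : e != 0.
    by apply: contraNneq c0 => e0; move/eqP: cE; rewrite qE e0 !mul0r -mul_polyC mulf_eq0 (negPf h0) orbF polyC_eq0.
  have : size (c%:P : {poly A}) = 1%N by rewrite size_polyC c0.
  have -> : c%:P = e * d by apply: (mulIf h0); rewrite mul_polyC cE qE; ring.
  rewrite size_mul // => s1; have : (0 < size e)%N by rewrite size_poly_gt0.
  by move: s1 sd; move: (size e) (size d) => a b; clear; lia.
have /(prime_dvdM hp)[/(lt_ndvd _ c'0)//|//] : divides h (c'%:P * g).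
by rewrite mul_polyC c'E; apply: dvd_mull.
Qed.

(** * Elimination at a zero of the reduced polynomial *)

Section Elimination.
Variables (A : idomainType) (k : fieldType) (psi : {rmorphism A -> k}).
Variables (h g : {poly A}) (theta : k) (H1 : {poly k}).
Hypotheses (hm : h \is monic) (hE : map_poly psi h = ('X - theta%:P) * H1).
Hypotheses (cop : coprimep H1 (map_poly psi g)).
Implicit Types (x : {poly A}).

Definition null x := map_poly psi x = 0.

Let N := (size h).-1.

Lemma elim_size : size h = N.+1.
Proof. by rewrite /N prednK // size_poly_gt0 monic_neq0. Qed.

Lemma elim_monic_reduce x : exists2 r : {poly A}, (size r <= N)%N & divides h (x - r) /\ (null x -> null r).
Proof.
exists (Pdiv.Ring.rmodp x h).
  by rewrite -ltnS -elim_size Pdiv.Ring.ltn_rmodp monic_neq0.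
have xE := Pdiv.RingMonic.rdivp_eq hm x.
split; first by exists (Pdiv.Ring.rdivp x h); rewrite {1}xE addrK.
rewrite /null => x0; set r := Pdiv.Ring.rmodp x h in xE *; set q := Pdiv.Ring.rdivp x h in xE.
have sr : (size (map_poly psi r) < size (map_poly psi h))%N.
  rewrite [X in (_ < X)%N]size_map_poly_id0 ?(monicP hm) ?rmorph1 ?oner_neq0 //.
  by apply: leq_ltn_trans (size_poly _ _) _; rewrite Pdiv.Ring.ltn_rmodp monic_neq0.
have E : map_poly psi r = - map_poly psi q * map_poly psi h.
  apply/eqP; rewrite mulNr -addr_eq0 addrC -rmorphM -rmorphD -xE. exact/eqP.
move: sr; rewrite E; have [->|q0] := eqVneq (map_poly psi q) 0; first by rewrite oppr0 mul0r.
have h0 : map_poly psi h != 0 by apply: monic_neq0; apply: monic_map.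
rewrite mulNr size_polyN size_mul // => lt; exfalso; move: lt.
have : (0 < size (map_poly psi q))%N by rewrite size_poly_gt0.
by move: (size (map_poly psi q)) (size (map_poly psi h)) => a b; clear; lia.
Qed.

Let u (i : nat) : {poly A} := if i is j.+1 then Pdiv.Ring.rmodp (g * 'X^j) h else 1.

Lemma psi_h_monic : map_poly psi h \is monic.
Proof. exact: monic_map. Qed.

Lemma size_psi_h : size (map_poly psi h) = N.+1.
Proof. by rewrite size_map_poly_id0 ?elim_size // (monicP hm) rmorph1 oner_neq0. Qed.

Lemma N_gt0 : (0 < N)%N.
Proof.
have H10 : H1 != 0.
  by apply: contraTneq (monic_neq0 psi_h_monic) => h0; rewrite hE h0 mulr0 eqxx.
have := size_psi_h; rewrite hE size_mul ?polyXsubC_eq0 // size_XsubC /= => -[<-].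
by rewrite size_poly_gt0.
Qed.

Lemma size_u i : (size (u i) <= N)%N.
Proof.
case: i => [|i]; first by rewrite size_poly1 N_gt0.
by rewrite -ltnS -elim_size Pdiv.Ring.ltn_rmodp monic_neq0.
Qed.

Lemma u_congr i : exists q, u i.+1 = g * 'X^i - q * h.
Proof.
exists (Pdiv.Ring.rdivp (g * 'X^i) h).
apply/eqP; rewrite eq_sym subr_eq addrC; apply/eqP.
exact: (Pdiv.RingMonic.rdivp_eq hm (g * 'X^i)).
Qed.

(** By Bezout for [H1] and [psi g], the polynomial [X - theta] is a multiple of [psi g] modulo
    [psi h]; so the constants and the multiples of [psi g] span [k[X]/(psi h)]. *)
Lemma elim_span (x : {poly k}) : (size x <= N)%N ->
  exists c : nat -> k, x = \sum_(i < N.+1) c i *: map_poly psi (u i).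
Proof.
move=> sx.
have [[a b] /= ab] : exists ab, ab.1 * H1 + ab.2 * map_poly psi g = 1.
  exact/Bezout_eq1_coprimepP.
have [x1 xE] : exists x1 : {poly k}, x = x1 * ('X - theta%:P) + x.[theta]%:P.
  have /factor_theorem[Q HQ] : root (x - x.[theta]%:P) theta.
    by rewrite rootE !hornerE subrr.
  by exists Q; rewrite -HQ subrK.
pose w := (x1 * b * ('X - theta%:P)) %% map_poly psi h.
have sw : (size w <= N)%N by rewrite -ltnS -size_psi_h ltn_modp monic_neq0 ?psi_h_monic.
pose c i := if i is j.+1 then w`_j else x.[theta].
exists c; set y := \sum_(_ < _) _.
have sy : (size y <= N)%N.
  apply: (leq_trans (size_sum _ _ _)); apply/bigmax_leqP => i _.
  apply: (leq_trans (size_scale_leq _ _)); apply: (leq_trans (size_poly _ _)).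
  exact: size_u.
have modE (p : {poly k}) : (size p <= N)%N -> p %% map_poly psi h = p.
  by move=> sp; rewrite modp_small // size_psi_h ltnS.
suff : (x - y) %% map_poly psi h = 0.
  by rewrite modpD modpN !modE // => /eqP; rewrite subr_eq0 => /eqP.
apply/eqP; rewrite -/(map_poly psi h %| (x - y)).
have [f fE] := choice u_congr.
have yE : y = x.[theta]%:P + w * map_poly psi g - (\sum_(j < N) w`_j *: map_poly psi (f j)) * map_poly psi h.
  rewrite /y big_ord_recl [u ord0]/= [c ord0]/= rmorph1 alg_polyC -addrA; congr (_ + _).
  have wS : w = \sum_(j < N) w`_j *: 'X^j.
    rewrite -(poly_def N (fun j => w`_j)); apply/polyP => l; rewrite coef_poly.
    by case: ltnP => // Nl; rewrite nth_default // (leq_trans sw).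
  rewrite [X in X * map_poly psi g - _]wS !mulr_suml -sumrB; apply: eq_bigr => j _.
  rewrite [u _](fE j) [c _]/= rmorphB !rmorphM /= map_polyXn -!scalerAl -scalerBr.
  by rewrite [_ * 'X^j]mulrC.
have wE : x1 * b * ('X - theta%:P) = (x1 * b * ('X - theta%:P)) %/ map_poly psi h * map_poly psi h + w.
  exact: divp_eq.
have -> : x - y = (x1 * a + ((x1 * b * ('X - theta%:P)) %/ map_poly psi h) * map_poly psi g
     + \sum_(j < N) w`_j *: map_poly psi (f j)) * map_poly psi h.
  rewrite yE.
  have -> : w = x1 * b * ('X - theta%:P) - (x1 * b * ('X - theta%:P)) %/ map_poly psi h * map_poly psi h.
    by rewrite {1}wE addrC addKr.
  have e1 : x1 * ('X - theta%:P) = x1 * a * map_poly psi h + x1 * b * ('X - theta%:P) * map_poly psi g.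
    by rewrite -[x1 in LHS]mulr1 -ab hE; ring.
  by rewrite {1}xE e1; ring.
exact: dvdp_mull.
Qed.

(** Nakayama's lemma in explicit form: in the free module [A[X]/(h)], the matrix of [1] and the
    [g X^j] has a maximal minor [s] that survives under [psi], and Cramer's rule expresses [s x]
    through these elements. The coefficients are linear in the remainder of [x] modulo [h], so they
    vanish under [psi] when [x] does. *)
Theorem elim_cyclic : exists2 s, psi s != 0 & forall x, exists (t : A) (e : {poly A}),
  divides h (s%:P * x - t%:P - g * e) /\ (null x -> psi t = 0 /\ null e).
Proof.
pose M := \matrix_(i < N.+1) poly_rV (u i) : 'M[A]_(N.+1, N).
have full : row_full (map_mx psi M).
  rewrite -sub1mx; apply/row_subP => j.
  have [|c cE] := @elim_span ('X^j); first by rewrite size_polyXn ltn_ord.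
  have -> : row j 1%:M = \row_i c i *m map_mx psi M.
    apply/rowP => l; rewrite !mxE; have /(congr1 (fun p : {poly k} => p`_l)) := cE.
    rewrite coefXn coef_sum eq_sym (inj_eq val_inj) => ->; apply: eq_bigr => i _.
    by rewrite !mxE coefZ coef_map.
  exact: submxMl.
pose f := fullrankfun full.
pose Bm := rowsub f M.
have Bu : psi (\det Bm) != 0.
  by rewrite -det_map_mx -unitfE -unitmxE map_mxsub fullrowsub_unit.
exists (\det Bm) => // x; have [r sr [xr nr]] := elim_monic_reduce x.
pose c : 'rV[A]_N.+1 := poly_rV r *m \adj Bm *m rowsub f 1%:M.
have cM : c *m M = \det Bm *: poly_rV r.
  rewrite /c -!mulmxA mul_rowsub_mx mul1mx -/Bm mul_adj_mx.
  by rewrite mul_mx_scalar.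
have sumE : \det Bm *: r = \sum_(i < N.+1) c 0 i *: u i.
  apply/polyP => l; rewrite coefZ coef_sum.
  have [lN|lN] := ltnP l N; last first.
    rewrite nth_default ?(leq_trans sr) // mulr0 big1 // => i _.
    by rewrite coefZ nth_default ?mulr0 // (leq_trans (size_u _)).
  have := congr1 (fun v : 'rV[A]_N => v 0 (Ordinal lN)) cM; rewrite !mxE /= => <-.
  by apply: eq_bigr => i _; rewrite coefZ !mxE.
exists (c 0 0), (\sum_(i < N) c 0 (lift ord0 i) *: 'X^i); split.
  have [q qE] := xr.
  have -> : (\det Bm)%:P * x = (\det Bm)%:P * q * h + \det Bm *: r.
    by rewrite -mul_polyC -[x](subrK r) qE; ring.
  rewrite sumE big_ord_recl [u ord0]/= alg_polyC.
  have [fq fE] := choice u_congr.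
  exists ((\det Bm)%:P * q - \sum_(i < N) c 0 (lift ord0 i) *: fq i).
  under eq_bigr => i _ do rewrite [u _](fE i) scalerBr scalerAr scalerAl.
  by rewrite sumrB -mulr_sumr -mulr_suml; ring.
move=> /nr r0; have rv0 : map_mx psi (poly_rV r : 'rV_N) = 0.
  by apply/rowP => i; rewrite !mxE -coef_map r0 coef0.
have c0 : map_mx psi c = 0 by rewrite !map_mxM rv0 !mul0mx.
have c0' i : psi (c 0 i) = 0.
  by have := congr1 (fun v : 'rV[k]_N.+1 => v 0 i) c0; rewrite !mxE.
split=> //; rewrite /null rmorph_sum big1 // => i _ /=.
by rewrite map_polyZ /= c0' scale0r.
Qed.
End Elimination.

Section EliminationNorm.
Variables (A : idomainType) (k : fieldType) (psi : {rmorphism A -> k}).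
Variables (h g : {poly A}) (theta : k) (H1 : {poly k}).
Hypotheses (hm : h \is monic) (hE : map_poly psi h = ('X - theta%:P) * H1).
Hypotheses (H1t : H1.[theta] != 0) (cop : coprimep H1 (map_poly psi g)).

Let ev (p : {poly A}) := (map_poly psi p).[theta].
Hypothesis gt : ev g = 0.

Lemma pseudo_divXsub (s t : A) (p : {poly A}) : exists n q c,
  (s ^+ n)%:P * p = (s%:P * 'X - t%:P) * q + c%:P.
Proof.
elim/poly_ind: p => [|p a [n [q [c E]]]].
  by exists 0%N, 0, 0; rewrite mulr0 addr0 !mulr0.
exists n.+1, ((s ^+ n)%:P * p + t%:P * q), (c * t + s ^+ n.+1 * a).
rewrite polyCD !polyCM [in LHS]exprS !polyCM mulrDr (mulrC s%:P) -!mulrA.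
have -> : (s ^+ n)%:P * (s%:P * (p * 'X)) = (s%:P * 'X) * ((s ^+ n)%:P * p) by ring.
have -> : (s%:P * 'X - t%:P) * ((s ^+ n)%:P * p + t%:P * q) =
  s%:P * 'X * ((s ^+ n)%:P * p) + t%:P * ((s%:P * 'X - t%:P) * q - (s ^+ n)%:P * p) by ring.
by rewrite E exprS polyCM; ring.
Qed.

Lemma ev_rmorphM p q : ev (p * q) = ev p * ev q.
Proof. by rewrite /ev rmorphM hornerM. Qed.
Lemma ev_rmorphD p q : ev (p + q) = ev p + ev q.
Proof. by rewrite /ev rmorphD hornerD. Qed.
Lemma ev_rmorphB p q : ev (p - q) = ev p - ev q.
Proof. by rewrite /ev rmorphB /= hornerD hornerN. Qed.
Lemma evC c : ev c%:P = psi c.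
Proof. by rewrite /ev map_polyC hornerC. Qed.
Lemma evX : ev 'X = theta.
Proof. by rewrite /ev map_polyX hornerX. Qed.
Lemma ev_h : ev h = 0.
Proof. by rewrite /ev hE !hornerE subrr mul0r. Qed.

(* The line parametrised by [t] meets [h = g = 0] only at [theta], transversally to [h]: then [g]
   divides an element of the base ring up to a factor invertible at [theta].  The factor is a
   lift of the cofactor [H1], corrected by means of [elim_cyclic]. *)
Theorem elim_norm : exists (f0 : A) (V : {poly A}),
  divides h (g * V - f0%:P) /\ ev V != 0.
Proof.
have [s s0 cyc] := elim_cyclic hm hE cop.
(* Modulo [h] and [g] the variable becomes the fraction [t/s], whose value at the point is
   [theta]. *)
have [t [e [[q qE] _]]] := cyc 'X.
have st : psi s * theta = psi t.
  apply/eqP; rewrite -subr_eq0 -!evC -evX -ev_rmorphM -ev_rmorphB.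
  have -> : s%:P * 'X - t%:P = q * h + g * e by rewrite -qE subrK.
  by rewrite ev_rmorphD !ev_rmorphM ev_h gt mulr0 mul0r addr0.
have st0 : ev (s%:P * 'X - t%:P) = 0 by rewrite ev_rmorphB ev_rmorphM !evC evX st subrr.
have [n [qh [ch hq]]] := pseudo_divXsub s t h.
have [m [qg [cg gq]]] := pseudo_divXsub s t g.
have ch0 : psi ch = 0.
  have : ev ((s ^+ n)%:P * h) = ev ((s%:P * 'X - t%:P) * qh + ch%:P) by rewrite hq.
  by rewrite ev_rmorphM ev_h mulr0 ev_rmorphD ev_rmorphM st0 mul0r add0r evC.
have cg0 : psi cg = 0.
  have : ev ((s ^+ m)%:P * g) = ev ((s%:P * 'X - t%:P) * qg + cg%:P) by rewrite gq.
  by rewrite ev_rmorphM gt mulr0 ev_rmorphD ev_rmorphM st0 mul0r add0r evC.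
have qh0 : ev qh != 0.
  have E : map_poly psi ((s ^+ n)%:P * h) = map_poly psi ((s%:P * 'X - t%:P) * qh + ch%:P) by rewrite hq.
  move: E; rewrite rmorphD !rmorphM rmorphB rmorphM /= !map_polyC map_polyX /= ch0 addr0 hE -st.
  rewrite polyCM -mulrBr (mulrC (psi s)%:P) -mulrA mulrCA => /(mulfI _).
  rewrite polyXsubC_eq0 => /(_ isT) /(congr1 (fun p => p.[theta])); rewrite !hornerM !hornerC => E.
  have : psi (s ^+ n) * H1.[theta] != 0 by rewrite mulf_neq0 // rmorphXn expf_neq0.
  by rewrite E mulf_eq0 negb_or => /andP[].
(* The multiples of [s X - t] cancel between the two divisions, so that [s m' = s^(m+1) qh g] modulo
   [h]. With [s m' = f0 + g e'] modulo [h] this gives [g V = f0]. As [e'] vanishes under [psi], the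
   value of [V] is that of [s^(m+1) qh], and [qh] lifts [H1] up to a nonzero constant. *)
pose m' := cg%:P * qh - ch%:P * qg.
have m'0 : null psi m'.
  by rewrite /null /m' rmorphB !rmorphM /= !map_polyC /= ch0 cg0 !mul0r subr0.
have [f0 [e' [[q' q'E] nul]]] := cyc m'; have [_ e'0] := nul m'0.
exists f0, ((s ^+ m.+1)%:P * qh - e'); split; last first.
  have -> : ev ((s ^+ m.+1)%:P * qh - e') = psi s ^+ m.+1 * ev qh.
    by rewrite ev_rmorphB ev_rmorphM evC rmorphXn /ev e'0 horner0 subr0.
  by rewrite mulf_neq0 // expf_neq0.
exists (q' + s%:P * (s ^+ n)%:P * qg).
rewrite mulrDl -q'E exprS polyCM /m'.
have -> : s%:P * (s ^+ n)%:P * qg * h = s%:P * (qg * ((s ^+ n)%:P * h)) by ring.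
have -> : g * (s%:P * (s ^+ m)%:P * qh - e') = s%:P * (qh * ((s ^+ m)%:P * g)) - g * e' by ring.
rewrite hq gq; ring.
Qed.
End EliminationNorm.

(** * Restriction of polynomials to lines *)

Section Lines.
Variables (R : comNzRingType).

Lemma mpoly_ring_ind n (Pr : {mpoly R[n]} -> Prop) :
  (forall c, Pr c%:MP) -> (forall i, Pr 'X_i) ->
  (forall p q, Pr p -> Pr q -> Pr (p + q)) -> (forall p q, Pr p -> Pr q -> Pr (p * q)) ->
  forall p, Pr p.
Proof.
move=> hC hX hD hM p; rewrite (mpolyE p).
apply: (big_ind Pr) => //; first by rewrite -mpolyC0.
move=> m _; rewrite -mul_mpolyC; apply: (hM) => //.
rewrite mpolyXE_id; apply: (big_ind Pr) => //; first by rewrite -mpolyC1.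
by move=> i _; elim: (m i) => [|j IH]; rewrite ?expr0 -?mpolyC1 // exprS; apply: hM.
Qed.

Variables (n : nat) (C : comNzRingType) (f : {rmorphism R -> C}).
Implicit Types (P D : 'I_n -> C) (p : {mpoly R[n]}).

Definition line P D : {mpoly R[n]} -> {poly C} :=
  mmap (polyC \o f) (fun i => (P i)%:P + (D i)%:P * 'X).
HB.instance Definition _ P D := GRing.RMorphism.on (line P D).

Lemma lineC P D c : line P D c%:MP = (f c)%:P.
Proof. by rewrite /line mmapC. Qed.
Lemma lineX P D i : line P D 'X_i = (P i)%:P + (D i)%:P * 'X.
Proof. by rewrite /line mmapXi. Qed.

Lemma line_at P D p z : (line P D p).[z] = mmap f (fun i => P i + D i * z) p.
Proof.
move: p; apply: (mpoly_rmorph_ext (f := horner_eval z \o line P D)) => [c|i] /=; rewrite /horner_eval.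
  by rewrite lineC mmapC hornerC.
by rewrite lineX mmapXi !hornerE.
Qed.

Lemma line0 P D p : (line P D p)`_0 = mmap f P p.
Proof. by rewrite -horner_coef0 line_at; apply: eq_mmap => i; rewrite mulr0 addr0. Qed.

Lemma line1 P D p : (line P D p)`_1 = \sum_i D i * mmap f P p^`M(i).
Proof.
have L1 (a b : {poly C}) : (a * b)`_1 = a`_1 * b`_0 + a`_0 * b`_1.
  by rewrite coefM big_ord_recl big_ord1 /= addrC.
move: p; apply: mpoly_ring_ind => [c|i|p q IHp IHq|p q IHp IHq].
- by rewrite lineC coefC big1 // => i _; rewrite mderivC rmorph0 mulr0.
- rewrite lineX coefD coefC coefCM coefX mulr1 add0r (bigD1 i) //= big1 => [|j ji].
    rewrite mderivX mnm1E eqxx scale1r addr0 (_ : (U_(i) - U_(i))%MM = 0%MM).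
      by rewrite mpolyX0 rmorph1 mulr1.
    by apply/mnmP => l; rewrite mnmBE subnn mnm0E.
  by rewrite mderivX mnm1E eq_sym (negPf ji) scale0r rmorph0 mulr0.
- rewrite rmorphD coefD IHp IHq -big_split; apply: eq_bigr => i _ /=.
  by rewrite mderivD rmorphD mulrDr.
- rewrite rmorphM L1 IHp IHq !line0 mulr_suml mulr_sumr -big_split; apply: eq_bigr => i _ /=.
  by rewrite mderivM rmorphD !rmorphM /=; ring.
Qed.

Lemma line_topX P D (m : 'X_{1..n}) :
  (size (line P D 'X_[m]) <= (mdeg m).+1)%N /\ (line P D 'X_[m])`_(mdeg m) = mmap f D 'X_[m].
Proof.
have key (a b : {poly C}) i j : (size a <= i.+1)%N -> (size b <= j.+1)%N ->
    (size (a * b)%R <= (i + j).+1)%N /\ (a * b)`_(i + j) = a`_i * b`_j.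
  move=> sa sb; split.
    apply: (leq_trans (size_polyMleq _ _)); move: sa sb; move: (size a) (size b) => x y.
    by clear; lia.
  rewrite coefM; have il : (i < (i + j).+1)%N by rewrite ltnS leq_addr.
  rewrite (bigD1 (Ordinal il)) //= addKn big1 ?addr0 // => l li.
  have [ltli|ltil|eqli] := ltngtP l i; last by case/eqP: li; apply: val_inj.
    rewrite [b`_ _](leq_sizeP _ _ sb) ?mulr0 //.
    by move: ltli; move: (nat_of_ord l) => x; clear; lia.
  by rewrite [a`_ _](leq_sizeP _ _ sa) ?mul0r.
have keyX (a : {poly C}) j : (size a <= 2)%N ->
    (size (a ^+ j)%R <= j.+1)%N /\ (a ^+ j)`_j = a`_1 ^+ j.
  move=> sa; elim: j => [|j [IH1 IH2]]; first by rewrite !expr0 size_poly1 coefC.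
  by have [h1 h2] := key a (a ^+ j) 1%N j sa IH1; rewrite exprS h2 IH2 exprS; split.
rewrite mpolyXE_id !rmorph_prod mdegE.
apply: (big_ind3 (fun (a : {poly C}) (d : nat) (c : C) => (size a <= d.+1)%N /\ a`_d = c)).
- by rewrite size_poly1 coefC.
- by move=> a i x b j y [sa <-] [sb <-]; apply: key.
move=> i _; rewrite !rmorphXn /= lineX mmapXi.
have s2 : (size ((P i)%:P + (D i)%:P * 'X)%R <= 2)%N.
  apply: (leq_trans (size_polyD _ _)); rewrite geq_max (leq_trans (size_polyC_leq1 _)) //=.
  apply: (leq_trans (size_polyMleq _ _)); rewrite size_polyX addn2 /=.
  by rewrite ltnS size_polyC_leq1.
have [s1 cE] := keyX _ (m i) s2; split=> //.
by rewrite cE coefD coefC coefCM coefX mulr1 add0r.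
Qed.

Lemma line_top P D p d : (msize p <= d.+1)%N ->
  (size (line P D p) <= d.+1)%N /\ (line P D p)`_d = mmap f D (pihomog mdeg d p).
Proof.
move=> sp; rewrite pihomogE {1 2}(mpolyE p) !rmorph_sum coef_sum /=.
have hm m : m \in msupp p -> (mdeg m <= d)%N.
  by move=> /msize_mdeg_lt lt; rewrite -ltnS (leq_trans lt).
split.
  apply: (leq_trans (size_sum _ _ _)); apply/bigmax_leqP_seq => m mp _.
  rewrite -mul_mpolyC rmorphM /= lineC mul_polyC (leq_trans (size_scale_leq _ _)) //.
  by have [sm _] := line_topX P D m; rewrite (leq_trans sm) // ltnS hm.
rewrite [RHS]big_mkcond /= big_seq [RHS]big_seq; apply: eq_bigr => m mp.
rewrite -mul_mpolyC rmorphM /= lineC coefCM.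
have [sm cm] := line_topX P D m.
case: eqP => [md|md]; first by rewrite -[in LHS]md cm rmorphM /= mmapC.
rewrite [_`_d](leq_sizeP _ _ sm) ?mulr0 //.
by rewrite ltn_neqAle hm // andbT; apply/eqP.
Qed.

Lemma line_scale P D c p : line P (fun i => c * D i) p = (line P D p) \Po (c%:P * 'X).
Proof.
move: p; apply: (mpoly_rmorph_ext (g := comp_poly (c%:P * 'X) \o line P D)) => [a|i] /=.
  by rewrite !lineC comp_polyC.
by rewrite !lineX comp_polyD comp_polyM !comp_polyC comp_polyX polyCM; ring.
Qed.
End Lines.

Definition idr (R : comNzRingType) : {rmorphism R -> R} := idfun.

Lemma mmap_homog (R C : comNzRingType) (f : {rmorphism R -> C}) n (v : 'I_n -> C) (a : C) d
  (q : {mpoly R[n]}) : q \is d.-homog ->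
  mmap f (fun i => a * v i) q = a ^+ d * mmap f v q.
Proof.
move=> /dhomogP hq; rewrite (mpolyE q) !rmorph_sum mulr_sumr big_seq [RHS]big_seq.
apply: eq_bigr => m /hq md; rewrite -mul_mpolyC !rmorphM /= !mmapC !mmapX mulrCA; congr (_ * _).
rewrite /mmap1; under eq_bigr do rewrite exprMn.
by rewrite big_split /= prodrXr -mdegE md.
Qed.

Definition top_form (R : comNzRingType) n (p : {mpoly R[n]}) := pihomog mdeg (msize p).-1 p.

Lemma top_form_neq0 (R : comNzRingType) n (p : {mpoly R[n]}) : p != 0 -> top_form p != 0.
Proof.
move=> p0; apply/eqP => /(congr1 (fun q : {mpoly R[n]} => q@_(mlead p))) /eqP.
rewrite mcoeff0 /top_form pihomogE raddf_sum /= big_mkcond /=.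
rewrite (bigD1_seq (mlead p)) ?mlead_supp ?msupp_uniq //= -(mlead_deg p0) eqxx.
rewrite big1 => [|m nm]; last by case: ifP => // _; rewrite mcoeffZ mcoeffX (negPf nm) mulr0.
rewrite addr0 mcoeffZ mcoeffX eqxx mulr1 => h.
by have := mlead_supp p0; rewrite mcoeff_msupp h.
Qed.

Section CharZero.
Variables (F k : fieldType) (iota : {rmorphism F -> k}).
Hypothesis char0 : forall j, (j.+1%:R : k) != 0.

Lemma natr_inj : injective (fun j : nat => j%:R : k).
Proof.
move=> i j; wlog le : i j / (i <= j)%N.
  by move=> H e; case/orP: (leq_total i j) => h; [apply: H | apply/esym/H].
move=> /eqP; rewrite eq_sym -subr_eq0 -natrB //; case E: (j - i)%N => [|d].
  by move=> _; apply/eqP; rewrite eqn_leq le -subn_eq0 E.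
by rewrite (negPf (char0 d)).
Qed.

Lemma poly_nat_nonroot (p : {poly k}) : p != 0 -> exists j, p.[j.+1%:R] != 0.
Proof.
move=> p0; apply: contrapT => /forallNP H.
pose rs := [seq (j.+1%:R : k) | j <- seq.iota 0 (size p)].
have := @max_poly_roots _ p rs p0; rewrite size_map size_iota ltnn => H2.
suff: false by [].
apply: H2; first by apply/allP => _ /mapP[j _ ->]; rewrite /root; apply: contrapT => /negP/H.
by rewrite map_inj_uniq ?iota_uniq // => i j /natr_inj[].
Qed.

(** Positive integers as coordinates make the same point available over both fields, and they can
    serve as denominators. *)
Lemma mpoly_nonvanish n (p : {mpoly F[n]}) : p != 0 ->
  exists D : 'I_n -> nat, mmap iota (fun i => (D i).+1%:R) p != 0.
Proof.
elim: n p => [|n IH] p p0.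
  have D0 : 'I_0 -> nat by case.
  exists D0; have pE : p = (p@_0)%:MP.
    apply/mpolyP => m; rewrite mcoeffC (_ : m = 0%MM) ?eqxx ?mulr1 //.
    by apply/mnmP; case.
  rewrite pE mmapC fmorph_eq0; apply: contraNneq p0 => h; by rewrite pE h mpolyC0.
have q0 : shear (fun=> 0) p != 0 by rewrite -(rmorph0 (shear (fun=> 0))) (can_eq (shearK _)).
have [|D hD] := IH (lead_coef (shear (fun=> 0) p)); first by rewrite lead_coef_eq0.
have [|j hj] := @poly_nat_nonroot (map_poly (mmap iota (fun i => (D i).+1%:R)) (shear (fun=> 0) p)).
  by apply: contraNneq hD => h; rewrite lead_coefE -coef_map h coef0.
exists (snoc D j); apply: contraNneq hj => h.
have := pev_shear (fun=> 0) iota (fun i => (D i).+1%:R) j.+1%:R p.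
rewrite /pev /= /horner_eval => ->; apply/eqP; rewrite -[RHS]h; apply: eq_mmap.
by apply: ord_snocP => [l|]; rewrite ?snoc_lift ?snoc_max // rmorph0 mul0r addr0.
Qed.
End CharZero.

Section ShearLead.
Variables (R : fieldType) (n : nat) (o : 'I_n -> R).

(** The normalisation trick of Noether: the coefficient of top degree in the main variable is the
    value of the top form at the direction [(o, 1)], a constant. *)
Lemma shear_lead (h : {mpoly R[n.+1]}) : h != 0 ->
  mmap (idr R) (snoc o 1) (top_form h) != 0 ->
  lead_coef (shear o h) = (mmap (idr R) (snoc o 1) (top_form h))%:MP.
Proof.
move=> h0; set c := mmap _ _ _ => c0.
pose P := snoc (fun j => 'X_j : {mpoly R[n]}) 0.
pose D := snoc (fun j => (o j)%:MP : {mpoly R[n]}) 1.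
have shE : shear o h = line (@mpolyC n R) P D h.
  rewrite /line; apply: eq_mmap; apply: ord_snocP => [j|].
    by rewrite /P /D !snoc_lift.
  by rewrite /P /D !snoc_max mul1r add0r.
have sz : (msize h <= (msize h).-1.+1)%N by rewrite leqSpred.
have [s1 c1] := line_top (@mpolyC n R) P D sz.
have cE : (shear o h)`_(msize h).-1 = c%:MP.
  rewrite shE c1 /c rmorph_mmap; apply: eq_mmap; apply: ord_snocP => [j|].
    by rewrite /D /= !snoc_lift.
  by rewrite /D /= !snoc_max mpolyC1.
rewrite lead_coefE -cE; congr (_`_(_.-1)); apply/eqP; rewrite eqn_leq; apply/andP; split.
  by rewrite shE (leq_trans s1) // -mpolySpred.
rewrite mpolySpred // ltnNge; apply/negP => /leq_sizeP/(_ _ (leqnn _)).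
by rewrite cE => /eqP; rewrite mpolyC_eq0 (negPf c0).
Qed.
End ShearLead.

Section GenericLine.
Variables (R k : fieldType) (iota : {rmorphism R -> k}).
Hypothesis char0 : forall j, (j.+1%:R : k) != 0.
Variables (n : nat) (P : 'I_n.+1 -> k).
Local Notation dir o := (snoc (fun j => iota (o j)) 1).

Lemma mmap_top_dir (o : 'I_n -> R) q :
  iota (mmap (idr R) (snoc o 1) q) = mmap iota (dir o) q.
Proof.
rewrite rmorph_mmap; apply: eq_mmap; apply: ord_snocP => [j|] /=.
  by rewrite !snoc_lift.
by rewrite !snoc_max rmorph1.
Qed.

(** Two forms must not vanish: the top form of [h] and the differential of [h] at [P]. An integral
    vector at which neither vanishes, divided by its last coordinate, is a direction over [R],
    although [P] is only defined over [k]. *)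
Lemma good_direction (h : {mpoly R[n.+1]}) v : h != 0 -> (line iota P v h)`_1 != 0 ->
  exists o : 'I_n -> R, mmap iota (dir o) (top_form h) != 0 /\ (line iota P (dir o) h)`_1 != 0.
Proof.
move=> h0; rewrite line1 => hv.
pose a i := mmap iota P h^`M(i).
have [i ai] : exists i, a i != 0.
  apply: contrapT => /forallNP H; case/negP: hv; apply/eqP; rewrite big1 // => i _.
  by have /negP := H i; rewrite negbK => /eqP; rewrite /a => ->; rewrite mulr0.
pose tq : {mpoly k[n.+1]} := map_mpoly iota (top_form h).
pose lin : {mpoly k[n.+1]} := \sum_i (a i)%:MP * 'X_i.
have tq0 : tq != 0.
  have := top_form_neq0 h0; apply: contraNneq => e; apply/eqP/mpolyP => m; rewrite mcoeff0.
  apply: (fmorph_inj iota); rewrite rmorph0 -mcoeff_map_mpoly -/tq e mcoeff0 //.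
have lin0 : lin != 0.
  apply: contraNneq ai => /(congr1 (fun q : {mpoly k[n.+1]} => q@_U_(i))).
  rewrite /lin raddf_sum mcoeff0 /= (bigD1 i) //= mul_mpolyC mcoeffZ mcoeffX eqxx mulr1.
  rewrite big1 ?addr0 => [->//|j ji].
  by rewrite mul_mpolyC mcoeffZ mcoeffX eq_mnm1 (negPf ji) mulr0.
have [|d hd] := @mpoly_nonvanish _ _ (idr k) char0 _ (tq * lin * 'X_ord_max).
  by rewrite !mulf_neq0 // -msupp_eq0 msuppX.
pose D1 i : k := (d i).+1%:R; pose t := D1 ord_max.
have t0 : t != 0 by exact: char0.
move: hd; rewrite !rmorphM /= !mulf_eq0 !negb_or => /andP[/andP[ht hl] _].
have {}ht : mmap iota D1 (top_form h) != 0.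
  suff tqE : mmap (idr k) D1 tq = mmap iota D1 (top_form h) by rewrite -tqE.
  rewrite /tq; move: (top_form h).
  apply: (mpoly_rmorph_ext (f := mmap (idr k) D1 \o map_mpoly iota) (g := mmap iota D1)) => [c|j] /=.
    by rewrite map_mpolyC !mmapC.
  by rewrite map_mpolyX !mmapXi.
have {}hl : \sum_i D1 i * a i != 0.
  move: hl; rewrite /lin rmorph_sum /=; congr (~~ (_ == _)); apply: eq_bigr => j _.
  by rewrite rmorphM /= mmapC mmapXi mulrC.
pose o (j : 'I_n) : R := (d (lift ord_max j)).+1%:R / (d ord_max).+1%:R.
exists o.
have dirE : dir o =1 (fun i => t^-1 * D1 i).
  apply: ord_snocP => [j|]; last by rewrite snoc_max mulVf.
  by rewrite snoc_lift /o fmorph_div !rmorph_nat mulrC.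
split.
  rewrite (eq_mmap _ dirE) (mmap_homog _ _ _ (pihomogP _ _ _)) mulf_neq0 //.
  by rewrite expf_neq0 // invr_eq0.
rewrite line1; under eq_bigr do rewrite dirE -mulrA.
by rewrite -mulr_sumr mulf_neq0 // invr_eq0.
Qed.
End GenericLine.

Lemma dvd_unitM (D : idomainType) (c p x : D) : c \is a GRing.unit ->
  divides (c * p) x <-> divides p x.
Proof.
move=> cu; split=> [[d ->]|[d ->]]; first by exists (d * c); rewrite mulrA.
by exists (d / c); rewrite mulrA divrK.
Qed.

Lemma prime_unitM (D : idomainType) (c p : D) : c \is a GRing.unit ->
  prime_elt p -> prime_elt (c * p).
Proof.
move=> cu [p0 pu pp]; split.
- by rewrite mulf_neq0 //; apply: contraTneq cu => ->; rewrite unitr0.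
- by rewrite unitrM negb_and pu orbT.
- by move=> x y /(dvd_unitM _ _ cu)/pp[] h; [left|right]; apply/dvd_unitM.
Qed.

Section GenericLineTheorem.
Variables (R k : fieldType) (iota : {rmorphism R -> k}).
Hypothesis char0 : forall j, (j.+1%:R : k) != 0.
Variables (n : nat) (P : 'I_n.+1 -> k).
Local Notation dir o := (snoc (fun j => iota (o j)) 1).

Lemma shear_prime (o : 'I_n -> R) (h : {mpoly R[n.+1]}) : prime_elt h -> prime_elt (shear o h).
Proof.
move=> hp.
apply: (@prime_iso {poly {mpoly R[n]}} {mpoly R[n.+1]} (unshear o) (shear o) (@unshearK R n o)).
by rewrite /= shearK.
Qed.

Lemma line_unshear_const (o : 'I_n -> R) (D : 'I_n.+1 -> k) (r : {mpoly R[n]}) :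
  line iota P D (unshear o r%:P) =
  line iota (fun j : 'I_n => P (lift ord_max j) - iota (o j) * P ord_max)
            (fun j : 'I_n => D (lift ord_max j) - iota (o j) * D ord_max) r.
Proof.
rewrite /line mmap_unshear pevC; apply: eq_mmap => j /=.
by rewrite !rmorphB !rmorphM /=; ring.
Qed.

Lemma shear_monic (o : 'I_n -> R) (h : {mpoly R[n.+1]}) : h != 0 ->
  mmap iota (dir o) (top_form h) != 0 ->
  exists2 u, u != 0 & u%:MP *: shear o h \is monic.
Proof.
move=> h0; rewrite -mmap_top_dir fmorph_eq0 => c0.
exists (mmap (idr R) (snoc o 1) (top_form h))^-1; first by rewrite invr_eq0.
by rewrite monicE lead_coefZ shear_lead // -mpolyCM mulVf // mpolyC1.
Qed.

(** Some nonzero combination [r] of [h] and [g] is constant in the direction [D1], so on the line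
    through [P] with direction [D0 + z D1] it restricts to a polynomial [rho] that does not depend
    on [z]. Common zeros of [h] and [g] on the line are zeros of [rho]. The leading coefficient in
    [z] of [h] on the line is a constant times a power of the parameter, hence coprime to [rho1],
    the part of [rho] away from [P]; so for almost all [z] no common zero other than [P] remains. *)
Theorem generic_line (h g : {mpoly R[n.+1]}) v : prime_elt h -> ~ divides h g ->
  mmap iota P h = 0 -> (line iota P v h)`_1 != 0 ->
  exists o : 'I_n -> R, mmap iota (dir o) (top_form h) != 0 /\
    exists H1, [/\ line iota P (dir o) h = 'X * H1, H1.[0] != 0 & coprimep H1 (line iota P (dir o) g)].
Proof.
move=> hp nhg hP hv; have [h0 hu _] := hp.
have [o1 [top1 dh1]] := good_direction char0 h0 hv.
pose D1 : 'I_n.+1 -> k := dir o1; rewrite -/D1 in top1 dh1.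
have [u u0 um] := shear_monic h0 top1.
have [r r0 [U [V E]]] : exists2 r : {mpoly R[n]}, r != 0 & exists U V, r%:P = U * shear o1 h + V * shear o1 g.
  have uu : (u%:MP%:P : {poly {mpoly R[n]}}) \is a GRing.unit.
    by apply: (rmorph_unit polyC); apply: (rmorph_unit (@mpolyC n R)); rewrite unitfE.
  have hp' : prime_elt (u%:MP *: shear o1 h).
    by rewrite -mul_polyC; apply: prime_unitM => //; apply: shear_prime.
  have [|r r0 [U [V E]]] := bezout_prime (g := shear o1 g) hp' um.
    move=> [c cE]; apply: nhg; exists (unshear o1 (u%:MP *: c)).
    by apply: (can_inj (shearK o1)); rewrite rmorphM /= unshearK cE -scalerAr scalerAl.
  by exists r => //; exists (u%:MP *: U), V; rewrite E -scalerAr scalerAl.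
have [d hd] := mpoly_nonvanish iota char0 (top_form_neq0 r0).
pose D0 : 'I_n.+1 -> k := snoc (fun j => (d j).+1%:R) 0.
pose P1 (j : 'I_n) := P (lift ord_max j) - iota (o1 j) * P ord_max.
pose rho := line iota P1 (fun j => (d j).+1%:R) r.
have rho0 : rho != 0.
  have sz : (msize r <= (msize r).-1.+1)%N by rewrite leqSpred.
  have [_ c1] := line_top iota P1 (fun j => (d j).+1%:R) sz.
  by apply: contraNneq hd => e; move: c1; rewrite -/rho e coef0 => <-.
have rhoE z : rho = line iota P (fun i => D0 i + z * D1 i) (unshear o1 r%:P).
  rewrite line_unshear_const /rho /line; apply: eq_mmap => j /=.
  by rewrite /D0 /D1 !snoc_lift !snoc_max; congr (_ + polyC _ * _); ring.
have {E} rhoUV z : exists a b, rho =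
    a * line iota P (fun i => D0 i + z * D1 i) h + b * line iota P (fun i => D0 i + z * D1 i) g.
  exists (line iota P (fun i => D0 i + z * D1 i) (unshear o1 U)),
    (line iota P (fun i => D0 i + z * D1 i) (unshear o1 V)).
  have e1 : unshear o1 r%:P = unshear o1 U * h + unshear o1 V * g.
    rewrite -{1}(shearK o1 h) -{1}(shearK o1 g).
    by rewrite -!(rmorphM (unshear o1)) -(rmorphD (unshear o1)) -E.
  by rewrite (rhoE z) e1 (rmorphD (line iota P _)) !(rmorphM (line iota P _)).
have [a [rho1 /implyP/(_ rho0) rho1r rhoX]] := multiplicity_XsubC rho 0.
have rho10 : rho1 != 0 by apply: contraNneq rho0 => e; rewrite rhoX e mul0r.
(* The outer variable of [H] is the slope [z], the inner one the parameter of the line. *)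
pose H := line (polyC \o iota) (fun i => (P i)%:P + (D0 i)%:P * 'X) (fun i => (D1 i)%:P * 'X) h.
have Hz z : H.[z%:P] = line iota P (fun i => D0 i + z * D1 i) h.
  rewrite /H line_at /line; apply: eq_mmap => i /=.
  by rewrite polyCD polyCM; ring.
have szh : (msize h <= (msize h).-1.+1)%N by rewrite leqSpred.
have [sH cH] := line_top (polyC \o iota) (fun i => (P i)%:P + (D0 i)%:P * 'X) (fun i => (D1 i)%:P * 'X) szh.
have {}cH : H`_(msize h).-1 = (mmap iota D1 (top_form h))%:P * 'X^((msize h).-1).
  rewrite cH mulrC [in RHS]rmorph_mmap -(mmap_homog _ _ _ (pihomogP _ _ _)).
  by apply: eq_mmap => i /=; rewrite mulrC.
have lH : lead_coef H = (mmap iota D1 (top_form h))%:P * 'X^((msize h).-1).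
  rewrite lead_coefE -cH; congr (_`_(_.-1)); apply/eqP; rewrite eqn_leq (leq_trans sH) -?mpolySpred //=.
  rewrite mpolySpred // ltnNge; apply/negP => /leq_sizeP/(_ _ (leqnn _)).
  by move=> /eqP; rewrite cH mulf_eq0 polyC_eq0 (negPf top1) -size_poly_eq0 size_polyXn.
have copX p : ~~ root p 0 -> coprimep p ('X : {poly k}).
  by move=> rp; rewrite (_ : 'X = 'X - 0%:P) ?coprimep_XsubC // subr0.
have [|b1 b10 hb1] := generic_coprime (H := H) rho10.
  rewrite lH coprimepMr; apply/andP; split; last by apply: coprimep_expr; apply: copX.
  rewrite -[_%:P]mulr1 mul_polyC coprimepZr ?coprimep1 //.
pose b2 := line iota D0 D1 (top_form h).
have b2z z : b2.[z] = mmap iota (fun i => D0 i + z * D1 i) (top_form h).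
  by rewrite /b2 line_at; apply: eq_mmap => i; rewrite mulrC.
have b20 : b2 != 0.
  have szt : (msize (top_form h) <= (msize h).-1.+1)%N.
    rewrite msizeE; apply/bigmax_leqP_seq => m mt _.
    by rewrite ltnS (dhomog_mf (pihomogP _ _ _) mt).
  have [_ c2] := line_top iota D0 D1 szt.
  apply: contraNneq top1 => e; move: c2; rewrite -/b2 e coef0 /top_form pihomog_id => <-.
  by [].
pose b3 : {poly k} := ((line iota P D0 h)`_1)%:P + ((line iota P D1 h)`_1)%:P * 'X.
have b3z z : b3.[z] = (line iota P (fun i => D0 i + z * D1 i) h)`_1.
  rewrite /b3 !hornerE !line1 mulr_suml -big_split; apply: eq_bigr => i _ /=; ring.
have b30 : b3 != 0.
  apply: contraNneq dh1 => /(congr1 (fun p : {poly k} => p`_1)).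
  by rewrite /b3 coefD coefC coefCM coefX coef0 mulr1 add0r => ->.
(* Off the roots of [b1], [b2] and [b3] respectively, [rho1] is coprime to [h] on the line, the top
   form of [h] does not vanish in the new direction, and the line is transversal to [h] at [P]. *)
have [|j] := @poly_nat_nonroot k char0 (b1 * b2 * b3); first by rewrite !mulf_neq0.
set z : k := j.+1%:R; have z0 : z != 0 by exact: char0.
rewrite !hornerM !mulf_eq0 !negb_or => /andP[/andP[/hb1 c1]]; rewrite b2z b3z {b1 b10 hb1 b2z b20 b2 b3 b30 b3z} => c2 c3.
pose D i := D0 i + z * D1 i; rewrite -/D in c2 c3.
pose o j' : R := o1 j' + (d j').+1%:R / j.+1%:R.
have DE : D =1 (fun i => z * dir o i).
  apply: ord_snocP => [j'|]; rewrite /D /D0 /D1 ?snoc_lift ?snoc_max ?add0r //.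
  by rewrite /o rmorphD fmorph_div !rmorph_nat -/z mulrDr addrC (mulrCA z) mulfV // mulr1.
have dirE : dir o =1 (fun i => z^-1 * D i) by move=> i; rewrite DE mulKf.
exists o; split.
  rewrite (eq_mmap _ dirE) (mmap_homog _ _ _ (pihomogP _ _ _)) mulf_neq0 //.
  by rewrite expf_neq0 // invr_eq0.
have lineE q : line iota P (dir o) q = line iota P D q \Po (z^-1%:P * 'X).
  rewrite -line_scale /line; apply: eq_mmap => i; congr (_ + polyC _ * _).
  exact: dirE.
have [G1 G1E] : exists G1, line iota P D h = 'X * G1.
  have /factor_theorem[Q QE] : root (line iota P D h) 0.
    by rewrite rootE horner_coef0 line0 hP.
  by exists Q; rewrite QE subr0 mulrC.
have G10 : G1.[0] != 0.
  by move: c3; rewrite G1E mulrC coefMX /= horner_coef0.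
have copG : coprimep G1 (line iota P D g).
  have [x [y xy]] := rhoUV z; rewrite -/D in xy.
  have copr : coprimep G1 rho.
    rewrite rhoX coprimepMr coprimep_expr ?subr0 ?copX // andbT.
    by move: c1; rewrite Hz -/D G1E coprimepMr (coprimep_sym G1) => /andP[_].
  apply/coprimepP => e e1 e2; move/coprimepP: copr; apply=> //.
  by rewrite xy G1E dvdp_add // dvdp_mull // dvdp_mull.
exists (z^-1%:P * (G1 \Po (z^-1%:P * 'X))); split.
- by rewrite lineE G1E comp_polyM comp_polyX; ring.
- by rewrite hornerM hornerC mulf_neq0 ?invr_eq0 // horner_comp !hornerE ?mulr0.
- by rewrite lineE mul_polyC coprimepZl ?invr_eq0 //; apply: coprimep_comp_poly.
Qed.

Lemma map_shear (o : 'I_n -> R) p :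
  map_poly (mmap iota (fun j : 'I_n => P (lift ord_max j) - iota (o j) * P ord_max)) (shear o p) =
  line iota P (dir o) p \Po ('X - (P ord_max)%:P).
Proof.
set Q := fun j => _; move: p.
apply: (mpoly_rmorph_ext (f := map_poly (mmap iota Q) \o shear o)
  (g := comp_poly ('X - (P ord_max)%:P) \o line iota P (dir o))) => [c|i] /=.
  by rewrite /shear mmapC /= map_polyC /= mmapC lineC comp_polyC.
rewrite /shear mmapXi lineX comp_polyD comp_polyM !comp_polyC comp_polyX.
move: i; apply: ord_snocP => [j|].
  rewrite !snoc_lift rmorphD rmorphM /= !map_polyC map_polyX /= mmapC mmapXi /Q.
  by rewrite polyCB polyCM; ring.
by rewrite !snoc_max map_polyX mul1r addrC subrK.
Qed.

Theorem elim_setup (h g : {mpoly R[n.+1]}) v : prime_elt h -> ~ divides h g ->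
  mmap iota P h = 0 -> (line iota P v h)`_1 != 0 ->
  exists o : 'I_n -> R,
    let psi := mmap iota (fun j : 'I_n => P (lift ord_max j) - iota (o j) * P ord_max) in
    exists u H1, [/\ u != 0, u%:MP *: shear o h \is monic,
      map_poly psi (u%:MP *: shear o h) = ('X - (P ord_max)%:P) * H1,
      H1.[P ord_max] != 0 & coprimep H1 (map_poly psi (shear o g))].
Proof.
move=> hp nhg hP hv; have [o [ot [H1 [hE H10 cop]]]] := generic_line hp nhg hP hv.
have [h0 _ _] := hp; exists o => psi.
have [u u0 um] := shear_monic h0 ot.
have iu : iota u != 0 by rewrite fmorph_eq0.
exists u, ((iota u)%:P * (H1 \Po ('X - (P ord_max)%:P))); split=> //.
- have pu : psi u%:MP = iota u by rewrite /psi mmapC.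
  rewrite map_polyZ -[X in X *: _]/(psi u%:MP) pu map_shear hE comp_polyM comp_polyX -mul_polyC; ring.
- by rewrite hornerM hornerC mulf_neq0 // horner_comp !hornerE subrr.
- by rewrite map_shear mul_polyC coprimepZl //; apply: coprimep_comp_poly.
Qed.
End GenericLineTheorem.

Local Opaque mmap shear unshear.

(** * Smooth points and reduction to a hypersurface *)

Lemma rmorph_relation (A C : comNzRingType) (ev : {rmorphism A -> C})
    (s x t g h e q u : A) (s' x' t' : C) :
  ev s = s' -> ev x = x' -> ev t = t' -> ev g = 0 -> ev h = 0 ->
  s * x - t - g * e = q * (u * h) -> s' * x' = t'.
Proof.
move=> es ex et eg eh /(congr1 ev); rewrite !rmorphB !rmorphM eg eh es ex et.
by rewrite mul0r !mulr0 subr0 => /eqP; rewrite subr_eq0 => /eqP.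
Qed.

Section PointData.
Variables (R K k : fieldType) (iK : {rmorphism R -> K}) (ik : {rmorphism R -> k}).
Hypothesis char0 : forall j, (j.+1%:R : k) != 0.

(* A subvariety of affine space is given by a generic point [y] and a point of it by a
   specialisation [P] of [y]; the local ring consists of the [p(y) / r(y)] with [r(P) <> 0]. *)
Section GenericPoint.
Variables (n : nat) (y : 'I_n -> K) (P : 'I_n -> k).
Implicit Types (p f g : {mpoly R[n]}).

Definition specializes := forall p, mmap iK y p = 0 -> mmap ik P p = 0.

Definition generates := forall x : K, exists p r, mmap iK y r != 0 /\ x = mmap iK y p / mmap iK y r.

Definition spec_unit (u : K) := exists p r,
  [/\ mmap ik P p != 0, mmap ik P r != 0 & u = mmap iK y p / mmap iK y r].

Definition locally_generated := exists (c : nat) (g : 'I_c -> {mpoly R[n]}),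
  (forall a, mmap iK y (g a) = 0) /\
  forall f, mmap iK y f = 0 -> exists2 s, mmap ik P s != 0 &
    exists h : 'I_c -> {mpoly R[n]}, s * f = \sum_a h a * g a.

(* The conormal space [I / m I] at [P] embeds in the cotangent space of the ambient space. *)
Definition conormal_injective := forall f, mmap iK y f = 0 -> (forall v, (line ik P v f)`_1 = 0) ->
  exists2 s, mmap ik P s != 0 & exists c (a b : 'I_c -> {mpoly R[n]}),
    (forall i, mmap ik P (a i) = 0 /\ mmap iK y (b i) = 0) /\ s * f = \sum_i a i * b i.
End GenericPoint.

Lemma line1M n (P v : 'I_n -> k) (p q : {mpoly R[n]}) :
  (line ik P v (p * q))`_1 = (line ik P v p)`_1 * mmap ik P q + mmap ik P p * (line ik P v q)`_1.
Proof. by rewrite rmorphM coefM big_ord_recl big_ord1 /= !line0 addrC. Qed.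

(** Let [I] be the ideal of [y] and [m] that of [P]. If all of [I] had zero differential at [P],
    then [I = m I] locally by conormal injectivity, and Nakayama's lemma would give [I = 0], against
    [f]. So some equation [q] has nonzero differential; by the product rule a prime factor of [q]
    vanishing at [y] inherits this. *)
Lemma smooth_prime_equation n (y : 'I_n -> K) (P : 'I_n -> k) (f : {mpoly R[n]}) :
  specializes y P -> locally_generated y P -> conormal_injective y P ->
  f != 0 -> mmap iK y f = 0 ->
  exists2 h, prime_elt h & mmap iK y h = 0 /\ exists v, (line ik P v h)`_1 != 0.
Proof.
move=> sp [c [g [gy gen]]] conj f0 fy.
have [q [qy [v qv]]] : exists q, mmap iK y q = 0 /\ exists v, (line ik P v q)`_1 != 0.
  apply: contrapT => /forallNP H; case/negP: f0.
  have dz q : mmap iK y q = 0 -> forall v, (line ik P v q)`_1 = 0.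
    move=> qy v; apply: contrapT => /eqP qv; apply: (H q); split=> //; by exists v.
  have lin m (a b : 'I_m -> {mpoly R[n]}) : (forall i, mmap ik P (a i) = 0 /\ mmap iK y (b i) = 0) ->
      exists2 s, mmap ik P s != 0 & exists2 A : 'I_c -> {mpoly R[n]}, (forall i, mmap ik P (A i) = 0) &
        s * \sum_i a i * b i = \sum_j A j * g j.
    elim: m a b => [|m IH] a b ab.
      exists 1; first by rewrite rmorph1 oner_neq0.
      exists (fun=> 0); first by move=> i; rewrite rmorph0.
      by rewrite big_ord0 mulr0 big1 // => i _; rewrite mul0r.
    have [s1 s10 [A1 A1P E1]] := IH _ _ (fun i => ab (lift ord0 i)).
    have [s2 s20 [A2 E2]] := gen _ (ab ord0).2.
    exists (s1 * s2); first by rewrite rmorphM mulf_neq0.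
    exists (fun j => s1 * a ord0 * A2 j + s2 * A1 j).
      by move=> i; rewrite rmorphD !rmorphM /= A1P (ab ord0).1 !mulr0 mul0r addr0.
    rewrite big_ord_recl mulrDr.
    have -> : s1 * s2 * (a ord0 * b ord0) = s1 * a ord0 * (s2 * b ord0) by ring.
    have -> : s1 * s2 * (\sum_(i < m) a (lift ord0 i) * b (lift ord0 i)) =
       s2 * (s1 * \sum_(i < m) a (lift ord0 i) * b (lift ord0 i)) by ring.
    rewrite E1 E2 !mulr_sumr -big_split; apply: eq_bigr => j _ /=; ring.
  have rel a : exists sA : {mpoly R[n]} * ('I_c -> {mpoly R[n]}),
      [/\ mmap ik P sA.1 != 0, forall i, mmap ik P (sA.2 i) = 0 & sA.1 * g a = \sum_j sA.2 j * g j].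
    have [s s0 [m [a' [b' [ab E]]]]] := conj _ (gy a) (dz _ (gy a)).
    have [s' s'0 [A AP E']] := lin _ _ _ ab.
    by exists (s' * s, A); split; rewrite //= ?rmorphM ?mulf_neq0 // -mulrA E.
  have [sA hsA] := choice rel.
  (* [M] annihilates the vector of the [g a] and becomes diagonal and invertible at [P]; its
     determinant, which annihilates each [g a], is therefore nonzero. *)
  pose M := diag_mx (\row_a (sA a).1) - \matrix_(a, b) (sA a).2 b : 'M[{mpoly R[n]}]_c.
  pose G := \col_a g a : 'cV[{mpoly R[n]}]_c.
  have MG : M *m G = 0.
    apply/matrixP => a z; rewrite mulmxBl mul_diag_mx !mxE; have [_ _ ->] := hsA a.
    by apply/eqP; rewrite subr_eq0; apply/eqP/eq_bigr => j _; rewrite !mxE.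
  have detM : mmap ik P (\det M) != 0.
    rewrite -det_map_mx (_ : map_mx _ M = diag_mx (\row_a mmap ik P (sA a).1)).
      rewrite det_diag; apply/prodf_neq0 => a _; rewrite mxE.
      by have [] := hsA a.
    apply/matrixP => a b; rewrite !mxE rmorphB rmorphMn /=.
    by have [_ -> _] := hsA a; rewrite subr0.
  have g0 a : g a = 0.
    have : \adj M *m (M *m G) = 0 by rewrite MG mulmx0.
    rewrite mulmxA mul_adj_mx mul_scalar_mx => /matrixP/(_ a 0); rewrite !mxE => /eqP.
    rewrite mulf_eq0 => /orP[/eqP d0|/eqP//].
    by move: detM; rewrite d0 rmorph0 eqxx.
  have [s s0 [h E]] := gen f fy; move: E; rewrite big1 => [/eqP|a _]; last by rewrite g0 mulr0.
  rewrite mulf_eq0 => /orP[/eqP s00|//].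
  by move: s0; rewrite s00 rmorph0 eqxx.
have q0 : q != 0 by apply: contraNneq qv => ->; rewrite rmorph0 coef0.
have [u uu [s sP qE]] := ufd_mpoly q0.
have uy : mmap iK y u != 0.
  by apply/eqP => u0; have := rmorph_unit (mmap iK y) uu; rewrite /= u0 unitr0.
have [h hs hy] : exists2 h, h \in s & mmap iK y h = 0.
  move/eqP: qy; rewrite qE rmorphM mulf_eq0 (negPf uy) /= rmorph_prod prodf_seq_eq0.
  by move=> /hasP[h hs /= /eqP hy]; exists h.
exists h; first exact: sP.
split=> //; exists v; apply: contraNneq qv => hv.
rewrite qE (big_rem _ hs) /= mulrCA line1M hv mul0r add0r.
by rewrite sp // mul0r.
Qed.

(** * Projection when the last coordinate is a regular function of the others *)

Section StepA.
Variables (n : nat) (y : 'I_n.+1 -> K) (P : 'I_n.+1 -> k) (o : 'I_n -> R).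
Let y' (j : 'I_n) := y (lift ord_max j) - iK (o j) * y ord_max.
Let P' (j : 'I_n) := P (lift ord_max j) - ik (o j) * P ord_max.

Lemma pev_shear_pt (C : comNzRingType) (f : {rmorphism R -> C}) (w : 'I_n.+1 -> C) p :
  pev f (fun j : 'I_n => w (lift ord_max j) - f (o j) * w ord_max) (w ord_max) (shear o p) = mmap f w p.
Proof.
rewrite pev_shear; apply: eq_mmap; apply: ord_snocP => [j|].
  by rewrite snoc_lift subrK.
by rewrite snoc_max.
Qed.

Lemma mmap_unshear_const (C : comNzRingType) (f : {rmorphism R -> C}) (w : 'I_n.+1 -> C) p :
  mmap f w (unshear o p%:P) = mmap f (fun j : 'I_n => w (lift ord_max j) - f (o j) * w ord_max) p.
Proof. by rewrite mmap_unshear pevC. Qed.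

Lemma specializes_shear : specializes y P -> specializes y' P'.
Proof. by move=> sp p py; rewrite /P' -mmap_unshear_const; apply: sp; rewrite mmap_unshear_const. Qed.

Lemma spec_unit_shear u : spec_unit y' P' u -> spec_unit y P u.
Proof.
move=> [p [r [pP rP ->]]]; exists (unshear o p%:P), (unshear o r%:P).
split; rewrite ?(mmap_unshear_const ik) //.
by rewrite [X in _ = X / _]mmap_unshear_const [X in _ = _ / X]mmap_unshear_const.
Qed.

Variables (s t : {mpoly R[n]}).
Hypotheses (s0 : mmap ik P' s != 0) (syt : mmap iK y' s * y ord_max = mmap iK y' t).
Hypothesis sPt : mmap ik P' s * P ord_max = mmap ik P' t.
Hypothesis sp : specializes y P.

(** [q'] is [q] with [t/s] substituted for the last coordinate and the denominator [s^N] cleared.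
    Quantifying over all evaluations allows its use at [y], at [P], and at the generic point [wF] of
    the graph of [t/s], where it yields identities of polynomials. *)
Definition star_of N (q : {mpoly R[n.+1]}) (q' : {mpoly R[n]}) :=
  forall (C : comNzRingType) (f : {rmorphism R -> C}) (w : 'I_n.+1 -> C),
  let w' (j : 'I_n) := w (lift ord_max j) - f (o j) * w ord_max in
  mmap f w' s * w ord_max = mmap f w' t -> mmap f w' q' = mmap f w' s ^+ N * mmap f w q.

Lemma star_ex q : exists N0, forall N, (N0 <= N)%N -> exists q', star_of N q q'.
Proof.
have [N0 [a [c E]]] := pseudo_divXsub s t (shear o q).
exists N0 => N le; exists (s ^+ (N - N0) * c) => C f w w' st.
pose ev : {rmorphism {poly {mpoly R[n]}} -> C} := pev f w' (w ord_max).
have evC p : ev p%:P = mmap f w' p by exact: pevC.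
have evX : ev 'X = w ord_max by exact: pevX.
have evq : ev (shear o q) = mmap f w q by exact: pev_shear_pt.
have := congr1 ev E.
rewrite (rmorphD ev) !(rmorphM ev) (rmorphB ev) (rmorphM ev) evX !evC evq st subrr mul0r add0r.
move=> e; rewrite (rmorphM (mmap f w')) /= -e.
by rewrite !(rmorphXn (mmap f w')) /= mulrA -exprD subnK.
Qed.

Lemma star_ex_fam c (q : 'I_c -> {mpoly R[n.+1]}) : exists N0, forall N, (N0 <= N)%N ->
  exists q', forall i, star_of N (q i) (q' i).
Proof.
have [N0 hN0] := choice (fun i => star_ex (q i)).
exists (\max_i N0 i)%N => N le.
have H i : exists q', star_of N (q i) q'.
  by apply: hN0; apply: leq_trans le; apply: leq_bigmax.
by have [q' hq'] := choice H; exists q'.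
Qed.

Lemma star_y N q q' : star_of N q q' -> mmap iK y' q' = mmap iK y' s ^+ N * mmap iK y q.
Proof. by move/(_ K iK y); apply. Qed.
Lemma star_P N q q' : star_of N q q' -> mmap ik P' q' = mmap ik P' s ^+ N * mmap ik P q.
Proof. by move/(_ k ik P); apply. Qed.

Let Fr : fieldType := {fraction {mpoly R[n]}}.
Let fr : {rmorphism R -> Fr} := (@tofrac {mpoly R[n]}) \o (@mpolyC n R).
Let aF : Fr := tofrac t / tofrac s.
Let wF : 'I_n.+1 -> Fr := snoc (fun j => tofrac 'X_j + fr (o j) * aF) aF.

Lemma s_neq0 : s != 0.
Proof. by apply: contraNneq s0 => ->; rewrite rmorph0. Qed.

Lemma wF' : (fun j : 'I_n => wF (lift ord_max j) - fr (o j) * wF ord_max) =1 (fun j => tofrac 'X_j).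
Proof. by move=> j; rewrite /wF snoc_lift snoc_max addrK. Qed.

Lemma mmap_fr p : mmap fr (fun j => tofrac 'X_j) p = tofrac p.
Proof.
move: p; apply: (mpoly_rmorph_ext (g := @tofrac {mpoly R[n]})) => [c|j] /=.
  by rewrite mmapC.
by rewrite mmapXi.
Qed.

Lemma star_frac N q q' : star_of N q q' -> tofrac q' = tofrac s ^+ N * mmap fr wF q.
Proof.
move=> h; have := h Fr fr wF; cbv zeta; rewrite !(eq_mmap _ wF') !mmap_fr; apply.
by rewrite /wF snoc_max /aF mulrCA mulfV ?mulr1 // tofrac_eq0 s_neq0.
Qed.

Lemma unshear_frac (p : {mpoly R[n]}) : mmap fr wF (unshear o p%:P) = tofrac p.
Proof. by rewrite mmap_unshear_const (eq_mmap _ wF') mmap_fr. Qed.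

Lemma sy0 : mmap iK y' s != 0.
Proof. by apply: contraNneq s0 => e; apply/eqP/specializes_shear. Qed.

Lemma generates_shear : generates y -> generates y'.
Proof.
move=> gen x; have [p [r [r0 ->]]] := gen x.
have [N1 h1] := star_ex p; have [N2 h2] := star_ex r.
have [p' hp] := h1 (maxn N1 N2) (leq_maxl _ _).
have [r' hr] := h2 (maxn N1 N2) (leq_maxr _ _).
exists p', r'; rewrite (star_y hp) (star_y hr) mulf_neq0 ?expf_neq0 ?sy0 //.
by split=> //; rewrite -mulf_div divff ?mul1r // expf_neq0 // sy0.
Qed.

Lemma locally_generated_shear : locally_generated y P -> locally_generated y' P'.
Proof.
move=> [c [g [gy gen]]]; have [N0 hN0] := star_ex_fam g; have [g' hg'] := hN0 N0 (leqnn _).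
exists c, g'; split; first by move=> a; rewrite (star_y (hg' a)) gy mulr0.
move=> f fy; have [|S S0 [h E]] := gen (unshear o f%:P); first by rewrite mmap_unshear_const.
have [N1 hN1] := star_ex_fam h; have [N2 hN2] := star_ex S.
have [h' hh'] := hN1 (maxn N1 N2) (leq_maxl _ _).
have [|S' hS'] := hN2 (maxn N1 N2 + N0)%N; first by rewrite (leq_trans (leq_maxr N1 _)) // leq_addr.
exists S'; first by rewrite (star_P hS') mulf_neq0 // expf_neq0.
exists h'; apply/eqP; rewrite -tofrac_eq; apply/eqP.
rewrite rmorph_sum rmorphM /= (star_frac hS') -(unshear_frac f) -mulrA.
rewrite -(rmorphM (mmap fr wF)) E rmorph_sum mulr_sumr; apply: eq_bigr => a _ /=.
by rewrite !rmorphM /= (star_frac (hg' a)) (star_frac (hh' a)) exprD; ring.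
Qed.

Lemma conormal_injective_shear : conormal_injective y P -> conormal_injective y' P'.
Proof.
move=> conj f fy fv.
have [||S S0 [c [a [b [ab E]]]]] := conj (unshear o f%:P).
- by rewrite mmap_unshear_const.
- by move=> v; rewrite line_unshear_const fv.
have [Na hNa] := star_ex_fam a; have [Nb hNb] := star_ex_fam b; have [N hN] := star_ex S.
have [a' ha'] := hNa (maxn Na N) (leq_maxl _ _); have [b' hb'] := hNb Nb (leqnn _).
have [|S' hS'] := hN (maxn Na N + Nb)%N; first by rewrite (leq_trans (leq_maxr Na _)) // leq_addr.
exists S'; first by rewrite (star_P hS') mulf_neq0 // expf_neq0.
exists c, a', b'; split.
  by move=> i; rewrite (star_P (ha' i)) (star_y (hb' i)) (ab i).1 (ab i).2 !mulr0.
apply/eqP; rewrite -tofrac_eq; apply/eqP.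
rewrite rmorph_sum rmorphM /= (star_frac hS') -(unshear_frac f) -mulrA.
rewrite -(rmorphM (mmap fr wF)) E rmorph_sum mulr_sumr; apply: eq_bigr => i _ /=.
by rewrite !rmorphM /= (star_frac (ha' i)) (star_frac (hb' i)) exprD; ring.
Qed.
End StepA.

Definition affine_model n (y : 'I_n -> K) := forall p : {mpoly R[n]}, mmap iK y p = 0 -> p = 0.

Definition hypersurface_model n (y : 'I_n -> K) (P : 'I_n -> k) :=
  exists h : {mpoly R[n]}, [/\ prime_elt h, mmap iK y h = 0, exists v, (line ik P v h)`_1 != 0
    & forall g, mmap iK y g = 0 -> divides h g].

(* If an equation [g] of [y] is not a multiple of the smooth equation [h], a generic line through [P]
   meets [h = g = 0] transversally and only at [P]: the last coordinate becomes a fraction, regular at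
   [P], of the others, and can be projected away. *)
Theorem reduce_to_hypersurface n (y : 'I_n -> K) (P : 'I_n -> k) :
  specializes y P -> generates y -> locally_generated y P -> conormal_injective y P ->
  exists m (y' : 'I_m -> K) (P' : 'I_m -> k),
    [/\ specializes y' P', generates y', forall u, spec_unit y' P' u -> spec_unit y P u
      & affine_model y' \/ 0 < m /\ hypersurface_model y' P']%N.
Proof.
elim: n y P => [|n IH] y P sp gen lg ci.
  exists 0%N, y, P; split=> //; left=> p.
  have -> : p = (p@_0)%:MP.
    apply/mpolyP => m; rewrite mcoeffC (_ : m = 0%MM) ?eqxx ?mulr1 //.
    by apply/mnmP; case.
  by rewrite mmapC => /eqP; rewrite fmorph_eq0 => /eqP->; rewrite mpolyC0.
have [[f [f0 fy]]|aff] := pselect (exists f : {mpoly R[n.+1]}, f != 0 /\ mmap iK y f = 0); last first.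
  exists n.+1, y, P; split=> //; left => p py; apply: contrapT => /eqP p0.
  by apply: aff; exists p.
have [h hp [hy [v hv]]] := smooth_prime_equation sp lg ci f0 fy.
have [[g [gy ng]]|hyp] := pselect (exists g, mmap iK y g = 0 /\ ~ divides h g); last first.
  exists n.+1, y, P; split=> //; right; split=> //; exists h; split=> //; first by exists v.
  by move=> g gy; apply: contrapT => ng; apply: hyp; exists g.
have [o [u [H1 [u0 hm hE _ cop]]]] := elim_setup char0 hp ng (sp _ hy) hv.
have [s s0 cyc] := elim_cyclic hm hE cop.
have [t [e [[q qE] _]]] := cyc 'X.
have key (C : comNzRingType) (f' : {rmorphism R -> C}) (w : 'I_n.+1 -> C) :
  let w' (j : 'I_n) := w (lift ord_max j) - f' (o j) * w ord_max in
  mmap f' w h = 0 -> mmap f' w g = 0 -> mmap f' w' s * w ord_max = mmap f' w' t.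
  move=> w' hw gw.
  pose ev : {rmorphism {poly {mpoly R[n]}} -> C} := pev f' w' (w ord_max).
  have evC p : ev p%:P = mmap f' w' p by exact: pevC.
  have evX : ev 'X = w ord_max by exact: pevX.
  have evS p : ev (shear o p) = mmap f' w p by exact: pev_shear_pt.
  apply: (rmorph_relation (ev := ev) (evC s) evX (evC t) (etrans (evS g) gw) (etrans (evS h) hw)).
  by rewrite -mul_polyC in qE; exact: qE.
have syt := key K iK y hy gy.
have sPt := key k ik P (sp _ hy) (sp _ gy).
have [m [y' [P' [sp' gen' un' alt]]]] := IH _ _ (specializes_shear (o := o) sp)
  (generates_shear s0 syt sp gen) (locally_generated_shear s0 syt sPt lg)
  (conormal_injective_shear s0 syt sPt ci).
exists m, y', P'; split=> // w wu; apply: (spec_unit_shear (o := o)); exact: un'.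
Qed.
End PointData.

(** * Parity of multiplicities *)

Definition ring_pred (K : fieldType) (S : K -> Prop) :=
  [/\ S 0, S 1, forall x y, S x -> S y -> S (x - y) & forall x y, S x -> S y -> S (x * y)].

Section RingPred.
Variables (K : fieldType) (S : K -> Prop).
Hypothesis rS : ring_pred S.
Lemma ring_pred0 : S 0. Proof. by case: rS. Qed.
Lemma ring_pred1 : S 1. Proof. by case: rS. Qed.
Lemma ring_predB x y : S x -> S y -> S (x - y). Proof. by case: rS => _ _ h _; apply: h. Qed.
Lemma ring_predM x y : S x -> S y -> S (x * y). Proof. by case: rS => _ _ _ h; apply: h. Qed.
Lemma ring_predN x : S x -> S (- x).
Proof. by move=> h; rewrite -[- x]add0r; apply: ring_predB => //; exact: ring_pred0. Qed.
Lemma ring_predD x y : S x -> S y -> S (x + y).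
Proof. by move=> hx hy; rewrite -[y]opprK; apply: ring_predB => //; exact: ring_predN. Qed.
Lemma ring_predX x j : S x -> S (x ^+ j).
Proof.
by move=> hx; elim: j => [|j IH]; [exact: ring_pred1 | rewrite exprS; apply: ring_predM].
Qed.
Lemma ring_pred_sum (s : seq K) (F : K -> K) : (forall x, x \in s -> S (F x)) ->
  S (\sum_(x <- s) F x).
Proof.
move=> h; rewrite big_seq; apply: (big_ind S) => //; first exact: ring_pred0.
exact: ring_predD.
Qed.
End RingPred.

Definition multiple (K : fieldType) (q : K) (S : K -> Prop) x := exists2 z, S z & x = q * z.

Section EvenValuation.
Variables (K : fieldType) (O L : K -> Prop) (q : K).
Hypotheses (q0 : q != 0) (rO : ring_pred O) (rL : ring_pred L) (LO : forall x, L x -> O x) (Oq : O q).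
Hypothesis residue : forall x, O x -> exists2 l, L l & multiple q O (x - l).
Hypothesis contract : forall l, L l -> multiple q O l -> multiple q L l.
Hypothesis Lprime : forall x y, L x -> L y -> multiple q L (x * y) -> multiple q L x \/ multiple q L y.
Hypothesis Lreal : forall s : seq K, (forall x, x \in s -> L x) ->
  multiple q L (\sum_(x <- s) x ^+ 4) -> forall x, x \in s -> multiple q L x.
Hypothesis fractions : forall s : seq K, exists2 d, O d & d != 0 /\ forall x, x \in s -> O (x * d).
Hypothesis finite_order : forall a, O a -> a != 0 -> exists k, ~ multiple (q ^+ k) O a.

Lemma multipleB x y : multiple q O x -> multiple q O y -> multiple q O (x - y).
Proof. by move=> [z Oz ->] [t Ot ->]; exists (z - t); [exact: ring_predB | rewrite mulrBr]. Qed.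
Lemma multiple0 : multiple q O 0.
Proof. by exists 0; [exact: ring_pred0 | rewrite mulr0]. Qed.
Lemma multipleD x y : multiple q O x -> multiple q O y -> multiple q O (x + y).
Proof.
by move=> hx hy; rewrite -[y]opprK -[- y]add0r; do 2![apply: multipleB => //]; exact: multiple0.
Qed.
Lemma multipleMl x y : O x -> multiple q O y -> multiple q O (x * y).
Proof. by move=> Ox [z Oz ->]; exists (x * z); [exact: ring_predM | rewrite mulrCA]. Qed.
Lemma multiple_LO x : multiple q L x -> multiple q O x.
Proof. by move=> [z Lz ->]; exists z => //; exact: LO. Qed.

(** By [residue] and [contract] the inclusion of [L] in [O] is an isomorphism modulo [q]. This
    transfers primality here and reality in [O_real]. *)
Lemma O_prime x y : O x -> O y -> multiple q O (x * y) -> multiple q O x \/ multiple q O y.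
Proof.
move=> Ox Oy xy; have [l Ll xl] := residue Ox; have [m Lm ym] := residue Oy.
have /contract : multiple q O (l * m).
  have -> : l * m = x * y - (x * (y - m) + m * (x - l)) by ring.
  apply: multipleB => //; apply: multipleD; apply: multipleMl => //; exact: LO.
move=> /(_ (ring_predM rL Ll Lm))/Lprime[] // /multiple_LO h; [left|right].
  by rewrite -(subrK l x); apply: multipleD.
by rewrite -(subrK m y); apply: multipleD.
Qed.

Lemma O_real (s : seq K) : (forall x, x \in s -> O x) ->
  multiple q O (\sum_(x <- s) x ^+ 4) -> forall x, x \in s -> multiple q O x.
Proof.
move=> sO; have [f hf] : exists f : K -> K, forall x, O x -> L (f x) /\ multiple q O (x - f x).
  have H x : exists l, O x -> L l /\ multiple q O (x - l).
    have [Ox|nO] := pselect (O x); last by exists 0.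
    by have [l Ll xl] := residue Ox; exists l.
  by have [f hf] := choice H; exists f.
move=> ss x xs; have [Lf xf] := hf _ (sO _ xs).
have fL y : y \in [seq f x | x <- s] -> L y.
  by move=> /mapP[z /sO/hf[Lz _] ->].
have : multiple q L (\sum_(y <- [seq f x | x <- s]) y ^+ 4).
  apply: contract; first by apply: ring_pred_sum => // y /fL; exact: ring_predX.
  have -> : \sum_(y <- [seq f x | x <- s]) y ^+ 4 = \sum_(y <- s) y ^+ 4
     - \sum_(y <- s) ((y + f y) * (y ^+ 2 + f y ^+ 2)) * (y - f y).
    by rewrite big_map -sumrB; apply: eq_bigr => y _; ring.
  apply: multipleB => //; rewrite big_seq; apply: (big_ind (multiple q O)).
  - exact: multiple0.
  - exact: multipleD.
  - move=> y ys; have [Lfy yf] := hf _ (sO _ ys); have Ofy := LO Lfy; have Oy := sO _ ys.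
    apply: multipleMl => //; apply: ring_predM => //; apply: ring_predD => //; exact: ring_predX.
move=> /(Lreal fL)/(_ (f x) (map_f f xs))/multiple_LO h.
by rewrite -(subrK (f x) x); apply: multipleD.
Qed.

(** By reality [q] divides every [x], so [q^4] cancels from the relation; an exponent 1, 2 or 3
    would make [eta] a multiple of [q]. *)
Lemma order_mod4 m eta (s : seq K) : O eta -> ~ multiple q O eta -> (forall x, x \in s -> O x) ->
  q ^+ m * eta = \sum_(x <- s) x ^+ 4 -> (4 %| m)%N.
Proof.
have [k] := ubnP m; elim: k m s => // k IH m s; rewrite ltnS => mk Oe ne sO E.
case: (posnP m) => [->//|m0].
have H : multiple q O (\sum_(x <- s) x ^+ 4).
  exists (q ^+ m.-1 * eta); first by apply: ring_predM => //; exact: ring_predX.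
  by rewrite -E -{1}(prednK m0) exprS mulrA.
have hs x : x \in s -> O (x / q).
  by move=> /(O_real sO H)[z Oz ->]; rewrite mulrC mulKf.
have E' : \sum_(x <- s) x ^+ 4 = q ^+ 4 * \sum_(x <- [seq x / q | x <- s]) x ^+ 4.
  rewrite big_map mulr_sumr; apply: eq_bigr => x _.
  by rewrite -exprMn mulrC divfK.
have hs' x : x \in [seq x / q | x <- s] -> O x by move=> /mapP[y ys ->]; exact: hs.
have [m4|m4] := leqP 4 m.
  rewrite -(subnK m4) dvdn_addl //; apply: (IH _ [seq x / q | x <- s]) => //.
    by move: mk m4; clear; lia.
  by apply: (mulfI (expf_neq0 4 q0)); rewrite -E' -E mulrA -exprD subnKC.
case: ne; exists (q ^+ (3 - m) * \sum_(x <- [seq x / q | x <- s]) x ^+ 4).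
  apply: ring_predM => //; first exact: ring_predX.
  by apply: ring_pred_sum => // x /hs'; exact: ring_predX.
apply: (mulfI (expf_neq0 m q0)); rewrite E E' !mulrA -exprSr -exprD.
by congr (q ^+ _ * _); move: m4; clear; lia.
Qed.

(** Clearing denominators in [f^2 = \sum x^4] by [d = q^r d1] gives a relation whose exponent
    [2 e + 4 r] must be divisible by 4. *)
Theorem even_valuation e omega f : O omega -> ~ multiple q O omega ->
  f = q ^+ e * omega -> sum_of_powers 4 (f ^+ 2) -> ~~ odd e.
Proof.
move=> Oo no fE [s sE].
have [d Od [d0 hd]] := fractions s.
have [r [d1 [Od1 nd1 dE]]] : exists r d1, [/\ O d1, ~ multiple q O d1 & d = q ^+ r * d1].
  have [k hk] := finite_order Od d0.
  elim: k hk => [|k IH] hk; first by case: hk; exists d; rewrite ?expr0 ?mul1r.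
  have [[z Oz dE]|nd] := pselect (multiple (q ^+ k) O d); last exact: IH.
  exists k, z; split=> // -[z' Oz' zE]; apply: hk; exists z' => //.
  by rewrite dE zE exprSr mulrA.
have npr x : O x -> ~ multiple q O x -> ~ multiple q O (x ^+ 2).
  by move=> Ox nx; rewrite expr2 => /O_prime[].
have npr2 x y : O x -> O y -> ~ multiple q O x -> ~ multiple q O y -> ~ multiple q O (x * y).
  by move=> Ox Oy nx ny /O_prime[].
have : (4 %| e.*2 + r * 4)%N.
  apply: (@order_mod4 _ (omega ^+ 2 * (d1 ^+ 2) ^+ 2) [seq x * d | x <- s]).
  - by apply: ring_predM => //; rewrite -?exprM; apply: ring_predX.
  - have Od2 := ring_predX rO 2 Od1.
    exact: (npr2 _ _ (ring_predX rO 2 Oo) (ring_predX rO 2 Od2) (npr _ Oo no) (npr _ Od2 (npr _ Od1 nd1))).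
  - by move=> _ /mapP[x xs ->]; exact: hd.
  rewrite big_map; under eq_bigr do rewrite exprMn.
  rewrite -mulr_suml -sE fE dE -muln2 !exprMn -!exprM exprD.
  by move: (q ^+ (e * 2)) (q ^+ (r * 4)) => a b; ring.
rewrite dvdn_addl ?dvdn_mull // -muln2 (_ : 4 = 2 * 2)%N // dvdn_pmul2r // dvdn2.
by [].
Qed.
End EvenValuation.

(** * Local rings of specialisations and divisibility by a prime through the point *)

Section SpecRing.
Variables (A : idomainType) (K k : fieldType) (e : {rmorphism A -> K}) (pi : {rmorphism A -> k}).
Hypothesis sp : forall p, e p = 0 -> pi p = 0.

Definition sring (x : K) := exists p r, pi r != 0 /\ x = e p / e r.
Definition sunit (x : K) := exists p r, [/\ pi p != 0, pi r != 0 & x = e p / e r].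

Lemma sp_neq0 r : pi r != 0 -> e r != 0.
Proof. by apply: contraNneq => /sp->. Qed.

Lemma sring_e p : sring (e p).
Proof. by exists p, 1; rewrite !rmorph1 oner_neq0 divr1. Qed.

Lemma sring_ring : ring_pred sring.
Proof.
split; first by rewrite -(rmorph0 e); exact: sring_e.
- by rewrite -(rmorph1 e); exact: sring_e.
- move=> _ _ [p [r [r0 ->]]] [p' [r' [r'0 ->]]]; exists (p * r' - p' * r), (r * r').
  rewrite rmorphM mulf_neq0 //; split=> //.
  by rewrite rmorphB !rmorphM; field; rewrite !sp_neq0.
- move=> _ _ [p [r [r0 ->]]] [p' [r' [r'0 ->]]]; exists (p * p'), (r * r').
  by rewrite !rmorphM mulf_neq0 //; split=> //; rewrite mulf_div.
Qed.

Lemma sunit_sring x : sunit x -> sring x.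
Proof. by move=> [p [r [_ r0 ->]]]; exists p, r. Qed.

Lemma sunitV x : sunit x -> sunit x^-1.
Proof. by move=> [p [r [p0 r0 ->]]]; exists r, p; rewrite invf_div. Qed.

Lemma sunitM x y : sunit x -> sunit y -> sunit (x * y).
Proof.
move=> [p [r [p0 r0 ->]]] [p' [r' [p'0 r'0 ->]]]; exists (p * p'), (r * r').
by rewrite !rmorphM !mulf_neq0 //; split=> //; rewrite mulf_div.
Qed.

Lemma sunit_e p : pi p != 0 -> sunit (e p).
Proof. by move=> p0; exists p, 1; rewrite !rmorph1 oner_neq0 divr1. Qed.

Lemma sring_fractions : (forall x, exists p r, e r != 0 /\ x = e p / e r) ->
  forall s : seq K, exists2 d, sring d & d != 0 /\ forall x, x \in s -> sring (x * d).
Proof.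
move=> gen; elim=> [|x s [d Od [d0 hd]]].
  by exists 1; [exact: (ring_pred1 sring_ring) | rewrite oner_neq0].
have [p [r [r0 xE]]] := gen x.
exists (e r * d); first by apply: (ring_predM sring_ring) => //; exact: sring_e.
split; first by rewrite mulf_neq0.
move=> y; rewrite inE => /orP[/eqP->|ys].
  by rewrite xE mulrA divfK //; apply: (ring_predM sring_ring) => //; exact: sring_e.
by rewrite mulrCA; apply: (ring_predM sring_ring); [exact: sring_e | exact: hd].
Qed.
End SpecRing.

Section PolynomialBase.
Variables (A : idomainType) (K k : fieldType) (e : {rmorphism A -> K}) (pi : {rmorphism A -> k}).
Hypothesis e_inj : injective e.
Variable q : A.
Hypotheses (qp : prime_elt q) (piq : pi q = 0).

Lemma e_eq0 p : (e p == 0) = (p == 0).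
Proof. by rewrite -(rmorph0 e) (inj_eq e_inj). Qed.

Lemma base_sp p : e p = 0 -> pi p = 0.
Proof. by move/eqP; rewrite e_eq0 => /eqP->; rewrite rmorph0. Qed.

Lemma ndvd_pi r : pi r != 0 -> ~ divides q r.
Proof. by move=> r0 [c rE]; case/negP: r0; rewrite rE rmorphM piq mulr0. Qed.

(** Denominators are nonzero at the point and [q] vanishes there, so the prime [q] divides no
    denominator. *)
Lemma multiple_sring p r : pi r != 0 ->
  multiple (e q) (sring e pi) (e p / e r) <-> divides q p.
Proof.
move=> r0; have er := sp_neq0 base_sp r0; split=> [[_ [p' [r' [r'0 ->]]] E]|[c ->]].
  have er' := sp_neq0 base_sp r'0.
  have /e_inj H : e (p * r') = e (r * p' * q).
    by rewrite !rmorphM; move/eqP: E; rewrite mulrA eqr_div // => /eqP->; ring.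
  have /(prime_dvdM qp)[//|/(ndvd_pi r'0)//] : divides q (p * r').
  by rewrite H; exists (r * p').
exists (e c / e r); first by exists c, r.
by rewrite rmorphM mulrA [e q * _]mulrC.
Qed.

Lemma sring_common (s : seq K) : (forall x, x \in s -> sring e pi x) ->
  exists2 r, pi r != 0 & forall x, x \in s -> exists p, x = e p / e r.
Proof.
elim: s => [|x s IH] hs; first by exists 1; rewrite ?rmorph1 ?oner_neq0.
have [|r r0 hr] := IH; first by move=> y ys; apply: hs; rewrite inE ys orbT.
have [p [r' [r'0 xE]]] := hs _ (mem_head _ _).
exists (r * r'); first by rewrite rmorphM mulf_neq0.
have er := sp_neq0 base_sp r0; have er' := sp_neq0 base_sp r'0.
move=> y; rewrite inE => /orP[/eqP->|/hr[p' ->]].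
  by exists (p * r); rewrite xE !rmorphM; field; rewrite er er'.
by exists (p' * r'); rewrite !rmorphM; field; rewrite er er'.
Qed.

Lemma base_prime x y : sring e pi x -> sring e pi y -> multiple (e q) (sring e pi) (x * y) ->
  multiple (e q) (sring e pi) x \/ multiple (e q) (sring e pi) y.
Proof.
move=> [p [r [r0 ->]]] [p' [r' [r'0 ->]]]; rewrite mulf_div -!rmorphM.
rewrite !multiple_sring ?rmorphM ?mulf_neq0 //; exact: (prime_dvdM qp).
Qed.

Definition real_elt (D : idomainType) (x : D) :=
  forall s : seq D, divides x (\sum_(y <- s) y ^+ 2) -> forall y, y \in s -> divides x y.

Lemma base_real : real_elt q -> forall s : seq K, (forall x, x \in s -> sring e pi x) ->
  multiple (e q) (sring e pi) (\sum_(x <- s) x ^+ 4) ->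
  forall x, x \in s -> multiple (e q) (sring e pi) x.
Proof.
move=> qr s hs; have [r r0 hr] := sring_common hs; have er := sp_neq0 base_sp r0.
have [f hf] : exists f : K -> A, forall x, x \in s -> x = e (f x) / e r.
  have H x : exists p, x \in s -> x = e p / e r.
    have [xs|_] := boolP (x \in s); last by exists 0.
    by have [p ->] := hr _ xs; exists p.
  by have [f hf] := choice H; exists f.
have -> : \sum_(x <- s) x ^+ 4 = e (\sum_(y <- [seq f x ^+ 2 | x <- s]) y ^+ 2) / e (r ^+ 4).
  rewrite rmorph_sum mulr_suml big_map; apply: eq_big_seq => x xs.
  by rewrite {1}(hf _ xs) expr_div_n !rmorphXn -exprM.
rewrite multiple_sring ?rmorphXn ?expf_neq0 // => /qr h x xs.
rewrite (hf _ xs) multiple_sring //; apply: (prime_dvd_exp (k := 2) qp); apply: h.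
exact: (map_f (fun x => f x ^+ 2)).
Qed.

Hypothesis fA : ufd A.

Lemma prime_multiplicity (x : A) : x != 0 -> exists j y, x = q ^+ j * y /\ ~ divides q y.
Proof.
move=> x0; have [u uu [s sp ->]] := fA x0.
have [n] := ubnP (size s); elim: n => // n IH in u uu s sp x0 *; rewrite ltnS => sn.
have [d|nd] := pselect (divides q (u * \prod_(p <- s) p)); last first.
  by exists 0%N, (u * \prod_(p <- s) p); rewrite expr0 mul1r.
have [v vu [t ts [st E]]] := dvd_sqr_factor uu sp qp d.
have [||j [y [yE ny]]] := IH v vu t (fun p pt => sp _ (ts _ pt)).
- exact: x0.
- exact: leq_trans st sn.
by exists j.+1, y; rewrite E yE exprS mulrA.
Qed.

Lemma base_order a : sring e pi a -> a != 0 -> exists j, ~ multiple (e q ^+ j) (sring e pi) a.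
Proof.
move=> [p [r [r0 ->]]] a0; have er := sp_neq0 base_sp r0.
have p0 : p != 0 by apply: contraNneq a0 => ->; rewrite rmorph0 mul0r.
have [j [y [pE ny]]] := prime_multiplicity p0.
exists j.+1 => -[_ [p' [r' [r'0 ->]]] E]; apply: ny.
have er' := sp_neq0 base_sp r'0; have eq0 : e q != 0 by rewrite e_eq0; case: qp.
have /e_inj H : e (y * r') = e (r * p' * q).
  rewrite !rmorphM; apply: (mulfI (expf_neq0 j eq0)).
  by move/eqP: E; rewrite mulrA eqr_div // pE rmorphM rmorphXn exprSr => /eqP E; rewrite mulrA E; ring.
have /(prime_dvdM qp)[//|/(ndvd_pi r'0)//] : divides q (y * r').
by rewrite H; exists (r * p').
Qed.
End PolynomialBase.

Section HypersurfaceValuation.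
Variables (A : idomainType) (K k : fieldType) (e : {rmorphism A -> K}) (pi : {rmorphism A -> k}).
Variables (eh : {rmorphism {poly A} -> K}) (pih : {rmorphism {poly A} -> k}) (h : {poly A}).
Hypotheses (fA : ufd A) (e_inj : injective e).
Hypotheses (ehC : forall c, eh c%:P = e c) (pihC : forall c, pih c%:P = pi c).
Hypotheses (hm : h \is monic) (hp : prime_elt h).
Hypotheses (ehP : forall p, eh p = 0 <-> divides h p) (pih_h : pih h = 0).

Local Notation O := (sring eh pih).
Local Notation L := (sring e pi).

Lemma hyp_sp p : eh p = 0 -> pih p = 0.
Proof. by move=> /ehP[c ->]; rewrite rmorphM pih_h mulr0. Qed.

Lemma hyp_LO x : L x -> O x.
Proof. by move=> [p [r [r0 ->]]]; exists p%:P, r%:P; rewrite pihC !ehC. Qed.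

Lemma monic_dvd_small (p : {poly A}) : (size p < size h)%N -> divides h p -> p = 0.
Proof.
move=> sp [c pE]; apply: contrapT => /eqP p0; move: sp; rewrite pE.
have c0 : c != 0 by apply: contraNneq p0 => c0; rewrite pE c0 mul0r.
rewrite size_mul ?(monic_neq0 hm) // => lt; have : (0 < size c)%N by rewrite size_poly_gt0.
by move: lt; move: (size c) (size h) => a b; clear; lia.
Qed.

Variable q : A.
Hypotheses (qp : prime_elt q) (piq : pi q = 0).

(** [A[X]/(h)] is free over [A], so after reduction modulo [h] the equation [p b' = q a'] holds
    coefficient by coefficient. If [q] did not divide [p] it would divide every coefficient of [b'],
    and the denominator [b] would vanish at the point. *)
Lemma hyp_contract l : L l -> multiple (e q) O l -> multiple (e q) L l.
Proof.
move=> [p [r [r0 ->]]] [_ [a [b [b0 ->]]] E]; apply/(multiple_sring e_inj qp piq _ r0).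
have er := sp_neq0 (base_sp pi e_inj) r0; have eb := sp_neq0 hyp_sp b0.
have hd : divides h (p%:P * b - q%:P * (r%:P * a)).
  apply/ehP; rewrite rmorphB !rmorphM !ehC; move/eqP: E.
  by rewrite mulrA eqr_div // => /eqP ->; ring.
have [b' sb [[cb cbE] _]] := elim_monic_reduce pi hm b.
have [a' sa [[ca caE] _]] := elim_monic_reduce pi hm (r%:P * a).
have sh := elim_size hm.
have E0 : p *: b' - q *: a' = 0.
  apply: monic_dvd_small.
    rewrite sh ltnS (leq_trans (size_polyD _ _)) // geq_max size_polyN.
    by rewrite !(leq_trans (size_scale_leq _ _)).
  rewrite -!mul_polyC (_ : _ - _ = p%:P * b - q%:P * (r%:P * a) - (p%:P * (b - b') - q%:P * (r%:P * a - a'))).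
    apply: dvdB => //; rewrite cbE caE; exists (p%:P * cb - q%:P * ca); ring.
  by ring.
apply: contrapT => nqp; case/negP: b0.
have /dvd_polyC[d b'E] : forall i, divides q b'`_i.
  move=> i; have /(congr1 (fun x : {poly A} => x`_i)) := E0.
  rewrite coefB !coefZ coef0 => /eqP; rewrite subr_eq0 => /eqP H.
  have /(prime_dvdM qp)[//|//] : divides q (p * b'`_i) by rewrite H; exists (a'`_i); rewrite mulrC.
have -> : b = cb * h + d * q%:P by rewrite -b'E -cbE subrK.
by rewrite rmorphD !rmorphM pih_h pihC piq !mulr0 addr0.
Qed.

(** Bezout gives a nonzero [c] in [A] that is a multiple of the numerator [p] modulo [h]. A power of
    [q] dividing [p] divides [c], and by contraction this is bounded by the multiplicity of [q] in
    [c] over the base. *)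
Lemma hyp_order a : O a -> a != 0 -> exists j, ~ multiple (e q ^+ j) O a.
Proof.
move=> [p [r [r0 ->]]] a0; have er := sp_neq0 hyp_sp r0.
have np : ~ divides h p by move=> /ehP p0; move: a0; rewrite p0 mul0r eqxx.
have [c c0 [u [v cE]]] := bezout_prime hp hm np.
have [j [y [yE ny]]] := prime_multiplicity qp fA c0.
exists j.+1 => -[z Oz E]; apply: ny.
have eq0 : e q != 0 by rewrite (e_eq0 e_inj); case: qp.
have /hyp_contract : L (e y / e 1) by exists y, 1; rewrite rmorph1 oner_neq0.
case=> [|z' Lz' E']; last first.
  by apply/(multiple_sring e_inj qp piq _ (r := 1)); rewrite ?rmorph1 ?oner_neq0 //; exists z'; rewrite // -E' rmorph1.
have rO := sring_ring hyp_sp.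
exists (eh v * eh r * z); first by apply: (ring_predM rO) => //; apply: (ring_predM rO); exact: sring_e.
rewrite rmorph1 divr1; apply: (mulfI (expf_neq0 j eq0)).
have -> : e q ^+ j * e y = eh (u * h + v * p) by rewrite -cE ehC yE rmorphM rmorphXn.
rewrite rmorphD !rmorphM ((ehP h).2 (dvd_refl h)) mulr0 add0r.
have -> : eh p = eh r * (e q ^+ j.+1 * z) by rewrite -E mulrCA mulfV // mulr1.
by rewrite exprSr; ring.
Qed.

Variables (F V : {poly A}) (s f0 f1 : A) (j : nat).
Hypotheses (s0 : pi s != 0) (V0 : pih V != 0) (F0 : pih F = 0).
Hypothesis FV : divides h (F * V - f0%:P).
Hypotheses (f0E : f0 = q ^+ j * f1) (nf1 : ~ divides q f1).
Hypothesis cyc : forall x, exists (t : A) (c : {poly A}), divides h (s%:P * x - t%:P - F * c).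

Lemma hyp_FV : eh F * eh V = e q ^+ j * e f1.
Proof.
have -> : e q ^+ j * e f1 = eh f0%:P by rewrite ehC f0E rmorphM rmorphXn.
by apply/eqP; rewrite -subr_eq0 -rmorphM -rmorphB; apply/eqP/ehP.
Qed.

Hypothesis j0 : (0 < j)%N.

Lemma hyp_F : multiple (e q) O (eh F).
Proof.
have eV := sp_neq0 hyp_sp V0; have rO := sring_ring hyp_sp.
exists (e q ^+ j.-1 * e f1 * (eh V)^-1).
  apply: (ring_predM rO); last by apply: (sunit_sring (e := eh)); apply/sunitV/sunit_e.
  by rewrite -rmorphXn -rmorphM -ehC; exact: sring_e.
apply: (mulIf eV); rewrite hyp_FV -{1}(prednK j0) exprS; field.
exact: eV.
Qed.

Lemma hyp_residue_poly a : exists t, multiple (e q) O (eh a - e t / e s) /\ pi t = pi s * pih a.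
Proof.
have [t [c ctE]] := cyc a; exists t; have es := sp_neq0 (base_sp pi e_inj) s0.
have rO := sring_ring hyp_sp; split; last first.
  have : pih (s%:P * a - t%:P - F * c) = 0 by apply/hyp_sp/ehP.
  rewrite !rmorphB !rmorphM F0 mul0r subr0 !pihC => /eqP.
  by rewrite subr_eq0 => /eqP.
have [z Oz FE] := hyp_F.
exists (z * eh c / e s).
  apply: (ring_predM rO); first by apply: (ring_predM rO) => //; exact: sring_e.
  by apply: hyp_LO; apply: (sunit_sring (e := e)); apply/sunitV/sunit_e.
have H : e s * eh a = e t + eh F * eh c.
  apply/eqP; rewrite -subr_eq0 -!ehC -!rmorphM -rmorphD -rmorphB.
  apply/eqP/ehP; have [d dE] := ctE; exists d; rewrite -dE; ring.
apply: (mulfI es); rewrite mulrBr H FE; field; exact: es.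
Qed.

Lemma hyp_residue x : O x -> exists2 l, L l & multiple (e q) O (x - l).
Proof.
move=> [a [b [b0 ->]]].
have [ta [ma _]] := hyp_residue_poly a; have [tb [mb tbE]] := hyp_residue_poly b.
have es := sp_neq0 (base_sp pi e_inj) s0; have eb := sp_neq0 hyp_sp b0.
have tb0 : pi tb != 0 by rewrite tbE mulf_neq0.
have etb := sp_neq0 (base_sp pi e_inj) tb0.
have rO := sring_ring hyp_sp.
exists (e ta / e tb); first by exists ta, tb.
have [za Oza aE] := ma; have [zb Ozb bE] := mb.
have -> : eh a / eh b - e ta / e tb =
    (eh b * (eh a - e ta / e s) - eh a * (eh b - e tb / e s)) * (e s / (eh b * e tb)).
  by field; rewrite es eb etb.
rewrite aE bE; exists ((eh b * za - eh a * zb) * (e s / (eh b * e tb))); last by ring.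
apply: (ring_predM rO).
  by apply: (ring_predB rO); apply: (ring_predM rO) => //; exact: sring_e.
apply: (ring_predM rO); first by rewrite -ehC; exact: sring_e.
apply: (sunit_sring (e := eh)); apply: sunitV; apply: sunitM; first exact: sunit_e.
by rewrite -ehC; apply: sunit_e; rewrite pihC.
Qed.

Hypothesis gen : forall x, exists p r, eh r != 0 /\ x = eh p / eh r.

(* Since [s x = t + F c] modulo [h] and [q] divides [F], the local rings of the hypersurface and of the
   base have the same residues modulo [q], so that [q] is again a real prime upstairs and [F] has the
   multiplicity [j] of [q] in [f0]. *)
Theorem hyp_even : real_elt q -> sum_of_powers 4 (eh F ^+ 2) -> ~~ odd j.
Proof.
move=> qr s4; have eV := sp_neq0 hyp_sp V0; have rO := sring_ring hyp_sp.
have sB := base_sp pi e_inj.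
have OV : O (e f1 / eh V).
  apply: (ring_predM rO); first by rewrite -ehC; exact: sring_e.
  by apply: (sunit_sring (e := eh)); apply/sunitV/sunit_e.
apply: (@even_valuation _ O L (e q) _ _ _ _ _ _ _ _ _ _ _ j (e f1 / eh V)) s4.
- by rewrite (e_eq0 e_inj); case: qp.
- exact: rO.
- exact: (sring_ring sB).
- exact: hyp_LO.
- by rewrite -ehC; exact: sring_e.
- exact: hyp_residue.
- exact: hyp_contract.
- exact: (base_prime e_inj qp piq).
- exact: (base_real e_inj qp piq qr).
- exact: (sring_fractions hyp_sp gen).
- exact: hyp_order.
- exact: OV.
- move=> [z Oz zE]; apply: nf1.
  have /hyp_contract : L (e f1 / e 1) by exists f1, 1; rewrite rmorph1 oner_neq0.
  case=> [|z' Lz' E'].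
    exists (eh V * z); first by apply: (ring_predM rO) => //; exact: sring_e.
    by rewrite rmorph1 divr1 mulrCA -zE mulrCA mulfV // mulr1.
  by apply/(multiple_sring e_inj qp piq _ (r := 1)); rewrite ?rmorph1 ?oner_neq0 //; exists z'; rewrite // -E' rmorph1.
- by rewrite mulrA -hyp_FV mulfK.
Qed.
End HypersurfaceValuation.

Section AffineValuation.
Variables (A : idomainType) (K k : fieldType) (e : {rmorphism A -> K}) (pi : {rmorphism A -> k}).
Hypotheses (fA : ufd A) (e_inj : injective e).
Variable q : A.
Hypotheses (qp : prime_elt q) (piq : pi q = 0).
Hypothesis gen : forall x, exists p r, e r != 0 /\ x = e p / e r.

Theorem affine_even (f0 f1 : A) j : f0 = q ^+ j * f1 -> ~ divides q f1 ->
  real_elt q -> sum_of_powers 4 (e f0 ^+ 2) -> ~~ odd j.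
Proof.
move=> f0E nf1 qr s4; have sB := base_sp pi e_inj; have rO := sring_ring sB.
apply: (@even_valuation _ (sring e pi) (sring e pi) (e q) _ _ _ _ _ _ _ _ _ _ _ j (e f1)) s4 => //.
- by rewrite (e_eq0 e_inj); case: qp.
- exact: sring_e.
- move=> x Ox; exists x => //; rewrite subrr; exists 0; rewrite ?mulr0 //; exact: (ring_pred0 rO).
- exact: (base_prime e_inj qp piq).
- exact: (base_real e_inj qp piq qr).
- exact: (sring_fractions sB gen).
- exact: (base_order e_inj qp piq fA).
- exact: sring_e.
- move=> [z Oz zE]; apply: nf1.
  apply/(multiple_sring e_inj qp piq _ (r := 1)); rewrite ?rmorph1 ?oner_neq0 //.
  by exists z; rewrite // -zE divr1.
- by rewrite f0E rmorphM rmorphXn.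
Qed.
End AffineValuation.

Lemma extract_prime (D : idomainType) (q u : D) (s : seq D) : u \is a GRing.unit ->
  (forall p, p \in s -> prime_elt p) -> prime_elt q ->
  exists j v t, [/\ v \is a GRing.unit, forall p, p \in t -> p \in s,
    u * \prod_(p <- s) p = q ^+ j * (v * \prod_(p <- t) p), ~ divides q (v * \prod_(p <- t) p)
    & (size t + j <= size s)%N].
Proof.
move=> uu sp qp; have [n] := ubnP (size s); elim: n => // n IH in u uu s sp *; rewrite ltnS => sn.
have [d|nd] := pselect (divides q (u * \prod_(p <- s) p)); last first.
  by exists 0%N, u, s; split=> //; rewrite ?expr0 ?mul1r ?addn0.
have [v vu [t ts [st E]]] := dvd_sqr_factor uu sp qp d.
have [|j [w [r [wu rt E' nd sr]]]] := IH v vu t (fun p pt => sp _ (ts _ pt)).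
  exact: leq_trans st sn.
exists j.+1, w, r; split=> //; first by move=> p /rt/ts.
  by rewrite E E' exprS mulrA.
by rewrite addnS (leq_ltn_trans sr).
Qed.

(** * Elements that are a local unit times a sum of squares *)

Section MonicFactors.
Variables (B : idomainType) (K k : fieldType) (e : {rmorphism {poly B} -> K}) (pi : {rmorphism {poly B} -> k}).
Hypotheses (n2 : (2 : K) != 0) (fB : ufd B) (e_inj : injective e).

Let sM := @sunitM _ _ _ e pi.

Lemma sunit_unit (u : {poly B}) : u \is a GRing.unit -> sunit e pi (e u).
Proof.
move=> uu; apply: sunit_e; apply/eqP => u0.
by have := rmorph_unit pi uu; rewrite u0 unitr0.
Qed.

Lemma sunit1 : sunit e pi 1.
Proof. by rewrite -(rmorph1 e); apply: sunit_unit; exact: unitr1. Qed.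

(** A prime factor not vanishing at the point is a local unit. For a nonreal one, [mu q] introduces
    the leading coefficient of [q], which divides that of [f0]; the unit hypothesis on the latter
    makes this correction a local unit. *)
Theorem factor_unit_sos (f0 : {poly B}) : f0 != 0 -> lead_coef f0 \is a GRing.unit ->
  (forall q, prime_elt q -> real_elt q -> pi q = 0 ->
     forall j f1, f0 = q ^+ j * f1 -> ~ divides q f1 -> ~~ odd j) ->
  exists u g, [/\ sunit e pi u, sum_of_powers 2 g & e f0 = u * g].
Proof.
move=> f00; have [u uu [s sp f0E]] := ufd_poly fB f00; rewrite {}f0E in f00 *.
have [n] := ubnP (size s); elim: n => // n IH in u uu s sp f00 *; rewrite ltnS => sn lu Ev.
case: s sp f00 sn lu Ev => [|q s] sp f00 sn lu Ev.
  exists (e u), 1; rewrite big_nil !mulr1; split=> //; first exact: sunit_unit.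
  exact: sum_of_powers1.
have qp : prime_elt q by apply: sp; rewrite mem_head.
have [j [v [t [vu ts E nd st]]]] := extract_prime uu sp qp.
have j0 : (0 < j)%N.
  case: j E {st} => // E; case: nd; rewrite expr0 mul1r in E; rewrite -E.
  by rewrite big_cons; apply: dvd_mull; apply: dvd_mulr; exact: dvd_refl.
have lt : lead_coef (v * \prod_(p <- t) p) \is a GRing.unit.
  by move: lu; rewrite E lead_coefM unitrM => /andP[].
have lq : lead_coef q \is a GRing.unit.
  by move: lu; rewrite E -(prednK j0) exprS -mulrA lead_coefM unitrM => /andP[].
have [||||u1 [g1 [u1u g1s E1]]] := IH v vu t (fun p pt => sp _ (ts _ pt)).
- by apply: contraNneq f00 => h; rewrite E h mulr0.
- by move: st sn j0; move: (size t) (size (q :: s)) => a b; clear; lia.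
- exact: lt.
(* The parity hypothesis passes to the cofactor, because a prime [q'] dividing the cofactor is not
   associate to [q]. *)
- move=> q' q'p q'r q'0 i f2 E2 nd2; case: (posnP i) => [->//|i0].
  apply: (Ev q' q'p q'r q'0 i (q ^+ j * f2)); first by rewrite E E2; ring.
  move=> /(prime_dvdM q'p)[/(prime_dvd_exp q'p) d|//].
  have [c cu qE] := prime_assoc q'p qp d.
  apply: nd; rewrite E2 -(prednK i0) exprS -mulrA; apply: dvd_mulr.
  by exists c^-1; rewrite qE mulKr.
suff [u2 [g2 [u2u g2s E2']]] : exists u2 g2, [/\ sunit e pi u2, sum_of_powers 2 g2 & e q ^+ j = u2 * g2].
  exists (u2 * u1), (g2 * g1); split; [exact: sM | exact: sum_of_powersM |].
  by rewrite E rmorphM rmorphXn E1 E2' mulrACA.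
have powu (x u2 g2 : K) : sunit e pi u2 -> sum_of_powers 2 g2 -> x = u2 * g2 ->
    exists u2 g2, [/\ sunit e pi u2, sum_of_powers 2 g2 & x ^+ j = u2 * g2].
  move=> u2u g2s ->; exists (u2 ^+ j), (g2 ^+ j); split; last exact: exprMn.
    by elim: (j) => [|l IHl]; [rewrite expr0; exact: sunit1 | rewrite exprS; exact: sM].
  exact: sum_of_powersXn.
have [q0|q0] := eqVneq (pi q) 0; last first.
  apply: (powu _ (e q) 1); rewrite ?mulr1 //; last exact: sum_of_powers1.
  exact: sunit_e.
have [qr|nqr] := pselect (real_elt q).
  have := Ev q qp qr q0 j _ E nd => /even_halfK jE.
  exists 1, (e q ^+ j); split; rewrite ?mul1r //; first exact: sunit1.
  by rewrite -jE -muln2 exprM; exact: sum_of_powersX.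
have qn : nonreal q.
  move: nqr => /existsNP[l /not_implyP[dl /existsNP[y /not_implyP[yl ny]]]].
  by exists l => //; exists y.
have := sos_nonreal_prime n2 fB e_inj qp qn; rewrite /mu => ms.
have el0 : e (lead_coef q)%:P != 0.
  by rewrite (e_eq0 e_inj) polyC_eq0 lead_coef_eq0; case: qp.
apply: (powu _ ((e (lead_coef q)%:P)^-1) (e q * e (lead_coef q)%:P)); first 1 last.
- exact: ms.
- by rewrite mulrC mulfK.
by apply: sunitV; apply: sunit_unit; apply: (rmorph_unit polyC).
Qed.
End MonicFactors.

Section LocalFactorization.
Variables (R K k : fieldType) (iK : {rmorphism R -> K}) (ik : {rmorphism R -> k}).
Hypotheses (char0 : forall j, (j.+1%:R : k) != 0) (n2 : (2 : K) != 0).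

Lemma char0R j : (j.+1%:R : R) != 0.
Proof. by rewrite -(fmorph_eq0 ik) rmorph_nat. Qed.

Lemma top_direction n (h : {mpoly R[n.+1]}) : h != 0 ->
  exists o : 'I_n -> R, mmap (idr R) (snoc o 1) (top_form h) != 0.
Proof.
move=> h0; have [d hd] := mpoly_nonvanish (idr R) char0R (top_form_neq0 h0).
pose o (j : 'I_n) : R := (d (lift ord_max j)).+1%:R / (d ord_max).+1%:R.
have t0 := char0R (d ord_max).
exists o; have E : snoc o 1 =1 (fun i => (d ord_max).+1%:R^-1 * (d i).+1%:R).
  by apply: ord_snocP => [j|]; rewrite ?snoc_lift ?snoc_max ?mulVf // mulrC.
rewrite (eq_mmap _ E) (mmap_homog _ _ _ (pihomogP _ _ _)) mulf_neq0 //.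
by rewrite expf_neq0 // invr_eq0.
Qed.

Lemma dvd_shear n (o : 'I_n -> R) (p q : {mpoly R[n.+1]}) :
  divides p q <-> divides (shear o p) (shear o q).
Proof. exact: (@dvd_iso {mpoly R[n.+1]} {poly {mpoly R[n]}} (shear o) (unshear o) (@shearK R n o)). Qed.

(** A shear along a direction at which the top form of [f0] does not vanish makes the leading
    coefficient a nonzero constant. *)
Lemma mpoly_factor_unit_sos n (e : {rmorphism {mpoly R[n]} -> K}) (pi : {rmorphism {mpoly R[n]} -> k}) f0 :
  injective e -> f0 != 0 ->
  (forall q, prime_elt q -> real_elt q -> pi q = 0 ->
     forall j f1, f0 = q ^+ j * f1 -> ~ divides q f1 -> ~~ odd j) ->
  exists u g, [/\ sunit e pi u, sum_of_powers 2 g & e f0 = u * g].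
Proof.
case: n e pi f0 => [|n] e pi f0 e_inj f00 Ev.
  exists (e f0), 1; split; rewrite ?mulr1 //; last exact: sum_of_powers1.
  apply: sunit_e; have fE : f0 = (f0@_0)%:MP.
    apply/mpolyP => m; rewrite mcoeffC (_ : m = 0%MM) ?eqxx ?mulr1 //.
    by apply/mnmP; case.
  rewrite fE; apply/eqP => p0.
  have c0 : f0@_0 != 0 by apply: contraNneq f00 => h; rewrite fE h mpolyC0.
  by have := rmorph_unit (pi \o @mpolyC 0 R) (x := f0@_0); rewrite unitfE c0 /= p0 unitr0 => /(_ isT).
have [o ot] := top_direction f00.
pose e' : {rmorphism {poly {mpoly R[n]}} -> K} := e \o unshear o.
pose pi' : {rmorphism {poly {mpoly R[n]}} -> k} := pi \o unshear o.
have e'_inj : injective e' := inj_comp e_inj (can_inj (@unshearK R n o)).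
have key : forall (f : {poly {mpoly R[n]}}), f = shear o f0 -> f != 0 /\ lead_coef f \is a GRing.unit.
  move=> _ ->; split.
    by apply: contraNneq f00 => h; rewrite -[f0](shearK o) h rmorph0.
  rewrite shear_lead //; apply: (rmorph_unit (@mpolyC n R)); by rewrite unitfE.
have [s0 su] := key _ erefl.
have [||q qp qr q0 j f1 E nd|u [g [[p [r [p0 r0 uE]]] gs E]]] :=
   @factor_unit_sos _ K k e' pi' n2 (@ufd_mpoly R n) e'_inj (shear o f0).
- exact: s0.
- exact: su.
- have us (x : {poly {mpoly R[n]}}) : shear o (unshear o x) = x := unshearK o x.
  apply: (Ev (unshear o q) _ _ q0 j (unshear o f1)).
  + apply: (@prime_iso {mpoly R[n.+1]} {poly {mpoly R[n]}} (shear o) (unshear o) (@shearK R n o)).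
    by rewrite /= us.
  + move=> l; rewrite (dvd_shear o) us (rmorph_sum (shear o)) => dl y yl.
    rewrite (dvd_shear o) us; apply: (qr [seq shear o x | x <- l]); last exact: map_f.
    rewrite big_map; move: dl; congr (divides _ _); apply: eq_bigr => x _.
    exact: (rmorphXn (shear o)).
  + by rewrite -[f0](shearK o) E (rmorphM (unshear o)) (rmorphXn (unshear o)).
  + by move=> /(dvd_shear o); rewrite !us.
exists u, g; split=> //; last by move: E; rewrite /e' /= shearK.
by exists (unshear o p), (unshear o r).
Qed.

Theorem affine_unit_sos n (y : 'I_n -> K) (P : 'I_n -> k) (f : K) :
  affine_model iK y -> generates iK y -> f != 0 -> sum_of_powers 4 (f ^+ 2) ->
  exists u g, [/\ spec_unit iK ik y P u, sum_of_powers 2 g & f = u * g].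
Proof.
move=> aff gen f0 s4; have [p [r [r0 fE]]] := gen f.
have e_inj : injective (mmap iK y).
  by apply: raddf_inj => q /aff.
have p0 : p * r != 0.
  apply: contraNneq f0 => pr0; move/eqP: pr0; rewrite mulf_eq0 fE => /orP[/eqP->|/eqP r00].
    by rewrite rmorph0 mul0r.
  by move: r0; rewrite r00 rmorph0 eqxx.
(* Replacing [p / r] by [p r] changes [f] only by a square. *)
have fr : mmap iK y (p * r) = f * mmap iK y r ^+ 2.
  by rewrite rmorphM fE /=; field; exact: r0.
have [q qp qr q0 j f1 E nd|u [g [uu gs E]]] :=
  @mpoly_factor_unit_sos n (mmap iK y) (mmap ik P) (p * r) e_inj p0.
  apply: (@affine_even _ K k (mmap iK y) (mmap ik P) (@ufd_mpoly R n) e_inj q qp q0 gen _ _ _ E nd qr).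
  rewrite [X in X ^+ 2]fr exprMn -exprM; apply: sum_of_powersM => //; exact: sum_of_powersX.
exists u, (g / mmap iK y r ^+ 2); split.
- exact: uu.
- by apply: sum_of_powers_div => //; exact: sum_of_powersX.
- by rewrite mulrA -[_ * g]E [X in X / _]fr mulfK // expf_neq0.
Qed.
End LocalFactorization.

(** An element of [A] killed by [e] is a constant polynomial divisible by [h], which is monic of
    positive degree. So the projected coordinates are algebraically independent. *)
Lemma monic_const_inj (A : idomainType) (K k : fieldType) (e : {rmorphism A -> K}) (pi : {rmorphism A -> k})
    (eh : {rmorphism {poly A} -> K}) (h : {poly A}) (theta : k) (H1 : {poly k}) :
  (forall c, eh c%:P = e c) -> h \is monic -> (forall p, eh p = 0 <-> divides h p) ->
  map_poly pi h = ('X - theta%:P) * H1 -> H1.[theta] != 0 -> injective e.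
Proof.
move=> ehC hm ehP hE H10; have H1n : H1 != 0 by apply: contraNneq H10 => ->; rewrite horner0.
have sh : (1 < size h)%N.
  rewrite -(size_map_poly_id0 (f := pi)) ?(monicP hm) ?rmorph1 ?oner_neq0 //.
  rewrite hE size_mul ?polyXsubC_eq0 // size_XsubC.
  by rewrite addSn /= add1n ltnS size_poly_gt0.
apply: raddf_inj => c ec; have /ehP d : eh c%:P = 0 by rewrite ehC.
apply/eqP.
rewrite -polyC_eq0; apply/eqP; apply: (monic_dvd_small hm _ d).
by apply: leq_ltn_trans sh; exact: size_polyC_leq1.
Qed.

Section Hypersurface.
Variables (R K k : fieldType) (iK : {rmorphism R -> K}) (ik : {rmorphism R -> k}).
Hypotheses (char0 : forall j, (j.+1%:R : k) != 0) (n2 : (2 : K) != 0).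

Section Abstract.
Variables (n : nat) (e : {rmorphism {mpoly R[n]} -> K}) (pi : {rmorphism {mpoly R[n]} -> k}).
Local Notation A := {mpoly R[n]}.
Variables (eh : {rmorphism {poly A} -> K}) (pih : {rmorphism {poly A} -> k}).
Variables (h F : {poly A}) (theta : k) (H1 : {poly k}).
Hypotheses (ehC : forall c, eh c%:P = e c) (pihC : forall c, pih c%:P = pi c).
Hypothesis pihE : forall p, pih p = (map_poly pi p).[theta].
Hypotheses (hm : h \is monic) (hp : prime_elt h).
Hypotheses (ehP : forall p, eh p = 0 <-> divides h p).
Hypothesis gen : forall x, exists p r, eh r != 0 /\ x = eh p / eh r.
Hypotheses (hE : map_poly pi h = ('X - theta%:P) * H1) (H10 : H1.[theta] != 0).
Hypothesis cop : coprimep H1 (map_poly pi F).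

(** In [F V = f0] the factor [V] is a local unit, so a decomposition of [f0], which lies in the
    polynomial ring of the base, gives one of [F]. *)
Lemma hyp_unit_sos : eh F != 0 -> pih F = 0 -> sum_of_powers 4 (eh F ^+ 2) ->
  exists u g, [/\ sunit eh pih u, sum_of_powers 2 g & eh F = u * g].
Proof.
move=> F0 pF s4; have e_inj := monic_const_inj ehC hm ehP hE H10.
have pih_h : pih h = 0 by rewrite pihE hE !hornerE subrr mul0r.
have sp p : eh p = 0 -> pih p = 0 by move=> /ehP[c ->]; rewrite rmorphM pih_h mulr0.
have [s s0 cyc] := elim_cyclic hm hE cop.
have gt : (map_poly pi F).[theta] = 0 by rewrite -pihE.
have [f0 [V [d]]] := elim_norm hm hE H10 cop gt; rewrite -pihE => V0.
have eV : eh V != 0 by apply: contraNneq V0 => /sp ->.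
have FVE : eh F * eh V = e f0.
  by apply/eqP; rewrite -ehC -subr_eq0 -rmorphM -rmorphB; apply/eqP/ehP.
have f00 : f0 != 0.
  by apply: contraNneq (mulf_neq0 F0 eV) => f00; rewrite FVE f00 rmorph0.
have [q qp qr q0 j f1 E nd|u [g [[p [r [p0 r0 uE]]] gs E]]] :=
  mpoly_factor_unit_sos ik char0 n2 (e := e) (pi := pi) e_inj f00.
  case: (posnP j) => [->//|j0].
  apply: (hyp_even (@ufd_mpoly R n) e_inj ehC pihC hm hp ehP pih_h qp q0 s0 V0 pF d E nd _ j0 gen qr s4).
  by move=> x; have [t [c [dx _]]] := cyc x; exists t, c.
exists (u / eh V), g; split=> //; last by rewrite mulrAC -E -FVE mulfK.
exists p%:P, (r%:P * V); rewrite (rmorphM pih) (rmorphM eh) !pihC !ehC mulf_neq0 //.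
by split=> //; rewrite uE invfM mulrA.
Qed.
End Abstract.

Theorem hypersurface_unit_sos n (y : 'I_n -> K) (P : 'I_n -> k) (f : K) : (0 < n)%N ->
  hypersurface_model iK ik y P -> specializes iK ik y P -> generates iK y ->
  f != 0 -> sum_of_powers 4 (f ^+ 2) ->
  exists u g, [/\ spec_unit iK ik y P u, sum_of_powers 2 g & f = u * g].
Proof.
case: n y P => // n y P _ [h [hp hy [v hv] hgen]] sp gen f0 s4.
have [p [r [r0 fE]]] := gen f; set F := p * r.
have p0 : mmap iK y p != 0 by apply: contraNneq f0 => p0; rewrite fE p0 mul0r.
have Fy : mmap iK y F = f * mmap iK y r ^+ 2.
  by rewrite (rmorphM (mmap iK y)) fE /=; field; exact: r0.
have Fy0 : mmap iK y F != 0 by rewrite Fy mulf_neq0 // expf_neq0.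
suff [u [g [uu gs E]]] : exists u g, [/\ spec_unit iK ik y P u, sum_of_powers 2 g & mmap iK y F = u * g].
  exists u, (g / mmap iK y r ^+ 2); split=> //.
    by apply: sum_of_powers_div => //; exact: sum_of_powersX.
  by rewrite mulrA -E Fy mulfK // expf_neq0.
have [FP|FP] := eqVneq (mmap ik P F) 0; last first.
  exists (mmap iK y F), 1; rewrite mulr1; split=> //; last exact: sum_of_powers1.
  exists F, 1; rewrite (rmorph1 (mmap iK y)) (rmorph1 (mmap ik P)) divr1 oner_neq0; split=> //.
have nd : ~ divides h F by move=> [c cE]; move: Fy0; rewrite cE (rmorphM (mmap iK y)) /= hy mulr0 eqxx.
have hP := sp _ hy.
have [o [u [H1 [u0 hm hE H10 cop]]]] := elim_setup char0 hp nd hP hv.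
pose y' (j : 'I_n) := y (lift ord_max j) - iK (o j) * y ord_max.
pose P' (j : 'I_n) := P (lift ord_max j) - ik (o j) * P ord_max.
have [eh [ehC ehS]] : exists eh : {rmorphism {poly {mpoly R[n]}} -> K},
    (forall c, eh c%:P = mmap iK y' c) /\ (forall q, eh (shear o q) = mmap iK y q).
  by exists (pev iK y' (y ord_max)); split=> q; [exact: pevC | exact: pev_shear_pt].
have [pih [pihC pihS pihE]] : exists pih : {rmorphism {poly {mpoly R[n]}} -> k},
    [/\ forall c, pih c%:P = mmap ik P' c, forall q, pih (shear o q) = mmap ik P q
      & forall q, pih q = (map_poly (mmap ik P') q).[P ord_max]].
  by exists (pev ik P' (P ord_max)); split=> q; [exact: pevC | exact: pev_shear_pt|].
have ehU q : eh q = mmap iK y (unshear o q) by rewrite -ehS unshearK.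
have pihU q : pih q = mmap ik P (unshear o q) by rewrite -pihS unshearK.
have uu : u%:MP%:P \is a @GRing.unit {poly {mpoly R[n]}}.
  by apply: (rmorph_unit polyC); apply: (rmorph_unit (@mpolyC n R)); rewrite unitfE.
move: hm hE; rewrite -mul_polyC => hm hE.
have hp' : prime_elt (u%:MP%:P * shear o h) by apply: prime_unitM => //; exact: shear_prime.
have ehP q : eh q = 0 <-> divides (u%:MP%:P * shear o h) q.
  rewrite ehU; split=> [/hgen[c cE]|/(dvd_unitM _ _ uu)[c cE]].
    apply/(dvd_unitM _ _ uu); exists (shear o c).
    by rewrite -[q](unshearK o) cE (rmorphM (shear o)).
  by rewrite -ehU cE (rmorphM eh) ehS hy mulr0.
have gen' x : exists p r, eh r != 0 /\ x = eh p / eh r.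
  have [a [b [b0 E]]] := gen x; exists (shear o a), (shear o b).
  exact: conj (eq_ind_r (fun z => z != 0) b0 (ehS b))
    (etrans E (esym (congr2 (fun z t => z / t) (ehS a) (ehS b)))).
have FS0 : eh (shear o F) != 0 by rewrite ehS.
have FSP : pih (shear o F) = 0 by rewrite pihS.
have FS4 : sum_of_powers 4 (eh (shear o F) ^+ 2).
  by rewrite ehS Fy exprMn -exprM; apply: sum_of_powersM => //; exact: sum_of_powersX.
have [w [g [[a [b [a0 b0 wE]]] gs E]]] :=
  hyp_unit_sos ehC pihC pihE hm hp' ehP gen' hE H10 cop FS0 FSP FS4.
exists w, g; split=> //; last by rewrite -E ehS.
by exists (unshear o a), (unshear o b); rewrite -(pihU a) -(pihU b) -(ehU a) -(ehU b); split.
Qed.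

Theorem unit_times_sos n (y : 'I_n -> K) (P : 'I_n -> k) (f : K) :
  specializes iK ik y P -> generates iK y -> locally_generated iK ik y P ->
  conormal_injective iK ik y P -> f != 0 -> sum_of_powers 4 (f ^+ 2) ->
  exists u g, [/\ spec_unit iK ik y P u, sum_of_powers 2 g & f = u * g].
Proof.
move=> sp gen lg ci f0 s4.
have [m [y' [P' [sp' gen' su alt]]]] := reduce_to_hypersurface char0 sp gen lg ci.
suff [u [g [uu gs E]]] : exists u g, [/\ spec_unit iK ik y' P' u, sum_of_powers 2 g & f = u * g].
  by exists u, g; split=> //; exact: su.
case: alt => [aff|[m0 hyp]]; first exact: affine_unit_sos.
exact: hypersurface_unit_sos.
Qed.
End Hypersurface.

(** * Points of projective varieties *)

Section Homogeneous.
Variables (R : comNzRingType) (n : nat).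
Implicit Types (p q g : {mpoly R[n]}).

Lemma homog_partition k p : (msize p <= k)%N -> p = \sum_(d < k) pihomog mdeg d p.
Proof. exact: (@pihomog_partitionE n R mdeg). Qed.

Lemma pihomogMr N d h g : g \is d.-homog ->
  pihomog mdeg N (h * g) = (if (d <= N)%N then pihomog mdeg (N - d) h else 0) * g.
Proof.
move=> hg; have comp e x : x \is e.-homog ->
    pihomog mdeg N (x * g) = if (e + d == N)%N then x * g else 0.
  move=> hx; have hxg := dhomogM hx hg; case: eqVneq hxg => [<- hxg|ne hxg].
    by rewrite pihomog_dE.
  exact: pihomog_ne0 ne hxg.
rewrite {1}(homog_partition (leqnn _) : h = _) mulr_suml raddf_sum /=.
under eq_bigr do rewrite (comp _ _ (pihomogP _ _ _)).
have [le|lt] := leqP d N; last first.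
  by rewrite mul0r big1 // => i _; rewrite gtn_eqF // (leq_trans lt) // leq_addl.
case: (ltnP (N - d) (msize h)) => sz.
  rewrite (bigD1 (Ordinal sz)) //= subnK // eqxx big1 ?addr0 // => i ne.
  case: eqP => // E; case/eqP: ne; apply: val_inj; by rewrite /= -E addnK.
rewrite big1 => [|i _]; last first.
  by rewrite ltn_eqF // addnC -ltn_subRL (leq_trans (ltn_ord i)).
have -> : pihomog mdeg (N - d) h = 0; last by rewrite mul0r.
rewrite {1}(homog_partition (leqnn _) : h = _) raddf_sum big1 // => i _.
apply: (pihomog_ne0 (d := i)); last exact: pihomogP.
by rewrite ltn_eqF // (leq_trans (ltn_ord i)).
Qed.

Lemma dhomog_mderiv d g i : g \is d.-homog -> g^`M(i) \is (d.-1).-homog.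
Proof.
move=> /dhomogP hg; rewrite (mpolyE g) raddf_sum big_seq; apply: rpred_sum => m mg /=.
rewrite mderivZ mderivX; do 1?apply: rpredZ.
case: (posnP (m i)) => [->|mi]; first by rewrite scale0r rpred0.
apply: rpredZ; rewrite dhomogX -(hg _ mg).
have le : (U_(i) <= m)%MM by rewrite lep1mP -lt0n.
by rewrite -[in (mdeg m).-1](submK le) mdegD mdeg1 addn1.
Qed.
End Homogeneous.

Lemma dhomog_var (R : nzRingType) n (i : 'I_n) : ('X_i : {mpoly R[n]}) \is 1.-homog.
Proof. by rewrite dhomogX; apply/eqP/mdeg1. Qed.

Lemma divf_common (L : fieldType) (a b x : L) : x != 0 -> a / x / (b / x) = a / b.
Proof. by move=> x0; rewrite invf_div mulrA mulfVK. Qed.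

Lemma div_swap (L : fieldType) (a b : L) : a != 0 -> b != 0 -> a / b * (b / a) = 1.
Proof. by move=> a0 b0; rewrite mulf_div [X in X / _]mulrC divff // mulf_neq0. Qed.

Section Dehomogenize.
Variables (R : fieldType) (n : nat) (L : fieldType) (psi : {rmorphism {mpoly R[n.+1]} -> L}) (j : 'I_n.+1).
Hypothesis psij : psi 'X_j != 0.

Lemma mmap_psi p : mmap (psi \o @mpolyC n.+1 R) (fun i => psi 'X_i) p = psi p.
Proof. by move: p; apply: mpoly_rmorph_ext => [c|i] /=; rewrite ?mmapC ?mmapXi. Qed.

Lemma dehomog_homog d p : p \is d.-homog ->
  mmap (psi \o @mpolyC n.+1 R) (fun i => psi 'X_i / psi 'X_j) p = psi p / psi 'X_j ^+ d.
Proof.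
move=> hp; have E : (fun i => psi 'X_i / psi 'X_j) =1 (fun i => (psi 'X_j)^-1 * psi 'X_i).
  by move=> i; rewrite mulrC.
rewrite (eq_mmap _ E).
by rewrite (mmap_homog _ _ _ hp) mmap_psi exprVn mulrC.
Qed.

Definition homogenize (D : nat) (p : {mpoly R[n.+1]}) : {mpoly R[n.+1]} :=
  \sum_(d < D) 'X_j ^+ (D - d) * pihomog mdeg d p.

Lemma homogenize_homog D p : homogenize D p \is D.-homog.
Proof.
apply: rpred_sum => d _; have hj := dhomog_var R j.
have := dhomogM (dhomogMn (D - d) hj) (pihomogP mdeg d p).
by rewrite mul1n subnK // ltnW.
Qed.

Lemma dehomogE D p : (msize p <= D)%N ->
  mmap (psi \o @mpolyC n.+1 R) (fun i => psi 'X_i / psi 'X_j) p = psi (homogenize D p) / psi 'X_j ^+ D.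
Proof.
move=> sp; rewrite {1}(homog_partition sp : p = _) !rmorph_sum mulr_suml; apply: eq_bigr => d _ /=.
rewrite (dehomog_homog (pihomogP _ _ _)) rmorphM rmorphXn /=.
have -> : psi 'X_j ^+ D = psi 'X_j ^+ (D - d) * psi 'X_j ^+ d.
  by rewrite -exprD subnK // ltnW.
rewrite invfM.
by rewrite mulrACA mulfV ?mul1r // expf_neq0.
Qed.

Lemma dvd_sub_homogenize D p : (msize p <= D)%N -> divides ('X_j - 1) (p - homogenize D p).
Proof.
move=> sp; rewrite {1}(homog_partition sp : p = _) /homogenize -sumrB.
apply: dvd_sum => d _; have -> : pihomog mdeg d p - 'X_j ^+ (D - d) * pihomog mdeg d p =
  (1 - 'X_j ^+ (D - d)) * pihomog mdeg d p by rewrite mulrBl mul1r.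
apply: dvd_mulr; exists (- \sum_(i < D - d) 'X_j ^+ i).
by rewrite -opprB subrX1 mulNr mulrC.
Qed.
End Dehomogenize.

Section Coordinates.
Variables (R : fieldType) (n : nat) (X : projPoint R n).
Local Notation K := (function_field X).

Definition frac_coord : {mpoly R[n.+1]} -> {fraction coordRing X} := @tofrac (coordRing X) \o @Defs.coord R n X.
HB.instance Definition _ := GRing.RMorphism.on frac_coord.

Lemma frac_coord_eq0 p : (frac_coord p == 0) = (p \in X).
Proof. by rewrite /frac_coord /= tofrac_eq0 coord_eq0. Qed.

Lemma ratio_degree0 d F G : F \is d.-homog -> G \is d.-homog -> G \notin X ->
  ratio_of X F G \in @degree0 _ _ X.
Proof. by move=> hF hG nG; apply/asboolP; exists d, F, G. Qed.

Definition const_field (c : R) : K := insubd (0 : K) (ratio_of X c%:MP 1).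

Lemma const_fieldE c : val (const_field c) = frac_coord c%:MP.
Proof.
rewrite insubdK; first by rewrite /ratio_of rmorph1 divr1.
by apply: (@ratio_degree0 0); rewrite ?dhomog1 ?idealr1 // -alg_mpolyC rpredZ // dhomog1.
Qed.

Fact const_field_zmod : zmod_morphism const_field.
Proof. by move=> a b; apply: val_inj; rewrite rmorphB /= !const_fieldE !rmorphB. Qed.
Fact const_field_monoid : monoid_morphism const_field.
Proof.
by split=> [|a b]; apply: val_inj; rewrite ?rmorph1 ?rmorphM /= !const_fieldE ?rmorph1 ?rmorphM.
Qed.
HB.instance Definition _ := GRing.isZmodMorphism.Build _ _ const_field const_field_zmod.
HB.instance Definition _ := GRing.isMonoidMorphism.Build _ _ const_field const_field_monoid.

Variable j : 'I_n.+1.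
Hypothesis jX : 'X_j \notin X.

(** All [n + 1] quotients are kept, including [x_j / x_j = 1]: the chart lies in affine space of
    dimension [n + 1] with [X_j - 1] as a further equation, which avoids reindexing. The default
    value 0 is not taken when [X_j] is outside [X]. *)
Definition affine_coord (i : 'I_n.+1) : K := insubd (0 : K) (ratio_of X 'X_i 'X_j).

Lemma affine_coordE i : val (affine_coord i) = frac_coord 'X_i / frac_coord 'X_j.
Proof. by rewrite insubdK //; apply: (@ratio_degree0 1); rewrite // dhomog_var. Qed.

Lemma frac_coord_j : frac_coord 'X_j != 0.
Proof. by rewrite frac_coord_eq0. Qed.

Lemma val_mmap_affine p : val (mmap const_field affine_coord p) =
  mmap (frac_coord \o @mpolyC n.+1 R) (fun i => frac_coord 'X_i / frac_coord 'X_j) p.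
Proof.
move: p; apply: (mpoly_rmorph_ext (f := (val : {rmorphism K -> _}) \o mmap const_field affine_coord)) => [c|i] /=.
  by rewrite !mmapC const_fieldE.
by rewrite !mmapXi affine_coordE.
Qed.

Lemma affine_eval_homog d p : p \is d.-homog ->
  val (mmap const_field affine_coord p) = frac_coord p / frac_coord 'X_j ^+ d.
Proof. by move=> hp; rewrite val_mmap_affine (dehomog_homog _ _ hp). Qed.

Lemma affine_eval D p : (msize p <= D)%N ->
  val (mmap const_field affine_coord p) = frac_coord (homogenize j D p) / frac_coord 'X_j ^+ D.
Proof. by move=> sp; rewrite val_mmap_affine (dehomogE frac_coord_j sp). Qed.

Lemma affine_eval_eq0 D p : (msize p <= D)%N ->
  (mmap const_field affine_coord p == 0) = (homogenize j D p \in X).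
Proof.
move=> sp; rewrite -(inj_eq val_inj) rmorph0 (affine_eval sp) -frac_coord_eq0.
by rewrite mulf_eq0 invr_eq0 expf_eq0 (negPf frac_coord_j) andbF orbF.
Qed.

Lemma affine_eval_homog_eq0 d p : p \is d.-homog ->
  (mmap const_field affine_coord p == 0) = (p \in X).
Proof.
move=> hp; rewrite -(inj_eq val_inj) rmorph0 (affine_eval_homog hp) -frac_coord_eq0.
by rewrite mulf_eq0 invr_eq0 expf_eq0 (negPf frac_coord_j) andbF orbF.
Qed.

Lemma affine_generates : generates const_field affine_coord.
Proof.
move=> x; have /asboolP[d [F [G [hF hG nG xE]]]] := valP x.
exists F, G; rewrite (affine_eval_homog_eq0 hG) nG; split=> //; apply: val_inj.
rewrite fmorph_div /= (affine_eval_homog hF) (affine_eval_homog hG).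
rewrite [LHS]xE /ratio_of invf_div mulrA mulfVK //.
by rewrite expf_neq0 // frac_coord_j.
Qed.

End Coordinates.

(* [phi] is the map to the fraction field of the coordinate ring of [M], or the evaluation at the
   homogeneous coordinates of a real point. *)
Section LocalPoint.
Variables (R : fieldType) (n : nat) (X M : projPoint R n) (k : fieldType).
Variable phi : {rmorphism {mpoly R[n.+1]} -> k}.
Hypothesis phiM : forall d p, p \is d.-homog -> (phi p == 0) = (p \in M).
Hypothesis XM : point_of X M.
Variable j : 'I_n.+1.
Hypothesis jM : 'X_j \notin M.

Let jX : 'X_j \notin X. Proof. by apply: contra jM; exact: XM. Qed.
Let phij : phi 'X_j != 0. Proof. by rewrite (phiM (d := 1)) // dhomog_var. Qed.

Local Notation K := (function_field X).
Local Notation iK := (@const_field _ _ X).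
Local Notation y := (affine_coord X j).
Let ik : {rmorphism R -> k} := phi \o @mpolyC n.+1 R.
Let P (i : 'I_n.+1) := phi 'X_i / phi 'X_j.

Lemma point_eval_homog_eq0 d p : p \is d.-homog -> (mmap ik P p == 0) = (p \in M).
Proof.
move=> hp; rewrite (dehomog_homog _ _ hp) -(phiM hp).
by rewrite mulf_eq0 invr_eq0 expf_eq0 (negPf phij) andbF orbF.
Qed.

Lemma point_eval_eq0 D p : (msize p <= D)%N -> (mmap ik P p == 0) = (homogenize j D p \in M).
Proof.
move=> sp; rewrite (dehomogE phij sp) -(phiM (homogenize_homog j D p)).
by rewrite mulf_eq0 invr_eq0 expf_eq0 (negPf phij) andbF orbF.
Qed.

Lemma affine_specializes : specializes iK ik y P.
Proof.
move=> p /eqP; rewrite (affine_eval_eq0 jX (leqnn _)) => /XM pM.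
by apply/eqP; rewrite (point_eval_eq0 (leqnn _)).
Qed.

Lemma spec_unit_local u : spec_unit iK ik y P u -> local_unit M u.
Proof.
move=> [p [r [pP rP uE]]]; set D := maxn (msize p) (msize r).
have sp : (msize p <= D)%N := leq_maxl _ _; have sr : (msize r <= D)%N := leq_maxr _ _.
have hp := homogenize_homog j D p; have hr := homogenize_homog j D r.
have pM : homogenize j D p \notin M by rewrite -(point_eval_eq0 sp).
have rM : homogenize j D r \notin M by rewrite -(point_eval_eq0 sr).
have py : mmap iK y p != 0 by apply: contraNneq pP => /affine_specializes/eqP.
have ry : mmap iK y r != 0 by apply: contraNneq rP => /affine_specializes/eqP.
have ratioE a b : (msize a <= D)%N -> (msize b <= D)%N ->
    val (mmap iK y a / mmap iK y b) = ratio_of X (homogenize j D a) (homogenize j D b).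
  move=> sa sb; rewrite fmorph_div /= (affine_eval jX sa) (affine_eval jX sb).
  exact: (divf_common _ _ (expf_neq0 D (frac_coord_j jX))).
split; first by exists D, (homogenize j D p), (homogenize j D r); split=> //; rewrite uE ratioE.
exists (mmap iK y r / mmap iK y p).
  by exists D, (homogenize j D r), (homogenize j D p); split=> //; rewrite ratioE.
exact: etrans (congr1 (fun z => z * _) uE) (div_swap py ry).
Qed.

Lemma homog_component_notin s : s \notin M -> exists e, pihomog mdeg e s \notin M.
Proof.
move=> sM; apply: contrapT => /forallNP H; case/negP: sM.
rewrite (homog_partition (leqnn _) : s = _); apply: rpred_sum => i _.
by apply: contrapT => /negP; exact: H.
Qed.

Variables (c : nat) (g : 'I_c -> {mpoly R[n.+1]}) (J : 'I_c -> 'I_n.+1).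
Hypothesis gX : forall a, g a \in X /\ exists d, g a \is d.-homog.
Hypothesis gen : forall f, f \in X -> exists2 s, s \notin M &
  exists h : 'I_c -> {mpoly R[n.+1]}, s * f = \sum_a h a * g a.
Hypothesis Jj : forall a, J a != j.
Hypothesis jac : \det (\matrix_(a, b) (g a)^`M(J b)) \notin M.

Lemma affine_equation a : mmap iK y (g a) = 0.
Proof. by have [ga [d hg]] := gX a; apply/eqP; rewrite (affine_eval_homog_eq0 jX hg). Qed.

(** The relation for the homogenization of [f] is restricted to a single degree, in which the
    multiplier is a homogeneous component outside [M], since [phi] detects [M] only on homogeneous
    polynomials. The difference between [f] and its homogenization is a multiple of [X_j - 1]. *)
Lemma affine_local_equations f : mmap iK y f = 0 -> exists2 s, mmap ik P s != 0 &
  exists (h : 'I_c -> {mpoly R[n.+1]}) h0, s * f = \sum_a h a * g a + h0 * ('X_j - 1).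
Proof.
move=> /eqP; set D := msize f; rewrite (affine_eval_eq0 jX (leqnn _)) => /gen[s sM [h E]].
have [e se] := homog_component_notin sM.
have [d dE] := choice (fun a => (gX a).2).
have hD := homogenize_homog j D f.
exists (pihomog mdeg e s); first by rewrite (point_eval_homog_eq0 (pihomogP _ _ _)).
have [q qE] := dvd_sub_homogenize j (leqnn (msize f)).
exists (fun a => if (d a <= e + D)%N then pihomog mdeg (e + D - d a) (h a) else 0), (pihomog mdeg e s * q).
have := congr1 (pihomog mdeg (e + D)) E; rewrite (pihomogMr _ _ hD) leq_addl addnK raddf_sum /= => E'.
rewrite -{1}[f](subrK (homogenize j D f)) mulrDr E' addrC qE mulrA; congr (_ + _).
by apply: eq_bigr => a _; rewrite (pihomogMr _ _ (dE a)).
Qed.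

Lemma coord_sub1_y : mmap iK y ('X_j - 1) = 0.
Proof.
rewrite rmorphB rmorph1 /= mmapXi; apply/eqP; rewrite subr_eq0 -(inj_eq val_inj) (affine_coordE jX) rmorph1.
by rewrite divff // (frac_coord_j jX).
Qed.

Lemma affine_locally_generated : locally_generated iK ik y P.
Proof.
exists c.+1, (fun a => if unlift ord0 a is Some b then g b else 'X_j - 1); split=> [a|f].
  by case: unliftP => [b _|_]; [exact: affine_equation | exact: coord_sub1_y].
move=> /affine_local_equations[s s0 [h [h0 E]]]; exists s => //.
exists (fun a => if unlift ord0 a is Some b then h b else h0).
rewrite E big_ord_recl unlift_none addrC; congr (_ + _).
by apply: eq_bigr => a _; rewrite liftK.
Qed.

Lemma jacobian_point : \det (\matrix_(a, b) mmap ik P (g a)^`M(J b)) != 0.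
Proof.
have [d dE] := choice (fun a => (gX a).2).
have hom : \det (\matrix_(a, b) (g a)^`M(J b)) \is (\sum_a (d a).-1)%N.-homog.
  apply: rpred_sum => s _; rewrite -signr_odd; case: odd; rewrite /= ?expr1 ?expr0 ?mulN1r ?mul1r ?rpredN;
    apply: (big_ind2 (fun (p : {mpoly R[n.+1]}) e => p \is e.-homog)) => [|p e q e' hp hq|a _];
    by [exact: dhomog1 | exact: dhomogM | rewrite mxE; apply: dhomog_mderiv].
rewrite (_ : (\matrix_(a, b) _) = map_mx (mmap ik P) (\matrix_(a, b) (g a)^`M(J b))).
  by rewrite det_map_mx (point_eval_homog_eq0 hom).
by apply/matrixP => a b; rewrite !mxE.
Qed.

(** Differentiating the local relation at [P] gives [\sum h_a dg_a + h0 dX_j = 0]. In the columns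
    [J], all different from [j], the last term disappears, and the Jacobian minor forces each [h_a]
    to vanish at [P]; then so does [h0]. *)
Lemma affine_conormal_injective : conormal_injective iK ik y P.
Proof.
move=> f fy dz; have [s s0 [h [h0 E]]] := affine_local_equations fy.
have fP := affine_specializes fy.
have gP a : mmap ik P (g a) = 0 := affine_specializes (affine_equation a).
have jP : mmap ik P ('X_j - 1) = 0 := affine_specializes coord_sub1_y.
have D v : \sum_a mmap ik P (h a) * (line ik P v (g a))`_1 + mmap ik P h0 * v j = 0.
  have := congr1 (fun p => (line ik P v p)`_1) E => /=.
  rewrite line1M dz fP !mulr0 addr0 (rmorphD (line ik P v)) coefD line1M jP mulr0 add0r.
  rewrite (rmorph_sum (line ik P v)) coef_sum /=.
  under eq_bigr do rewrite line1M gP mulr0 add0r.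
  move=> e.
rewrite [RHS]e; congr (_ + _ * _).
rewrite line1 (bigD1 j) //= big1 => [|i ij].
    rewrite addr0 mderivB -mpolyC1 mderivC mderivX mnm1E eqxx scale1r subr0.
    have -> : (U_(j) - U_(j))%MM = 0%MM by apply/mnmP => i; rewrite !mnmE subnn.
    by rewrite mpolyX0 rmorph1 mulr1.
  by rewrite mderivB -mpolyC1 mderivC mderivX mnm1E eq_sym (negPf ij) scale0r subr0 rmorph0 mulr0.
exists s => //; exists c.+1, (fun a => if unlift ord0 a is Some b then h b else h0),
  (fun a => if unlift ord0 a is Some b then g b else 'X_j - 1).
have hz a : mmap ik P (h a) = 0.
  pose u : 'rV[k]_c := \row_a mmap ik P (h a).
  have : u *m (\matrix_(a, b) mmap ik P (g a)^`M(J b)) = 0.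
    apply/rowP => b; rewrite !mxE; have := D (fun i => (i == J b)%:R).
    rewrite eq_sym (negPf (Jj b)) mulr0 addr0 => {2}<-; apply: eq_bigr => a' _.
    rewrite !mxE line1 (bigD1 (J b)) //= eqxx mul1r big1 ?addr0 // => i /negPf->.
    by rewrite mul0r.
  move=> /(congr1 (mulmx^~ (invmx (\matrix_(a, b) mmap ik P (g a)^`M(J b))))).
  rewrite mul0mx mulmxK; last by rewrite unitmxE unitfE jacobian_point.
  by move=> /rowP/(_ a); rewrite !mxE.
have h0z : mmap ik P h0 = 0.
  have := D (fun i => (i == j)%:R); rewrite eqxx mulr1 big1 ?add0r // => a _.
  by rewrite hz mul0r.
split.
  move=> a; case: unliftP => [b _|_]; first by split; [exact: hz | exact: affine_equation].
  by split; [exact: h0z | exact: coord_sub1_y].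
rewrite E big_ord_recl unlift_none addrC; congr (_ + _).
by apply: eq_bigr => a _; rewrite liftK.
Qed.

End LocalPoint.

Theorem so4_local_unit_sos (R : rcfType) n (X M : projPoint R n) (f : function_field X) :
  point_of X M -> smooth_at X M -> f != 0 -> sum_of_powers 4 (f ^+ 2) ->
  exists u g, [/\ local_unit M u, sum_of_powers 2 g & f = u * g].
Proof.
move=> XM [j [c [g [J [jM gX gen [Jj jac]]]]]] f0 s4.
have phiM d p : p \is d.-homog -> (frac_coord M p == 0) = (p \in M) by rewrite frac_coord_eq0.
have [u [q [uu qs E]]] := unit_times_sos
  (natr_neq0 (frac_coord M \o @mpolyC n.+1 R)) (natr_neq0 (@const_field _ _ X) 1)
  (affine_specializes phiM XM jM) (affine_generates (contra (XM _) jM))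
  (affine_locally_generated phiM XM jM gX gen) (affine_conormal_injective phiM XM jM gX gen Jj jac)
  f0 s4.
by exists u, q; split=> //; exact: (spec_unit_local phiM XM jM uu).
Qed.

(** * Real points *)

Lemma poly_same_sign (F : realFieldType) (q : {poly F}) a : q.[a] != 0 ->
  exists2 d, 0 < d & forall t, `|t - a| <= d -> 0 < q.[t] * q.[a].
Proof.
move=> qa; have [s sE] : exists s, q - q.[a]%:P = s * ('X - a%:P).
  by apply/factor_theorem; rewrite /root !hornerE subrr.
have [M hM] := poly_disk_bound (s \Po ('X + a%:P)) 1.
pose N := Num.max M 1; have N0 : 0 < N by rewrite lt_max ltr01 orbT.
have q0 : 0 < `|q.[a]| by rewrite normr_gt0.
exists (Num.min 1 (`|q.[a]| / (2 * N))).
  by rewrite lt_min ltr01 divr_gt0 // mulr_gt0.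
move=> t; rewrite le_min => /andP[t1 t2].
have sb : `|s.[t]| <= N.
  have := hM _ t1; rewrite horner_comp !hornerE subrK => h; apply: le_trans h _.
  by rewrite le_max lexx.
have qE : q.[t] = q.[a] + s.[t] * (t - a).
  by have /(congr1 (horner^~ t)) := sE; rewrite !hornerE => <-; rewrite addrC subrK.
have lt : `|s.[t] * (t - a)| < `|q.[a]|.
  rewrite normrM; apply: (le_lt_trans (ler_pM _ _ sb t2)) => //.
  have -> : N * (`|q.[a]| / (2 * N)) = `|q.[a]| / 2 by field; exact: lt0r_neq0.
  by rewrite ltr_pdivrMr // ltr_pMr // ltr1n.
rewrite qE mulrDl -expr2; have : `|s.[t] * (t - a) * q.[a]| < q.[a] ^+ 2.
  by rewrite normrM -(real_normK (num_real q.[a])) expr2 ltr_pM2r.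
by move=> /ltrNnormlW; rewrite -subr_gt0 opprK addrC.
Qed.

Lemma horner_horner (F : comNzRingType) (H : {poly {poly F}}) (t e : F) :
  H.[t%:P].[e] = (map_poly (horner_eval e) H).[t].
Proof.
by have := horner_map (horner_eval e) H t%:P; rewrite /= /horner_eval hornerC => ->.
Qed.

(** The simple zero [theta] at [e = 0] makes [H] change sign between [theta - d] and [theta + d],
    and the change persists for small [e > 0]. [C] is a power of the variable times a polynomial
    nonzero at 0, so it does not vanish at such an [e]. *)
Lemma real_branch (F : rcfType) (H : {poly {poly F}}) (theta : F) (H1 C : {poly F}) :
  map_poly (horner_eval 0) H = ('X - theta%:P) * H1 -> H1.[theta] != 0 -> C != 0 ->
  exists e t, H.[t%:P].[e] = 0 /\ C.[e] != 0.
Proof.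
move=> HE h1 C0; have [d d0 hd] := poly_same_sign h1.
have H0 t : H.[t%:P].[0] = (t - theta) * H1.[t] by rewrite horner_horner HE !hornerE.
have hp : 0 < H1.[theta + d] * H1.[theta] by apply: hd; rewrite addrC addKr gtr0_norm.
have hm : 0 < H1.[theta - d] * H1.[theta] by apply: hd; rewrite addrC addKr normrN gtr0_norm.
have hpm : 0 < H1.[theta + d] * H1.[theta - d].
  have : 0 < (H1.[theta + d] * H1.[theta]) * (H1.[theta - d] * H1.[theta]) by rewrite mulr_gt0.
  by rewrite mulrACA -expr2 pmulr_lgt0 // exprn_even_gt0.
pose Ap := H.[(theta + d)%:P]; pose Am := H.[(theta - d)%:P].
have Ap0 : Ap.[0] = d * H1.[theta + d] by rewrite H0 addrC addKr.
have Am0 : Am.[0] = - d * H1.[theta - d] by rewrite H0 addrC addKr.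
have nz x y : 0 < x * y :> F -> x != 0.
  by move=> h; apply: contraTneq h => ->; rewrite mul0r ltxx.
have [|d1 d10 h1'] := @poly_same_sign _ Ap 0.
  by rewrite Ap0 mulf_neq0 ?(nz _ _ hpm) // gt_eqF.
have [|d2 d20 h2'] := @poly_same_sign _ Am 0.
  by rewrite Am0 mulf_neq0 ?(nz _ _ hm) // oppr_eq0 gt_eqF.
have [l [C1]] := multiplicity_XsubC C 0; rewrite C0 subr0 /= => nC1 CE.
have [|d3 d30 h3'] := @poly_same_sign _ C1 0; first by move: nC1; rewrite /root.
pose e := Num.min d1 (Num.min d2 d3).
have e0 : 0 < e by rewrite !lt_min d10 d20.
have ee : `|e - 0| = e by rewrite subr0 gtr0_norm.
have ae : 0 < Ap.[e] * Ap.[0] by apply: h1'; rewrite ee ge_min lexx.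
have be : 0 < Am.[e] * Am.[0] by apply: h2'; rewrite ee !ge_min lexx orbT.
have ce : C1.[e] != 0 by apply: (nz _ C1.[0]); apply: h3'; rewrite ee !ge_min lexx !orbT.
have opp : Am.[e] * Ap.[e] <= 0.
  have : 0 < (Ap.[e] * Ap.[0]) * (Am.[e] * Am.[0]) by rewrite mulr_gt0.
  rewrite mulrACA Ap0 Am0 [_ * (- d * _)]mulrACA mulrN -expr2 mulNr mulrN oppr_gt0.
  rewrite [X in _ * X < 0]mulrC mulrA pmulr_llt0 ?exprn_even_gt0 ?gt_eqF //.
  by rewrite pmulr_llt0 // mulrC => /ltW.
pose q := map_poly (horner_eval e) H.
(* The factor [Ap.[e]] orients the sign change from nonpositive to nonnegative. *)
have [||t _ /rootP qt] := @poly_ivt F (Ap.[e] *: q) (theta - d) (theta + d).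
- by rewrite lerD2l (le_trans _ (ltW d0)) // oppr_le0 ltW.
- by rewrite !hornerZ -!horner_horner -expr2 sqr_ge0 mulrC opp.
exists e, t; split; last by rewrite CE hornerM mulf_neq0 // horner_exp hornerX expf_neq0 // gt_eqF.
move: qt; rewrite hornerZ -horner_horner => /eqP; rewrite mulf_eq0 => /orP[/eqP Ae|/eqP//].
by move: ae; rewrite Ae mul0r ltxx.
Qed.

Section RealSpecializations.
Variables (R : fieldType) (K : fieldType) (F : rcfType).
Variables (iK : {rmorphism R -> K}) (ik : {rmorphism R -> F}).

Definition real_dense n (y : 'I_n -> K) := forall r, mmap iK y r != 0 ->
  exists z : 'I_n -> F, specializes iK ik y z /\ mmap ik z r != 0.

Lemma affine_real_dense n (y : 'I_n -> K) : affine_model iK y -> real_dense y.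
Proof.
move=> aff r ry; have r0 : r != 0 by apply: contraNneq ry => ->; rewrite rmorph0.
have [D hD] := mpoly_nonvanish ik (natr_neq0 (idr F)) r0.
by exists (fun i => (D i).+1%:R); split=> // p /aff ->; rewrite rmorph0.
Qed.

(** Some nonzero [c] of the base ring lies in the ideal of [h] and [r]. On the line from the
    projection [P'] of [P] to an integral point where [c] is nonzero, reached at parameter 1, [c] is
    not identically zero. Following the simple zero of [h] along this line leads to a real zero of
    [h] at which [c], and therefore [r], does not vanish. *)
Lemma hypersurface_real_dense n (y : 'I_n -> K) (P : 'I_n -> F) : (0 < n)%N ->
  specializes iK ik y P -> hypersurface_model iK ik y P -> real_dense y.
Proof.
case: n y P => // n y P _ sp [h [hp hy [v hv] hgen]] r ry.
have nd : ~ divides h r by move=> [c cE]; move: ry; rewrite cE (rmorphM (mmap iK y)) /= hy mulr0 eqxx.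
have [o [u [H1 [u0 hm hE H10 _]]]] := elim_setup (natr_neq0 (idr F)) hp nd (sp _ hy) hv.
pose P' (j : 'I_n) := P (lift ord_max j) - ik (o j) * P ord_max.
have uu : u%:MP%:P \is a @GRing.unit {poly {mpoly R[n]}}.
  by apply: (rmorph_unit polyC); apply: (rmorph_unit (@mpolyC n R)); rewrite unitfE.
move: hm hE; rewrite -mul_polyC => hm hE.
have hp' : prime_elt (u%:MP%:P * shear o h) by apply: prime_unitM => //; exact: shear_prime.
have [|c c0 [a [b cE]]] := bezout_prime (g := shear o r) hp' hm.
  move=> /(dvd_unitM _ _ uu)[x xE]; apply: nd; exists (unshear o x).
  by apply: (can_inj (@shearK R n o)); rewrite xE (rmorphM (shear o)) /= unshearK.
have [D hD] := mpoly_nonvanish ik (natr_neq0 (idr F)) c0.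
pose w i := (D i).+1%:R - P' i.
pose L : {rmorphism {mpoly R[n]} -> {poly F}} := line ik P' w.
have Lat e p : (L p).[e] = mmap ik (fun i => P' i + w i * e) p by exact: line_at.
have L0 : map_poly (horner_eval 0) (map_poly L (u%:MP%:P * shear o h)) = ('X - (P ord_max)%:P) * H1.
  rewrite -map_poly_comp -[RHS]hE; apply: eq_map_poly => p.
  rewrite /= /horner_eval Lat; apply: eq_mmap => i; by rewrite mulr0 addr0.
have Lc : L c != 0.
  apply: contraNneq hD => Lc; have := Lat 1 c; rewrite Lc horner0 => h1.
  apply/eqP; rewrite [RHS]h1; apply: eq_mmap => i; by rewrite mulr1 /w addrC subrK.
have [e [t [Ht Ce]]] := real_branch L0 H10 Lc.
pose s i := P' i + w i * e.
have [ev [evC evS evE]] : exists ev : {rmorphism {poly {mpoly R[n]}} -> F},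
    [/\ forall q, ev q%:P = mmap ik s q,
      forall q, ev (shear o q) = mmap ik (snoc (fun j => s j + ik (o j) * t) t) q &
      forall q, ev q = (map_poly L q).[t%:P].[e]].
  exists (pev ik s t); split=> q; [exact: pevC | exact: pev_shear|].
  rewrite horner_horner -map_poly_comp /pev /= /horner_eval; congr (_.[t]); apply: eq_map_poly => x.
  by rewrite /= Lat.
have hz : ev (u%:MP%:P * shear o h) = 0 by rewrite evE.
exists (snoc (fun j => s j + ik (o j) * t) t); split.
  move=> p /hgen[x ->]; rewrite (rmorphM (mmap ik _)) /=; move: hz; rewrite (rmorphM ev) evS => /eqP.
  rewrite mulf_eq0 => /orP[/eqP hz|/eqP -> //]; last by rewrite mulr0.
  by have := rmorph_unit ev uu; rewrite /= hz unitr0.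
apply/eqP => rz; case/eqP: Ce; rewrite Lat -evC.
have rz' : ev (shear o r) = 0 := etrans (evS r) rz.
have : ev c%:P = ev a * ev (u%:MP%:P * shear o h) + ev b * ev (shear o r).
  by rewrite [in LHS]cE (rmorphD ev); congr (_ + _); exact: (rmorphM ev).
by rewrite hz rz' !mulr0 addr0.
Qed.

(** With denominators cleared, [-1 = \sum x^2] becomes [r^2 + \sum p^2 = 0] at [y], which fails at a
    real specialisation where [r] is nonzero. *)
Theorem real_dense_formally_real n (y : 'I_n -> K) : generates iK y -> real_dense y ->
  ~ sum_of_powers 2 (- 1 : K).
Proof.
move=> gen dense [l lE].
have [r r0 [s E]] : exists2 r, mmap iK y r != 0 &
    exists s : seq {mpoly R[n]}, mmap iK y (\sum_(p <- s) p ^+ 2) = mmap iK y r ^+ 2 * \sum_(x <- l) x ^+ 2.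
  elim: l {lE} => [|x l [r r0 [s E]]].
    by exists 1; [rewrite rmorph1 oner_neq0 | exists [::]; rewrite !big_nil rmorph0 mulr0].
  have [p [q [q0 xE]]] := gen x; exists (r * q); first by rewrite (rmorphM (mmap iK y)) mulf_neq0.
  exists (r * p :: [seq q * p' | p' <- s]).
  rewrite !big_cons big_map (rmorphD (mmap iK y)) (rmorphXn (mmap iK y)) !(rmorphM (mmap iK y)) /= xE.
  have -> : \sum_(p' <- s) (q * p') ^+ 2 = q ^+ 2 * \sum_(p' <- s) p' ^+ 2.
    by rewrite mulr_sumr; apply: eq_bigr => p' _; rewrite exprMn.
  rewrite (rmorphM (mmap iK y)) (rmorphXn (mmap iK y)) /= E; move: q0.
  move: (mmap iK y q) (mmap iK y p) (mmap iK y r) (\sum_(_ <- _) _) => a b c d a0.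
  by field.
have [z [sp rz]] := dense r r0.
have : mmap iK y (r ^+ 2 + \sum_(p <- s) p ^+ 2) = 0.
  by rewrite (rmorphD (mmap iK y)) /= E (rmorphXn (mmap iK y)) -lE mulrN1 subrr.
move=> /sp; rewrite (rmorphD (mmap ik z)) (rmorphXn (mmap ik z)) rmorph_sum /= => /eqP.
rewrite paddr_eq0 ?sqr_ge0 ?sumr_ge0 // => [|p _]; last by rewrite (rmorphXn (mmap ik z)) sqr_ge0.
by rewrite sqrf_eq0 (negPf rz).
Qed.

Theorem smooth_real_point_formally_real n (y : 'I_n -> K) (P : 'I_n -> F) :
  specializes iK ik y P -> generates iK y -> locally_generated iK ik y P ->
  conormal_injective iK ik y P -> ~ sum_of_powers 2 (- 1 : K).
Proof.
move=> sp gen lg ci.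
have [m [y' [P' [sp' gen' _ alt]]]] := reduce_to_hypersurface (natr_neq0 (idr F)) sp gen lg ci.
apply: (real_dense_formally_real gen'); case: alt => [|[m0]]; first exact: affine_real_dense.
exact: hypersurface_real_dense.
Qed.
End RealSpecializations.

Lemma prime_ideal_ex (D : comNzRingType) (S : D -> Prop) :
  S 0 -> ~ S 1 -> (forall a u v, S u -> S v -> S (a * u + v)) ->
  (forall u v, S (u * v) -> S u \/ S v) -> exists I : prime_idealr D, forall x, x \in I <-> S x.
Proof.
move=> S0 S1 lin pr; pose T : {pred D} := fun x => `[< S x >].
have TP x : reflect (S x) (x \in T) by exact: asboolP.
have idT : idealr_closed T.
  split; [exact/TP | by apply/negP => /TP | by move=> a u v /TP su /TP sv; apply/TP/lin].
have prT : prime_idealr_closed T.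
  by move=> u v /TP/pr[] h; apply/orP; [left|right]; apply/TP.
pose I : prime_idealr D := HB.pack (T : D -> bool) (isIdealr.Build D T idT) (isPrimeIdealrClosed.Build D T prT).
by exists I => x; split=> [/TP|/TP].
Qed.

Lemma projPoint_ex (k : fieldType) n (S : {mpoly k[n.+1]} -> Prop) :
  S 0 -> ~ S 1 -> (forall a u v, S u -> S v -> S (a * u + v)) ->
  (forall u v, S (u * v) -> S u \/ S v) -> (forall p d, S p -> S (pihomog mdeg d p)) ->
  (exists i, ~ S 'X_i) -> exists M : projPoint k n, forall p, p \in M <-> S p.
Proof.
move=> S0 S1 lin pr hom [i nS]; have [I IP] := prime_ideal_ex S0 S1 lin pr.
have hI (p : {mpoly k[n.+1]}) d : p \in I -> pihomog mdeg d p \in I by move=> /IP/hom/IP.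
have hi : exists i : 'I_n.+1, 'X_i \notin I by exists i; apply/negP => /IP.
by exists (ProjPoint hI hi).
Qed.

Section LineThroughOrigin.
Variables (R C : comNzRingType) (f : {rmorphism R -> C}) (n : nat) (x : 'I_n.+1 -> C).

(** The parameter of the line records the degree, so a condition on every coefficient of the
    restriction is a condition on every homogeneous component. Homogeneous ideals are obtained in
    this way. *)
Lemma line_homog d (p : {mpoly R[n.+1]}) : p \is d.-homog ->
  line f (fun=> 0) x p = (mmap f x p) *: 'X^d.
Proof.
move=> hp; have E : (fun i => 0%:P + (x i)%:P * 'X) =1 (fun i => 'X * (x i)%:P).
  by move=> i; rewrite polyC0 add0r mulrC.
rewrite /line (eq_mmap _ E) (mmap_homog _ _ _ hp) -mul_polyC mulrC; congr (_ * _).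
by rewrite (rmorph_mmap f polyC).
Qed.

Lemma line_coef d (p : {mpoly R[n.+1]}) :
  (line f (fun=> 0) x p)`_d = mmap f x (pihomog mdeg d p).
Proof.
have sz := leq_maxl (msize p) d.+1.
rewrite {1}(homog_partition sz : p = _) (rmorph_sum (line _ _ _)) coef_sum /=.
have ld : (d < maxn (msize p) d.+1)%N by rewrite leq_max ltnSn orbT.
rewrite (bigD1 (Ordinal ld)) //= (line_homog (pihomogP _ _ _)) coefZ coefXn eqxx mulr1.
rewrite big1 ?addr0 // => i ne; rewrite (line_homog (pihomogP _ _ _)) coefZ coefXn.
have -> : (d == i)%N = false by apply: contraNF ne => /eqP E; apply/eqP/val_inj.
by rewrite mulr0.
Qed.
End LineThroughOrigin.

Section RealPoint.
Variables (R : fieldType) (n : nat) (x : 'I_n.+1 -> R).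

(* The ideal of [x] is the kernel of the substitution of [x_i T] for [X_i]. *)
Lemma real_point_ex : (exists i, x i != 0) -> exists M : projPoint R n,
  (forall d p, p \is d.-homog -> (mmap (idr R) x p == 0) = (p \in M)) /\
  (forall X : projPoint R n, (forall p, p \in X -> mmap (idr R) x p = 0) -> point_of X M).
Proof.
move=> [i xi]; pose S (p : {mpoly R[n.+1]}) := line (idr R) (fun=> 0) x p = 0.
have SP p : S p <-> forall d, mmap (idr R) x (pihomog mdeg d p) = 0.
  split=> [Sp d|h]; first by rewrite -line_coef Sp coef0.
  by apply/polyP => d; rewrite line_coef h coef0.
have Sh d p : p \is d.-homog -> mmap (idr R) x p = 0 <-> S p.
  move=> hp; rewrite /S (line_homog _ _ hp); split=> [->|/eqP]; first by rewrite scale0r.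
  by rewrite scale_poly_eq0 -size_poly_eq0 size_polyXn orbF => /eqP.
have [||||||M MP] := @projPoint_ex R n S.
- by rewrite /S rmorph0.
- by rewrite /S rmorph1 => /eqP; rewrite oner_eq0.
- by move=> a u v Su Sv; rewrite /S rmorphD rmorphM /= Su Sv mulr0 addr0.
- by move=> u v /eqP; rewrite /S rmorphM mulf_eq0 => /orP[] /eqP ->; [left|right].
- by move=> p d /SP h; apply/(Sh d); rewrite ?pihomogP.
- exists i => /(Sh _ _ (dhomog_var R i)); rewrite mmapXi => xi0.
  by rewrite xi0 eqxx in xi.
exists M; split=> [d p hp|X hX p pX]; first by apply/eqP/idP => [/(Sh _ _ hp)/MP//|/MP/(Sh _ _ hp)].
apply/MP/SP => d; apply: hX.
by case: X pX => I h1 h2 /=; exact: h1.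
Qed.
End RealPoint.

Theorem function_field_formally_real (R : rcfType) n (X : projPoint R n) (x : 'I_n.+1 -> R) :
  smooth X -> (exists i, x i != 0) -> (forall p, p \in X -> p.@[x] = 0) ->
  ~ sum_of_powers 2 (- 1 : function_field X).
Proof.
move=> sm xi hx; have [M [phiM XM']] := real_point_ex xi.
have XM : point_of X M by apply: XM' => p /hx; apply: etrans.
have [j [c [g [J [jM gX gen [Jj jac]]]]]] := sm M XM.
exact: (smooth_real_point_formally_real (affine_specializes phiM XM jM) (affine_generates (contra (XM _) jM))
  (affine_locally_generated phiM XM jM gX gen) (affine_conormal_injective phiM XM jM gX gen Jj jac)).
Qed.

(** * Bounded elements *)

Section PrimeIdeals.
Variables (K : fieldType) (S : K -> Prop).
Hypothesis rS : ring_pred S.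

Definition ideal_in (Q : K -> Prop) :=
  [/\ Q 0, ~ Q 1, forall x, Q x -> S x & forall a u v, S a -> Q u -> Q v -> Q (a * u + v)].

Lemma prime_ideal_above (J : K -> Prop) : ideal_in J -> exists2 Q, ideal_in Q /\ (forall x, J x -> Q x) &
  forall u v, S u -> S v -> Q (u * v) -> Q u \/ Q v.
Proof.
move=> [J0 J1 JS Jl].
(* Joining [B] with [J] gives the empty chain an upper bound. *)
pose Pr (B : classical_sets.set K) := ideal_in (fun x => J x \/ B x).
have [|A [[A0 A1 AS Al] Amax]] := @classical_sets.Zorn_bigcup K Pr.
  move=> F FP tot; split; [by left | | |].
  - by move=> [//|[B FB B1]]; have [_ nB _ _] := FP B FB; apply: nB; right.
  - move=> x [/JS//|[B FB Bx]]; have [_ _ sB _] := FP B FB; apply: sB; by right.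
  - have up (B : K -> Prop) a u v : F B -> S a -> J u \/ B u -> J v \/ B v ->
        J (a * u + v) \/ classical_sets.bigcup F id (a * u + v).
      move=> FB Sa Bu Bv; have [_ _ _ lB] := FP B FB.
      by have [|h] := lB a u v Sa Bu Bv; [left | right; exists B].
    move=> a u v Sa [Ju|[B FB Bu]] [Jv|[B' FB' Bv]].
    + by left; apply: Jl.
    + by apply: (up B' a u v FB' Sa); [left | right].
    + by apply: (up B a u v FB Sa); [right | left].
    + have [s|s] := tot B B' FB FB'; [apply: (up B' a u v FB' Sa) | apply: (up B a u v FB Sa)]; right=> //;
        exact: s.
exists (fun x => J x \/ A x); first by split=> //; left.
move=> u v Su Sv Quv; apply: contrapT => /not_orP[nu nv].
pose Q' x := exists q s, [/\ J q \/ A q, S s & x = q + s * u].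
have [Q1|nQ1] := pselect (Q' 1).
  have [q [s [Qq Ss E]]] := Q1; apply: nv; rewrite -[v]mul1r E mulrDl -mulrA addrC.
  by apply: (Al) => //; rewrite mulrC -[v * q]addr0; exact: Al.
have QS x : J x \/ A x -> Q' x.
  by move=> Qx; exists x, 0; rewrite mul0r addr0; split=> //; exact: ring_pred0.
have Q'u : Q' u.
  by exists 0, 1; rewrite mul1r add0r; split=> //; exact: ring_pred1.
apply: (Amax Q'); first by split=> [x Ax|sub]; [apply: QS; right | apply: nu; right; exact: sub].
have E x : (J x \/ Q' x) -> Q' x by move=> [Jx|//]; apply: QS; left.
split; [by left | by move=> /E | |].
  by move=> x /E[q [s [Qq Ss ->]]]; apply: ring_predD => //; [exact: AS | exact: ring_predM].
move=> a x y Sa /E[q [s [Qq Ss ->]]] /E[q' [s' [Qq' Ss' ->]]]; right.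
exists (a * q + q'), (a * s + s'); split; first exact: Al.
  by apply: ring_predD => //; exact: ring_predM.
by ring.
Qed.

(** Gauss's argument with the lowest coefficients outside [Q]. *)
Lemma poly_prime_ideal (Q : K -> Prop) (p q : {poly K}) : ideal_in Q ->
  (forall u v, S u -> S v -> Q (u * v) -> Q u \/ Q v) ->
  (forall d, S p`_d) -> (forall d, S q`_d) -> (forall d, Q (p * q)`_d) ->
  (forall d, Q p`_d) \/ (forall d, Q q`_d).
Proof.
move=> [Q0 Q1 QS Ql] Qp Sp Sq pq; apply: contrapT => /not_orP[/existsNP np /existsNP nq].
have ex (r : {poly K}) : (exists d, ~ Q r`_d) -> exists d, ~ Q r`_d /\ forall i, (i < d)%N -> Q r`_i.
  move=> [d nd]; have [|m /asboolP nm min] := @ex_minnP (fun d => `[< ~ Q r`_d >]).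
    by exists d; apply/asboolP.
  exists m; split=> // i lt; apply: contrapT => ni.
  by have := min i; rewrite leqNgt lt => /(_ (asboolT ni)).
have QD u v : Q u -> Q v -> Q (u + v).
  by move=> hu hv; rewrite -[u]mul1r; apply: (Ql) => //; exact: ring_pred1.
have QM a u : S a -> Q u -> Q (a * u).
  by move=> Sa hu; rewrite -[_ * _]addr0; apply: Ql.
have [a [na la]] := ex _ np; have [b [nb lb]] := ex _ nq.
suff : Q p`_a \/ Q q`_b by case.
apply: Qp => //; have := pq (a + b)%N; rewrite coefM.
have la' : (a < (a + b).+1)%N by rewrite ltnS leq_addr.
rewrite (bigD1 (Ordinal la')) //= addKn => h.
set s := (X in Q (_ + X)) in h; have Qs : Q s.
  apply: (big_ind Q) => // i ne; have [lt|] := ltnP i a; first by rewrite mulrC; apply: QM; last exact: la.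
  rewrite leq_eqVlt => /orP[/eqP E|gt].
    by case/eqP: ne; apply: val_inj.
  by apply: QM => //; apply: lb; rewrite ltn_subLR ?ltn_add2r // -ltnS.
rewrite -[_ * _](addrK s); apply: QD => //; rewrite -[- s]mulN1r; apply: QM => //.
by apply: ring_predN => //; exact: ring_pred1.
Qed.
End PrimeIdeals.

Section ExtraBounds.
Variables (R : realType) (K : fieldType) (iota : {rmorphism R -> K}).

Lemma sbounded_ring : ring_pred (sbounded iota).
Proof.
split; [by rewrite -(rmorph0 iota); exact: sbounded_const | by rewrite -(rmorph1 iota); exact: sbounded_const | |].
  by move=> x y bx bY; apply: sboundedD => //; apply: sboundedN.
exact: sboundedM.
Qed.

(** [x^2 <= (x^4 + 1) / 2]. *)
Lemma sbounded_sqr x : sbounded iota (x ^+ 2) -> sbounded iota x.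
Proof.
move=> [C hC]; exists ((C + 1) / 2); rewrite /ple.
have n2 : (2 : K) != 0 := natr_neq0 iota 1.
have -> : iota ((C + 1) / 2) - x ^+ 2 = ((iota C - (x ^+ 2) ^+ 2) + (x ^+ 2 - 1) ^+ 2) / 2.
  by rewrite fmorph_div rmorphD rmorph1 rmorph_nat; field.
apply: sum_of_powers_div; last exact: sum_of_powers_nat.
by apply: sum_of_powersD => //; exact: sum_of_powersX.
Qed.

Lemma sbounded_le x z : sum_of_powers 2 x -> ple x z -> sbounded iota z -> sbounded iota x.
Proof. by move=> sx xz [C hC]; exists C; apply: ple_trans hC; apply: pleX. Qed.

Local Notation sos := (@sum_of_powers K 2).
Local Notation bounded := (sbounded iota).

Variable f : K.
Hypothesis f0 : f != 0.

(** The convex ideal generated by the bounded multipliers [c] that make [f c] a sum of squares.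
    Domination of [x] by one [c], in place of a linear combination, is what lets a statement about
    ideals yield a single multiplier. *)
Definition dominated (x : K) :=
  exists c C, [/\ sos (f * c), bounded c & ple (x ^+ 2) (iota C * c ^+ 2)].

(** [c c' = (f c) (f c') / f^2] is a sum of squares, so [(c + c')^2] dominates both [c^2] and
    [c'^2]. *)
Lemma dominated_ideal : ~ dominated 1 -> ideal_in bounded dominated.
Proof.
have sm (a b : K) : sos a -> sos b -> sos (a * b) := @sum_of_powersM _ 2 a b.
have pos (C : R) : 0 <= C -> sos (iota C) := @sos_pos _ _ iota C.
have up (C C' : R) (c : K) : C <= C' -> ple (iota C * c ^+ 2) (iota C' * c ^+ 2).
  by move=> le; rewrite ![_ * c ^+ 2]mulrC; apply: ple_pM; [exact: sum_of_powersX | exact: ple_const].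
have nn x c C : ple (x ^+ 2) (iota C * c ^+ 2) -> ple (x ^+ 2) (iota `|C| * c ^+ 2).
  move=> h; apply: (ple_trans h); apply: up; exact: ler_norm.
move=> n1; split=> //.
- exists 0, 0; rewrite mulr0 expr0n mulr0; split; [exact: sum_of_powers0 | | exact: ple_refl].
  exact: (ring_pred0 sbounded_ring).
- move=> x [c [C [_ [D hD] /nn hx]]]; exists (`|C| * D); apply: (ple_trans hx).
  by rewrite rmorphM; apply: ple_pM => //; apply: pos.
move=> a u v [A hA] [c [C [fc bc /nn hu]]] [c' [C' [fc' bc' /nn hv]]].
exists (c + c'), (2 * (`|A| * `|C| + `|C'|)); split.
- by rewrite mulrDr; apply: sum_of_powersD.
- exact: sboundedD.
have cc : sos (c * c').
  have -> : c * c' = (f * c) * (f * c') / f ^+ 2 by field.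
  by apply: sum_of_powers_div; [exact: sm | exact: sum_of_powersX].
have ha : ple (a ^+ 2) (iota `|A|) by apply: (ple_trans hA); apply: ple_const; exact: ler_norm.
have hau : ple ((a * u) ^+ 2) (iota (`|A| * `|C|) * c ^+ 2).
  rewrite exprMn rmorphM -mulrA; apply: pleM => //; exact: sum_of_powersX.
apply: (ple_trans (ple_sqrD _ _)); rewrite rmorphM rmorph_nat -mulrA.
apply: ple_pM; first exact: sum_of_powers_nat.
apply: (ple_trans (pleD hau hv)).
rewrite rmorphD mulrDl /ple; set B := iota (_ * _); set B' := iota `|C'|.
have -> : B * (c + c') ^+ 2 + B' * (c + c') ^+ 2 - (B * c ^+ 2 + B' * c' ^+ 2) =
  B * (c' ^+ 2) + B' * c ^+ 2 + 2 * ((B + B') * (c * c')) by ring.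
have sB : sos B by apply: pos; rewrite mulr_ge0.
have sB' : sos B' by apply: pos.
apply: sum_of_powersD; last by apply: (sm); [exact: sum_of_powers_nat | apply: (sm) => //; exact: sum_of_powersD].
by apply: sum_of_powersD; apply: (sm) => //; exact: sum_of_powersX.
Qed.

Theorem dominated1_so4 : ~ sos (- 1) -> dominated 1 -> sum_of_powers 4 (f ^+ 2).
Proof.
move=> real [c [C [fc bc]]]; rewrite expr1n => h1.
have n12 : (12 : K) != 0 := natr_neq0 iota 11.
have c0 : c != 0.
  apply: contra_notN real => /eqP c0; move: h1; rewrite c0 expr0n mulr0.
  by rewrite /ple sub0r.
have -> : f ^+ 2 = (f * c) ^+ 2 / c ^+ 2 by field.
apply: sum_of_powers_div; first exact: so4_sqr.
pose E := `|C| + 1; have E0 : 0 < E by rewrite ltr_wpDl.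
apply: (so4_bounded_pos (iota := iota) (e := E^-1)); first by rewrite invr_gt0.
  by apply: (ring_predX sbounded_ring).
have hE : ple 1 (iota E * c ^+ 2).
  apply: (ple_trans h1); rewrite ![_ * c ^+ 2]mulrC; apply: ple_pM; first exact: sum_of_powersX.
  by apply: ple_const; rewrite (le_trans (ler_norm _)) // lerDl.
have := ple_pM (@sos_pos _ _ iota _ (ltW (etrans (invr_gt0 E) E0))) hE.
by rewrite mulr1 mulrA -rmorphM mulVf ?gt_eqF // rmorph1 mul1r.
Qed.

Lemma local_multiplier (F : fieldType) (u a b g T : F) : T != 0 -> u * b = a * g ->
  u * (a * b ^+ 3 / (T * T)) = (a * b / T) ^+ 2 * g.
Proof.
move=> T0 E; have -> : u * (a * b ^+ 3 / (T * T)) = (u * b) * a * b ^+ 2 / (T * T) by field.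
by rewrite E; field.
Qed.

Lemma homog_rescale (F : fieldType) (a N P : F) e :
  (a / N) ^+ (e + e) * P = (a ^+ 2 / N) ^+ e * (P / N ^+ e).
Proof. by rewrite !exprMn -exprVn !exprD; ring. Qed.

End ExtraBounds.

Lemma mmap_in_ring (R : comNzRingType) (K : fieldType) (f : {rmorphism R -> K}) (S : K -> Prop) n
    (v : 'I_n -> K) (p : {mpoly R[n]}) :
  ring_pred S -> (forall c, S (f c)) -> (forall i, S (v i)) -> S (mmap f v p).
Proof.
move=> rS Sf Sv; move: p; apply: mpoly_ring_ind => [c|l|p q bp bq|p q bp bq].
- by rewrite mmapC; exact: Sf.
- by rewrite mmapXi; exact: Sv.
- by rewrite (rmorphD (mmap f v)); apply: ring_predD.
- by rewrite (rmorphM (mmap f v)); apply: ring_predM.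
Qed.

(** * From local presentations to a global multiplier *)

Section Becker.
Variables (R : realType) (n : nat) (X : projPoint R n).
Local Notation K := (function_field X).
Local Notation iK := (@const_field _ _ X).
Hypothesis real : ~ sum_of_powers 2 (- 1 : K).
Variable j : 'I_n.+1.
Hypothesis jX : 'X_j \notin X.
Local Notation y := (affine_coord X j).
Local Notation sos := (@sum_of_powers K 2).
Local Notation bounded := (sbounded iK).

Let N : K := \sum_i y i ^+ 2.

Lemma affine_coord_j : y j = 1.
Proof. by apply: val_inj; rewrite (affine_coordE jX) rmorph1 divff // (frac_coord_j jX). Qed.

Lemma norm_neq0 : N != 0.
Proof.
apply: contra_notN real => /eqP; rewrite /N (bigD1 j) //= affine_coord_j expr1n addrC => /eqP.
rewrite addr_eq0 => /eqP <-; apply: sum_of_powers_sum => i _; exact: sum_of_powersX.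
Qed.

Lemma norm_sos : sos N.
Proof. by apply: sum_of_powers_sum => i _; exact: sum_of_powersX. Qed.

Lemma coord_sqr_bounded i : bounded (y i ^+ 2 / N).
Proof.
apply: (sbounded_le _ _ (sbounded_const iK 1)).
  by apply: sum_of_powers_div; [exact: sum_of_powersX | exact: norm_sos].
rewrite rmorph1 /ple -[X in X - _](divff norm_neq0) -mulrBl.
apply: sum_of_powers_div; last exact: norm_sos.
rewrite /N (bigD1 i) //= addrAC subrr add0r; apply: sum_of_powers_sum => l _; exact: sum_of_powersX.
Qed.

Lemma coord_prod_bounded l i : bounded (y l * y i / N).
Proof.
apply: sbounded_sqr; have -> : (y l * y i / N) ^+ 2 = (y l ^+ 2 / N) * (y i ^+ 2 / N).
  by rewrite !exprMn [RHS]mulrACA -[N^-1 * N^-1]expr2.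
by apply: sboundedM; exact: coord_sqr_bounded.
Qed.

(** The square of a monomial of degree [2 e] divided by [N^e] is a product of factors
    [y_i^2 / N]. *)
Lemma homog_bounded e (p : {mpoly R[n.+1]}) : p \is (e + e)%N.-homog -> bounded (mmap iK y p / N ^+ e).
Proof.
have rb := sbounded_ring iK.
move=> /dhomogP hp; rewrite (mpolyE p) rmorph_sum mulr_suml big_seq.
apply: (big_ind bounded) => [||m mp]; [exact: (ring_pred0 rb) | exact: (ring_predD rb) |].
rewrite /= mmapZ mmapX -mulrA; apply: (ring_predM rb); first exact: sbounded_const.
have hm : mdeg m = (e + e)%N := hp _ mp.
apply: sbounded_sqr; rewrite exprMn exprVn -exprM muln2 -addnn -hm mdegE expr_sum.
rewrite /mmap1 -prodrXl -prodfV -big_split /=.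
apply: (big_ind bounded) => [||i _]; [exact: (ring_pred1 rb) | exact: (ring_predM rb) |].
by rewrite -exprM mulnC exprM -exprVn -exprMn; apply: (ring_predX rb); exact: coord_sqr_bounded.
Qed.

Variable f : K.
Hypothesis f0 : f != 0.

Hypothesis local : forall M, point_of X M -> exists d (F G : {mpoly R[n.+1]}) g,
  [/\ F \is d.-homog, G \is d.-homog, (F \notin M) && (G \notin M), sos g
    & f * mmap iK y G = mmap iK y F * g].

(* If the multipliers [F G^3 / N^(2d)] of the local presentations did not generate the unit ideal of
   the ring of bounded elements, a prime ideal containing them would cut out a point of [X] where all
   of them vanish. *)
Lemma dominated1 : dominated iK f 1.
Proof.
have rb := sbounded_ring iK.
apply: contrapT => /(dominated_ideal f0) idJ; have [Q [[Q0 Q1 QS Ql] JQ] Qp] := prime_ideal_above rb idJ.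
have idQ : ideal_in bounded Q by [].
have QM a u : bounded a -> Q u -> Q (a * u) by move=> Sa hu; rewrite -[_ * _]addr0; apply: (Ql).
have QD u v : Q u -> Q v -> Q (u + v).
  by move=> hu hv; rewrite -[u]mul1r; apply: (Ql) => //; exact: (ring_pred1 rb).
(* The elements [y_i^2 / N] add up to 1, so [Q] does not contain all of them. *)
have [i wi] : exists i, ~ Q (y i ^+ 2 / N).
  apply: contrapT => /forallNP H; apply: Q1; rewrite -(divff norm_neq0) {1}/N mulr_suml.
  by apply: (big_ind Q) => // i _; apply: contrapT; exact: H.
(* The vector [y] multiplied by [y_i / N]: the same projective point with bounded coordinates, one
   of them outside [Q]. *)
have [D [DE Di bDl]] : exists D : 'I_n.+1 -> K,
    [/\ D =1 (fun l => (y i / N) * y l), D i = y i ^+ 2 / N & forall l, bounded (D l)].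
  exists (fun l => y l * y i / N); split=> [l||l]; last exact: coord_prod_bounded.
    by rewrite -mulrA mulrC.
  by rewrite -expr2.
have [lp [lpH lpC]] : exists lp : {rmorphism {mpoly R[n.+1]} -> {poly K}},
    (forall d p, p \is d.-homog -> lp p = (mmap iK D p) *: 'X^d) /\
    (forall d p, (lp p)`_d = mmap iK D (pihomog mdeg d p)).
  by exists (line iK (fun=> 0) D); split=> d p; [exact: line_homog | exact: line_coef].
have evD d p : p \is d.-homog -> mmap iK D p = (y i / N) ^+ d * mmap iK y p.
  by move=> hp; rewrite (eq_mmap _ DE) (mmap_homog _ _ _ hp).
have bD p : bounded (mmap iK D p) := mmap_in_ring p rb (sbounded_const iK) bDl.
have blp d p : bounded (lp p)`_d by rewrite lpC.
pose S p := forall d, Q (lp p)`_d.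
have Sh d p : p \is d.-homog -> S p <-> Q (mmap iK D p).
  move=> hp; split=> [/(_ d)|h e]; first by rewrite (lpH _ _ hp) coefZ coefXn eqxx mulr1.
  by rewrite (lpH _ _ hp) coefZ coefXn; case: eqP; rewrite ?mulr1 ?mulr0.
have [||||||M MP] := @projPoint_ex R n S.
- by move=> d; rewrite rmorph0 coef0.
- by move=> /(_ 0%N); rewrite rmorph1 coefC eqxx.
- move=> a u v Su Sv d; rewrite (rmorphD lp) (rmorphM lp) coefD coefM; apply: (QD); last exact: Sv.
  by apply: (big_ind Q) => [//||l _]; [exact: (QD) | apply: (QM); [exact: blp | exact: Su]].
- move=> u v Suv; apply: (poly_prime_ideal rb idQ Qp) => // d.
  by have := Suv d; rewrite (rmorphM lp).
- move=> p d Sp; apply/(Sh d); first exact: pihomogP.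
  by rewrite -lpC.
- by exists i => /(Sh _ _ (dhomog_var R i)); rewrite mmapXi Di.
have XM : point_of X M.
  move=> p pX; apply/MP => d; rewrite lpC (evD _ _ (pihomogP _ _ _)).
  have : pihomog mdeg d p \in X by case: X pX => I h1 h2 /=; exact: h1.
  by rewrite -(affine_eval_homog_eq0 jX (pihomogP _ _ _)) => /eqP ->; rewrite mulr0.
have [d [F [G [g [hF hG /andP[nF nG] sg E]]]]] := local XM.
have hP : F * G ^+ 3 \is (d + d + (d + d))%N.-homog.
  have := dhomogM hF (dhomogMn 3 hG); congr (_ \is _.-homog); lia.
suff : F * G ^+ 3 \in M by rewrite prime_idealrM (negPf nF) !exprS mulr1 !prime_idealrM (negPf nG).
apply/MP/(Sh _ _ hP); rewrite (evD _ _ hP).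
set P := mmap iK y (F * G ^+ 3).
(* At [D], the form [F G^3] of degree [4 d] takes the value of the multiplier [F G^3 / N^(2 d)]
   times the bounded factor [(y_i^2 / N)^(2 d)]. *)
have -> : (y i / N) ^+ (d + d + (d + d)) * P = (y i ^+ 2 / N) ^+ (d + d) * (P / N ^+ (d + d)) by exact: homog_rescale.
apply: QM; first by apply: (ring_predX rb); exact: coord_sqr_bounded.
apply: JQ; exists (P / N ^+ (d + d)), 1; split; last by rewrite rmorph1 mul1r; exact: ple_refl.
  have -> : f * (P / N ^+ (d + d)) = (mmap iK y F * mmap iK y G / N ^+ d) ^+ 2 * g.
    rewrite /P (rmorphM (mmap iK y)) (rmorphXn (mmap iK y)) /= exprD.
    exact: local_multiplier (expf_neq0 d norm_neq0) E.
  by apply: sum_of_powersM => //; exact: sum_of_powersX.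
exact: homog_bounded.
Qed.

Theorem so4_of_local_sos : sum_of_powers 4 (f ^+ 2).
Proof. exact: (dominated1_so4 real dominated1). Qed.

End Becker.

(** * The squaring map *)

Lemma mulf_div_eq1 (L : fieldType) (a b c d : L) : b != 0 -> d != 0 -> a / b * (c / d) = 1 -> a * c = b * d.
Proof. by move=> b0 d0 E; rewrite -[RHS]mul1r -E; field; apply/andP. Qed.

Lemma mulf_divK (L : fieldType) (a b c : L) : b != 0 -> a / b * (b / c) = a / c.
Proof. by move=> b0; rewrite mulrA mulfVK. Qed.

(** If [F'/G'] is the inverse of [u = F/G], then [F F' - G G'] lies in [X], hence in [M]; as [G G']
    is outside [M], so is [F]. *)
Lemma local_unit_homog (R : fieldType) n (X M : projPoint R n) j (u : function_field X) :
  'X_j \notin X -> point_of X M -> local_unit M u -> exists d (F G : {mpoly R[n.+1]}),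
  [/\ F \is d.-homog, G \is d.-homog, (F \notin M) && (G \notin M) &
    u * mmap (@const_field _ _ X) (affine_coord X j) G = mmap (@const_field _ _ X) (affine_coord X j) F].
Proof.
move=> jX XM [[d [F [G [hF hG nG uE]]]] [v [d' [F' [G' [hF' hG' nG' vE]]]] uv]].
have GX : frac_coord X G != 0 by rewrite frac_coord_eq0; apply: contra nG; exact: XM.
have GX' : frac_coord X G' != 0 by rewrite frac_coord_eq0; apply: contra nG'; exact: XM.
have uE' : val u = frac_coord X F / frac_coord X G := uE.
have vE' : val v = frac_coord X F' / frac_coord X G' := vE.
exists d, F, G; split=> //.
  rewrite nG andbT; apply: contra nG => FM.
  have : F * F' - G * G' \in X.
    rewrite -frac_coord_eq0 rmorphB !rmorphM subr_eq0 /=; apply/eqP.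
    apply: (mulf_div_eq1 GX GX').
    by have := congr1 val uv; rewrite rmorphM rmorph1 /= uE' vE'.
  move=> /XM; rewrite rpredBl ?prime_idealrM ?FM //.
  by rewrite (negPf nG') orbF.
apply: val_inj; rewrite rmorphM /= (affine_eval_homog jX hG) (affine_eval_homog jX hF) uE'.
exact: (mulf_divK _ _ GX).
Qed.

Lemma projPoint_var (k : fieldType) n (X : projPoint k n) : exists j : 'I_n.+1, 'X_j \notin X.
Proof. by case: X. Qed.

Theorem DX_sqr_so4 (R : realType) n (X : projPoint R n) (f : Kstar (function_field X)) :
  ~ sum_of_powers 2 (- 1 : function_field X) -> f \in DX X -> sum_of_powers 4 (val f ^+ 2).
Proof.
move=> real /asboolP Df; have [j jX] := projPoint_var X.
apply: (so4_of_local_sos real jX (valP f)) => M XM.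
have [u [g [uu sg fE]]] := Df M XM.
have [d [F [G [hF hG nFG E]]]] := local_unit_homog jX XM uu.
by exists d, F, G, g; split=> //; rewrite fE mulrAC E.
Qed.

Lemma so4_sqr_DX (R : rcfType) n (X : projPoint R n) (f : Kstar (function_field X)) :
  smooth X -> sum_of_powers 4 (val f ^+ 2) -> f \in DX X.
Proof.
move=> sm s4; apply/asboolP => M XM.
exact: (so4_local_unit_sos XM (sm M XM) (valP f) s4).
Qed.

Local Open Scope quotient_scope.

Section SquaringMap.
Variables (K : fieldType) (A B A' B' : groupClosed (Kstar K)).
Hypotheses (AA : forall x, x \in A -> (x ^+ 2)%g \in A') (BB : forall x, x \in B -> (x ^+ 2)%g \in B').

Definition sqr_sub (x : subgroup A) : subgroup A' := Sub (val x ^+ 2)%g (AA (valP x)).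

Lemma val_sqr_sub x : val (sqr_sub x) = (val x ^+ 2)%g.
Proof. by []. Qed.

Definition sqr_subquot (x : subquot A B) : subquot A' B' := \pi_(subquot A' B') (sqr_sub (repr x)).

Lemma sqr_subquot_pi (x : subgroup A) :
  sqr_subquot (\pi_(subquot A B) x) = \pi_(subquot A' B') (sqr_sub x).
Proof.
apply/(@subquot_eqP K A' B' (sqr_sub _) (sqr_sub x)).
rewrite !val_sqr_sub.
have := BB (@repr_subquot K A B x); set a := val _; set b := val _.
have <- // : ((a / b) ^+ 2 = a ^+ 2 / b ^+ 2)%g.
by apply: val_inj; rewrite !expg2 !(val_KstarM, val_KstarV) invfM mulrACA.
Qed.

Fact sqr_subquot_is_multiplicative : {morph sqr_subquot : x y / (x * y)%g}.
Proof.
move=> a b; elim/quotW: a => x; elim/quotW: b => y; rewrite [X in sqr_subquot X = _](@subquot_piM K A B x y) !sqr_subquot_pi.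
rewrite [RHS](@subquot_piM K A' B'); congr (\pi_(subquot A' B') _); apply: val_inj.
rewrite valM !val_sqr_sub valM; apply: val_inj; rewrite !expg2 !val_KstarM; exact: mulrACA.
Qed.
HB.instance Definition _ :=
  isMultiplicative.Build (subquot A B) (subquot A' B') sqr_subquot sqr_subquot_is_multiplicative.

Lemma sqr_subquot_ex : exists sq : {multiplicative subquot A B -> subquot A' B'},
  forall x, sq (\pi_(subquot A B) x) = \pi_(subquot A' B') (sqr_sub x).
Proof. by exists sqr_subquot => x; exact: sqr_subquot_pi. Qed.
End SquaringMap.

Theorem mainTheorem2 (R : realType) (n : nat) (X : projPoint R n) :
  smooth X -> absolutely_irreducible X -> has_real_point X ->
  let K := function_field X in
  exists sq : {multiplicative subquot (DX X) (sosK K) ->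
                              subquot (sq_so4K K) (sosK2 K)},
    (forall d : subgroup (DX X), exists2 e : subgroup (sq_so4K K),
        val e = (val d ^+ 2)%g &
        sq (\pi_(subquot (DX X) (sosK K)) d)
        = \pi_(subquot (sq_so4K K) (sosK2 K)) e) /\
    short_exact (quot_incl (sosK K) (pm1K_sub_DX X)) sq.
Proof.
move=> sm _ [x xi hx] K.
have real : ~ sum_of_powers 2 (- 1 : K) := function_field_formally_real sm xi hx.
have AA d : d \in DX X -> (d ^+ 2)%g \in sq_so4K K.
  move=> hd; apply/asboolP; split; first by exists d.
  by rewrite expg2 val_KstarM -expr2; exact: DX_sqr_so4 real hd.
have BB d : d \in sosK K -> (d ^+ 2)%g \in sosK2 K by move=> hd; apply/asboolP; exists d.
have [sq sqE] := sqr_subquot_ex AA BB; exists sq; split.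
  by move=> d; exists (sqr_sub AA d); [exact: val_sqr_sub | exact: sqE].
split.
(* If [1] and [-1] had the same class, [-1] would be a sum of squares. *)
- move=> a b /subquot_eqP; rewrite !SubK => /asboolP; rewrite val_KstarM val_KstarV.
  have := valP a; have := valP b; rewrite !unfold_in => hb ha s; apply/val_inj/val_inj.
  by move: ha hb s => /orP[] /eqP -> /orP[] /eqP ->; rewrite ?invrN invr1 ?mulrN ?mulNr ?mulr1.
- elim/quotW=> d; rewrite sqE; split.
    move=> /subquot_eqP; rewrite val1 val_sqr_sub divg1 => /asboolP[g sg /(congr1 val)].
    rewrite !expg2 !val_KstarM -!expr2 => /eqP; rewrite eqf_sqr => dg.
    have hx0 : (val d / g)%g \in pm1K K.
      rewrite unfold_in val_KstarM val_KstarV.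
      by case/orP: dg => /eqP ->; rewrite ?mulNr divff ?eqxx ?orbT //; exact: (valP g).
    exists (Sub (val d / g)%g hx0); apply/subquot_eqP; rewrite !SubK.
    by have -> : (val d / g / val d = g^-1)%g;
      [rewrite Kstar_mulC mulgA mulVg mul1g | rewrite gpredV].
  move=> [a /subquot_eqP]; rewrite SubK => ad; apply/subquot_eqP; rewrite val1 val_sqr_sub divg1.
  (* Since [a^2 = 1], the inverse of [a / d] has square [d^2]. *)
  apply/asboolP; exists (val a / val d)^-1%g; first by rewrite gpredV.
  have a2 : val (val a) ^+ 2 = 1 by case/orP: (valP a) => /eqP ->; rewrite ?sqrrN expr1n.
  apply: val_inj; rewrite !expg2 !(val_KstarM, val_KstarV) invf_div -!expr2 expr_div_n a2 divr1.
  by [].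
- elim/quotW=> e; have /asboolP[[h hE] s4] := valP e.
  have hD : h \in DX X by apply: so4_sqr_DX => //; move: s4; rewrite hE expg2 val_KstarM -expr2.
  exists (\pi_(subquot (DX X) (sosK K)) (Sub h hD)); rewrite sqE.
  by congr (\pi_(subquot _ _) _); apply: val_inj; rewrite !SubK hE.
Qed.
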